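(* Suppose that $v$ satisfies Assumption A and Assumption C (stated in the context) on the compact rectangle $T$. Then for every fixed $x_0\in T$, $$\lim_{r\to0+}\ \sup_{x\in T:\,0<d(x,x_0)\le r}\frac{|v(x)-v(x_0)|}{d(x,x_0)\sqrt{\log\log(d(x,x_0)^{-1})}}=\sqrt2\quad\text{a.s.}$$ and $$\lim_{r\to0+}\ \sup_{x\in T:\,0<\Delta(x,x_0)\le r}\frac{|v(x)-v(x_0)|}{\Delta(x,x_0)\sqrt{\log\log(\Delta(x,x_0)^{-1})}}=\kappa\quad\text{a.s.}$$ for some positive finite constant $\kappa$ satisfying $\sqrt2\,c_3\le\kappa\le\sqrt2\,c_1$, where $c_3$ is the constant in Assumption C and $c_1$ is a constant such that, for some $\varepsilon_1>0$, $\|v(x)-v(y)\|_{L^2}\le c_1\Delta(x,y)$ for all $x,y\in T$ with $\Delta(x,y)\le\varepsilon_1$ (such $c_1,\varepsilon_1$ exist under Assumption A).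
   Context: Let $k\ge1$, let $v=\{v(x):x\in\mathbb R^k\}$ be a real-valued continuous centered Gaussian random field, and let $T\subset\mathbb R^k$ be a compact rectangle (a product of compact intervals of positive length). Write $\|X\|_{L^2}=(\mathbb E[X^2])^{1/2}$. Assumption A. There exists a centered Gaussian random field $\{v(A,x):A\in\mathscr B(\mathbb R_+),x\in T\}$, where $\mathscr B(\mathbb R_+)$ is the Borel $\sigma$-algebra of $\mathbb R_+=[0,\infty)$, such that: (a) for every $x\in T$, $A\mapsto v(A,x)$ is an independently scattered Gaussian noise (values on disjoint sets are independent, and $v(\bigcup_nA_n,x)=\sum_nv(A_n,x)$ in $L^2$ for disjoint $A_n$) with $v(\mathbb R_+,x)=v(x)$, and the processes $v(A,\cdot)$ and $v(B,\cdot)$ are independent whenever $A$ and $B$ are disjoint; (b) there exist constants $c_0>0$, $a_0\ge0$ and $\gamma_j>0$, $j=1,\dots,k$, such that for all $a_0\le a<b\le\infty$ and $x,y\in T$ (with $b^{-1}=0$ if $b=\infty$), $$\|v([a,b),x)-v(x)-v([a,b),y)+v(y)\|_{L^2}\le c_0\Big(\sum_{j=1}^ka^{\gamma_j}|x_j-y_j|+b^{-1}\Big)$$ and $$\|v([0,a_0),x)-v([0,a_0),y)\|_{L^2}\le c_0\sum_{j=1}^k|x_j-y_j|.$$ Notation: $\alpha_j=(\gamma_j+1)^{-1}\in(0,1)$, $\Delta(x,y)=\sum_{j=1}^k|x_j-y_j|^{\alpha_j}$ and $d(x,y)=\|v(x)-v(y)\|_{L^2}$ for $x,y\in\mathbb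 R^k$. Assumption C. There exists a constant $c_3>0$ such that $\|v(x)-v(y)\|_{L^2}\ge c_3\Delta(x,y)$ for all $x,y\in T$. *)

(* Defs.v *)
From HB Require Import structures.
From mathcomp Require Import all_boot all_order all_algebra.
From mathcomp Require Import all_classical all_reals all_analysis.

Set Implicit Arguments.
Unset Strict Implicit.
Unset Printing Implicit Defensive.

Import Order.TTheory GRing.Theory Num.Theory.
Import numFieldNormedType.Exports.

Local Open Scope classical_set_scope.
Local Open Scope ring_scope.

Section probability_notions.
Context {d : measure_display} {Omega : measurableType d} {R : realType}.
Variable P : probability Omega R.

(* The variance may vanish: constant linear combinations are Gaussian.  That
   case is separate because the library's normal_prob 0 0 is not the Dirac mass
   at 0 (it is the uniform law on [0, 1]). *)
Definition centered_gaussian_law (sigma : R) : set R -> \bar R :=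
  if sigma == 0 then \d_(0 : R) else normal_prob 0 sigma.

Definition centered_gaussian (X : Omega -> R) : Prop :=
  exists2 sigma : R, 0 <= sigma &
    forall B : set R, measurable B ->
      pushforward P X B = centered_gaussian_law sigma B.

Definition centered_gaussian_field (I : Type) (D : set I)
    (X : I -> {RV P >-> R}) : Prop :=
  forall (n : nat) (c : 'I_n -> R) (t : 'I_n -> I), (forall i, D (t i)) ->
    centered_gaussian (fun w => \sum_(i < n) c i * X (t i) w).

Definition sigma_generated (I : Type) (D : set I) (X : I -> {RV P >-> R}) :
    set (set Omega) :=
  <<s \bigcup_(i in D) preimage_set_system setT (X i) measurable >>.

Definition independent_processes (I J : Type) (D : set I) (E : set J)
    (X : I -> {RV P >-> R}) (Y : J -> {RV P >-> R}) : Prop :=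
  forall F G : set Omega, sigma_generated D X F -> sigma_generated E Y G ->
    P (F `&` G) = (P F * P G)%E.

(* No subfamilies are needed: take B i = setT for the indices left out. *)
Definition mutually_independent (n : nat) (X : 'I_n -> {RV P >-> R}) : Prop :=
  forall B : 'I_n -> set R, (forall i, measurable (B i)) ->
    P (\bigcap_i (X i @^-1` B i)) = (\prod_(i < n) P (X i @^-1` B i))%E.

Definition L2norm (X : Omega -> R) : R :=
  Num.sqrt (fine 'E_P[fun w => X w ^+ 2]).

End probability_notions.

Section random_field.
Context {d : measure_display} {Omega : measurableType d} {R : realType}.
Variables (P : probability Omega R) (k : nat).

Definition rectangle (lo hi : 'rV[R]_k) : set 'rV[R]_k :=
  [set x | forall j, lo 0 j <= x 0 j <= hi 0 j].

Definition continuous_field (v : 'rV[R]_k -> {RV P >-> R}) : Prop :=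
  {ae P, forall w, continuous (fun x => v x w)}.

Definition borel_Rplus (A : set R) : Prop :=
  measurable A /\ A `<=` `[0, +oo[%classic.

Record gaussian_noise_field (v : 'rV[R]_k -> {RV P >-> R}) (T : set 'rV[R]_k)
    (W : set R -> 'rV[R]_k -> {RV P >-> R}) : Prop := {
  noise_gaussian :
    centered_gaussian_field [set p : set R * 'rV[R]_k | borel_Rplus p.1 /\ T p.2]
      (fun p => W p.1 p.2);
  noise_scattered : forall x, T x ->
    forall (n : nat) (A : 'I_n -> set R), (forall i, borel_Rplus (A i)) ->
      trivIset setT A -> mutually_independent (fun i => W (A i) x);
  noise_additive : forall x, T x ->
    forall A : nat -> set R, (forall i, borel_Rplus (A i)) ->
      trivIset setT A ->
      L2norm P (fun w => W (\bigcup_i A i) x w - \sum_(i < n) W (A i) x w)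
        @[n --> \oo] --> 0;
  noise_total : forall x, T x ->
    {ae P, forall w, W `[0, +oo[%classic x w = v x w};
  noise_independent : forall A B : set R, borel_Rplus A -> borel_Rplus B ->
    A `&` B = set0 -> independent_processes T T (W A) (W B)
}.

Definition Ico (a : R) (b : \bar R) : set R :=
  [set t | a <= t /\ (t%:E < b)%E].

(* In b^-1%E, the extended-real inverse, +oo is sent to 0; b is positive here. *)
Definition assumption_A (v : 'rV[R]_k -> {RV P >-> R}) (T : set 'rV[R]_k)
    (gamma : 'I_k -> R) : Prop :=
  exists W : set R -> 'rV[R]_k -> {RV P >-> R},
    gaussian_noise_field v T W /\
    exists c0 a0 : R,
      [/\ 0 < c0, 0 <= a0, (forall j, 0 < gamma j),
          (forall (a : R) (b : \bar R) (x y : 'rV[R]_k),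
             a0 <= a -> (a%:E < b)%E -> T x -> T y ->
             L2norm P (fun w => W (Ico a b) x w - v x w
                                - W (Ico a b) y w + v y w)
             <= c0 * (\sum_(j < k) a `^ gamma j * `|x 0 j - y 0 j|
                      + fine b^-1%E))
        & (forall x y : 'rV[R]_k, T x -> T y ->
             L2norm P (fun w => W (Ico 0 a0%:E) x w - W (Ico 0 a0%:E) y w)
             <= c0 * \sum_(j < k) `|x 0 j - y 0 j|)].

Definition alpha (gamma : 'I_k -> R) (j : 'I_k) : R := (gamma j + 1)^-1.

Definition Delta (gamma : 'I_k -> R) (x y : 'rV[R]_k) : R :=
  \sum_(j < k) `|x 0 j - y 0 j| `^ alpha gamma j.

Definition canonical_metric (v : 'rV[R]_k -> {RV P >-> R})
    (x y : 'rV[R]_k) : R :=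
  L2norm P (fun w => v x w - v y w).

Definition assumption_C (v : 'rV[R]_k -> {RV P >-> R}) (T : set 'rV[R]_k)
    (gamma : 'I_k -> R) (c3 : R) : Prop :=
  0 < c3 /\ forall x y : 'rV[R]_k, T x -> T y ->
    c3 * Delta gamma x y <= canonical_metric v x y.

Definition locally_bounded_by_Delta (v : 'rV[R]_k -> {RV P >-> R})
    (T : set 'rV[R]_k) (gamma : 'I_k -> R) (c1 : R) : Prop :=
  exists2 eps1 : R, 0 < eps1 &
    forall x y : 'rV[R]_k, T x -> T y -> Delta gamma x y <= eps1 ->
      canonical_metric v x y <= c1 * Delta gamma x y.

(* sup of |v(x) - v(x0)| / (rho(x,x0) sqrt(log log (1 / rho(x,x0)))) over the
   x in T with 0 < rho(x,x0) <= r.  The iterated logarithm is positive, hence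
   the quotient meaningful, as soon as r < exp (-1); only r -> 0+ is used. *)
Definition lil_sup (v : 'rV[R]_k -> {RV P >-> R}) (T : set 'rV[R]_k)
    (rho : 'rV[R]_k -> 'rV[R]_k -> R) (x0 : 'rV[R]_k) (w : Omega) (r : R) :
    \bar R :=
  ereal_sup [set (`|v x w - v x0 w| /
                  (rho x x0 * Num.sqrt (ln (ln ((rho x x0)^-1)))))%:E
            | x in [set x | T x /\ 0 < rho x x0 <= r]].

End random_field.

(* Main.v *)
Require Import Defs.
From HB Require Import structures.
From mathcomp Require Import all_boot all_order all_algebra.
From mathcomp Require Import all_classical all_reals all_analysis.
From mathcomp Require Import measurable_realfun.
From mathcomp Require Import ring lra.
Import Order.TTheory GRing.Theory Num.Theory.
Import numFieldNormedType.Exports.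
Local Open Scope classical_set_scope.
Local Open Scope ring_scope.
Set Implicit Arguments.
Unset Strict Implicit.
Unset Printing Implicit Defensive.

(** Fix [x0], let [d] be the canonical metric and let [Delta] be the anisotropic
    distance, both measured from [x0].  Along the scales [q ^+ n] the quantity
    [ln (ln d^-1)] is [ln n] up to an additive constant, so that both halves of
    the law are Borel-Cantelli arguments over the shells [d ~ q ^+ n].

    Upper half ([lil_upper]).  Round the points of a shell toward [x0] on a grid
    whose mesh in direction [j] is a fixed fraction of [(q ^+ n) `^ (gamma j + 1)].
    The number of grid points in a shell is bounded independently of [n], and a Gaussian
    variable exceeds [sqrt (2 (1 + e) ln n)] standard deviations with probability
    at most of order [n ^ (- 1 - e)], which is summable ([coarse_net_bound]).  The
    increment between a point and its rounding is controlled by chaining through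
    finer and finer grids ([chaining_bound]); as [d <= c1 Delta] near the diagonal
    ([canonical_metric_le_Delta]), it is an arbitrarily small multiple of
    [q ^+ n * sqrt (ln n)] as soon as the grid is fine enough.  Path continuity
    carries the bound from the grids to the whole rectangle.

    Lower half ([lil_lower]).  Choose points [x_n] on a coordinate axis with
    [Delta x_n x0 = q ^+ n].  By Assumption A the increment of [v] between [x_n] and
    [x0] is produced by the noise on the band [[del / q ^+ n, 1 / (del q ^+ n))], up
    to an error which is small compared with [Delta], hence, by Assumption C, with
    [d].  For [q = del ^+ 2] these bands are disjoint, the band increments are
    independent Gaussian variables, and each exceeds [(1 - t) sqrt (2 ln n)]
    standard deviations with probability at least of order [1 / n].  The second
    Borel-Cantelli lemma then applies.  The two halves give the constant [sqrt 2]
    for [d] ([canonical_metric_lil]).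

    Normalization by [Delta] ([Delta_lil]).  Noise carried by bounded frequencies
    has increments of order [o(Delta)], since [`|x j - y j|] is at most
    [Delta `^ (gamma j + 1)]; by chaining again ([lil_negligible]) it does not
    contribute to the limsup.  The event that the limsup exceeds [t] is therefore,
    up to a null set, determined by the noise on [[a, +oo)] for every large [a], and has
    probability 0 or 1 ([zero_one_law], [exceeds_zero_one]).  Hence the limsup is
    almost surely a constant [kappa], and comparing [d] with [c3 Delta] and
    [c1 Delta] in the law for [d] encloses [kappa] between [sqrt 2 * c3] and
    [sqrt 2 * c1]: the iterated logarithm does not feel constant factors
    ([lnln_scale]). *)

(** * The second moment of a centered normal law *)

Section normal_second_moment.
Context {R : realType}.
Notation mu := (@lebesgue_measure R).

(** Both the Radon-Nikodym derivative and [normal_pdf] represent the law on every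
    measurable set, hence they agree almost everywhere. *)
Lemma integral_normal_prob (s : R) (U : set (measurableTypeR R)) (f : measurableTypeR R -> \bar R) :
  measurable U -> (normal_prob 0 s).-integrable U f ->
  (\int[normal_prob 0 s]_(x in U) f x =
   \int[mu]_(x in U) (f x * (normal_pdf 0 s x)%:E))%E.
Proof.
move=> mU intf; have dom := @normal_prob_dominates R 0 s.
have mf := measurable_int _ intf.
have mpdf : measurable_fun U (fun x => (normal_pdf 0 s x)%:E : \bar R).
  by apply/measurable_funTS/measurable_EFinP; exact: measurable_normal_pdf.
pose nu := charge_of_finite_measure (normal_prob 0 s).
have intd : mu.-integrable U (Radon_Nikodym nu mu).
  by apply: (integrableS measurableT mU (@subsetT _ _)); exact: Radon_Nikodym_integrable.
rewrite -(Radon_Nikodym_change_of_variables dom mU intf).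
have density : ae_eq mu U (Radon_Nikodym nu mu)
    (fun x => (normal_pdf 0 s x)%:E).
  by apply: integral_ae_eq => // E _ mE; rewrite -Radon_Nikodym_integral.
apply: ae_eq_integral => //.
- by apply: emeasurable_funM => //; exact: measurable_int intd.
- exact: emeasurable_funM.
by apply: filterS density => x dx Ux; rewrite dx.
Qed.

Lemma integrable_sqr_sub_itv (s : R) (n : nat) :
  (normal_prob 0 s).-integrable `[(- n%:R)%R, n%:R%R]%classic (fun x => (x ^+ 2 - s ^+ 2)%:E).
Proof.
apply: measurable_bounded_integrable => //.
- by rewrite (le_lt_trans (probability_le1 _ _)) // ltry.
- by apply/measurable_EFinP; apply: measurable_funTS; apply/measurable_EFinP;
    apply: measurable_funB => //; exact: measurable_funX.
- exists (n%:R ^+ 2 + s ^+ 2); split; first exact: num_real.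
  move=> M nM x; rewrite /= in_itv /= -ler_norml => xn.
  rewrite (le_trans (ler_normB _ _)) // (le_trans _ (ltW nM)) //.
  rewrite (ger0_norm (sqr_ge0 s)) lerD2r normrX lerXn2r ?nnegrE ?ler0n //.
Qed.

(** The primitive behind the second moment: since the density [p] satisfies
    [p' = - x / s ^+ 2 * p], integrating [x ^+ 2 * p] by parts leaves [s ^+ 2 * p]
    and a boundary term that vanishes at infinity. *)
Lemma is_derive_id_mul_normal_pdf (s x : R) : s != 0 ->
  is_derive x 1 (fun y => - (s ^+ 2 * y) * normal_pdf 0 s y)
    ((x ^+ 2 - s ^+ 2) * normal_pdf 0 s x).
Proof.
move=> s0.
have E y : normal_pdf 0 s y = normal_peak s * expR (- y ^+ 2 / (s ^+ 2 *+ 2)).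
  by rewrite normal_pdfE //= /normal_fun subr0.
rewrite [X in is_derive _ _ X](_ : _ = fun y =>
  - (s ^+ 2 * y) * (normal_peak s * expR (- y ^+ 2 / (s ^+ 2 *+ 2)))); last first.
  by apply/funext => y; rewrite E.
rewrite E.
apply: is_derive_eq => /=.
rewrite /GRing.scale /= -(mulr_natr (s ^+ 2)) !expr2.
by field; rewrite s0.
Qed.

Lemma normal_truncated_second_moment (s : R) (n : nat) : s != 0 -> (0 < n)%N ->
  (\int[normal_prob 0 s]_(x in `[(- n%:R)%R, n%:R%R]%classic) (x ^+ 2 - s ^+ 2)%:E)%E =
   (- (2 * s ^+ 2 * (n%:R * normal_pdf 0 s n%:R)))%:E.
Proof.
move=> s0 n0.
have n0' : (0 : R) < n%:R by rewrite ltr0n.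
rewrite integral_normal_prob //; last exact: integrable_sqr_sub_itv.
under eq_integral do rewrite -EFinM.
pose F y : R := - (s ^+ 2 * y) * normal_pdf 0 s y.
have dF x : is_derive x (1 : R) F ((x ^+ 2 - s ^+ 2) * normal_pdf 0 s x).
  exact: is_derive_id_mul_normal_pdf.
have cF : continuous F.
  by move=> x; apply: differentiable_continuous; apply/derivable1_diffP; have [] := dF x.
rewrite (@continuous_FTC2 _ _ F).
- rewrite -EFinB; congr EFin; rewrite /F.
  have -> : normal_pdf 0 s (- n%:R) = normal_pdf 0 s n%:R.
    by rewrite !normal_pdfE //= /normal_fun !subr0 sqrrN.
  by ring.
- by lra.
- apply: continuous_subspaceT => x; apply: cvgM; last exact: continuous_normal_pdf.
  by apply: cvgB; [exact: exprn_continuous | exact: cvg_cst].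
- split.
  + by move=> x _; have [] := dF x.
  + exact/cvg_at_right_filter/cF.
  + exact/cvg_at_left_filter/cF.
- by move=> x _; rewrite derive1E; have [_ ->] := dF x.
Qed.

Lemma cvg_normal_pdf_tail (s : R) : s != 0 ->
  (n%:R : R) * normal_pdf 0 s n%:R @[n --> \oo] --> (0 : R).
Proof.
move=> s0.
have s2 : 0 < s ^+ 2 by rewrite exprn_even_gt0.
(* [y <= expR y] for [y = n ^+ 2 / (2 s ^+ 2)] bounds the density by a multiple of [n ^- 2] *)
apply: (@squeeze_cvgr _ _ _ _ (cst 0)
    (fun n => normal_peak s * (4 * s ^+ 2) * n.+1%:R^-1)).
- near=> n.
  have n0 : (0 < n)%N by near: n; exact: nbhs_infty_gt.
  rewrite mulr_ge0 ?normal_pdf_ge0 ?ler0n //=.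
  rewrite normal_pdfE //= /normal_fun subr0 mulrCA -mulrA.
  rewrite ler_wpM2l ?normal_peak_ge0 // mulNr expRN -(mulr_natr (s ^+ 2)).
  set y := n%:R ^+ 2 / _; have e1 : y <= expR y.
    by rewrite (le_trans _ (expR_ge1Dx _)) // lerDr.
  rewrite ler_pdivrMr ?expR_gt0 //.
  apply: (@le_trans _ _ (4 * s ^+ 2 / n.+1%:R * y)).
    have -> : 4 * s ^+ 2 / n.+1%:R * y = n%:R * (n%:R * (2 / n.+1%:R)) :> R.
      by rewrite /y; field; rewrite s0 nat1r pnatr_eq0.
    rewrite ler_peMr ?ler0n // mulrA ler_pdivlMr ?ltr0n // mul1r.
    by rewrite -natr1 mulr_natr mulr2n lerD2l ler1n.
  by rewrite ler_wpM2l // mulr_ge0 // ?invr_ge0 // mulr_ge0 // ltW.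
- exact: cvg_cst.
- rewrite -[X in _ --> X](mulr0 (normal_peak s * (4 * s ^+ 2))).
  by apply: cvgM; [exact: cvg_cst|exact: cvg_harmonic].
Unshelve. all: by end_near. Qed.

Lemma integral_sqr_normal_prob (s : R) : s != 0 ->
  (\int[normal_prob 0 s]_x (x ^+ 2)%:E)%E = (s ^+ 2)%:E.
Proof.
move=> s0.
pose I n : set (measurableTypeR R) := `[(- n%:R)%R, n%:R%R]%classic.
have ndI : nondecreasing_seq I.
  move=> m n mn; apply/subsetPset => x; rewrite /I /= !in_itv /= => /andP[a b].
  have : (m%:R : R) <= n%:R by rewrite ler_nat.
  by move=> mn'; apply/andP; split; lra.
have UI : \bigcup_n I n = setT.
  apply/seteqP; split => // x _.
  exists (Num.truncn `|x|).+1 => //=; rewrite /I /= in_itv /= -ler_norml ltW //.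
  exact: truncnS_gt.
have mI n : measurable (I n) by exact: measurable_itv.
have mf : measurable_fun setT (fun x : R => (x ^+ 2)%:E).
  by apply/measurable_EFinP; exact: measurable_funX.
have c1 : (\int[normal_prob 0 s]_(x in I n) (x ^+ 2)%:E @[n --> \oo] -->
    \int[normal_prob 0 s]_x (x ^+ 2)%:E)%E.
  rewrite -UI; apply: ge0_nondecreasing_set_cvg_integral => //.
    by move=> n; exact: measurable_funTS.
  by move=> n x _; rewrite lee_fin sqr_ge0.
have c2 : (normal_prob 0 s (I n) @[n --> \oo] --> 1)%E.
  rewrite -(@probability_setT _ _ _ (normal_prob 0 s)) -UI.
  apply: nondecreasing_cvg_mu => //.
  by rewrite UI.
have E n : (0 < n)%N -> (\int[normal_prob 0 s]_(x in I n) (x ^+ 2)%:E =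
    (s ^+ 2)%:E * normal_prob 0 s (I n) + (- (2 * s ^+ 2 * (n%:R * normal_pdf 0 s n%:R)))%:E)%E.
  move=> n0; rewrite -normal_truncated_second_moment //.
  rewrite -(integral_cst _ (mI n)) -integralD //=.
  - by apply: eq_integral => x _; rewrite -EFinD addrC subrK.
  - exact: finite_measure_integrable_cst.
  - exact: integrable_sqr_sub_itv.
have c4 : - (2 * s ^+ 2 * (n%:R * normal_pdf 0 s n%:R)) @[n --> \oo] --> (0 : R).
  have := cvgN (cvgM (cvg_cst (2 * s ^+ 2)) (cvg_normal_pdf_tail s0)).
  by rewrite mulr0 oppr0; apply.
have c3 : ((s ^+ 2)%:E * normal_prob 0 s (I n) +
    (- (2 * s ^+ 2 * (n%:R * normal_pdf 0 s n%:R)))%:E @[n --> \oo] --> (s ^+ 2)%:E)%E.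
  rewrite -[X in (_ --> X)%E]adde0 -[X in (_ --> X + _)%E]mule1.
  apply: cvgeD => //; first exact: cvgeZl.
  apply: cvg_EFin; first exact: nearW.
  exact: c4.
apply: (cvg_unique _ c1 _) => //.
apply: cvg_trans c3; apply: near_eq_cvg; near=> n; rewrite E //.
by near: n; exact: nbhs_infty_gt.
Unshelve. all: by end_near. Qed.
End normal_second_moment.

(** * L2 norms and tails of Gaussian variables *)

Section gaussian_variables.
Context {d : measure_display} {Omega : measurableType d} {R : realType}.
Variable P : probability Omega R.
Implicit Types X Y : Omega -> R.

Lemma gaussian_second_moment X sigma : measurable_fun setT X -> 0 <= sigma ->
  (forall B, measurable B -> pushforward P X B = centered_gaussian_law sigma B) ->
  (\int[P]_w (X w ^+ 2)%:E)%E = (sigma ^+ 2)%:E.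
Proof.
move=> mX s0 lawX.
pose GR := measurableTypeR R.
have mX' : @measurable_fun _ _ Omega GR setT X by [].
pose Xm : {mfun Omega >-> GR} := HB.pack X (isMeasurableFun.Build _ _ Omega GR X mX').
have mf : @measurable_fun _ _ GR _ setT (fun x : R => (x ^+ 2)%:E).
  by apply/measurable_EFinP; exact: measurable_funX.
have -> : (\int[P]_w (X w ^+ 2)%:E = \int[distribution P Xm]_x (x ^+ 2)%:E)%E.
  rewrite ge0_integral_distribution // => y; by rewrite lee_fin sqr_ge0.
have [sE|sN] := eqVneq sigma 0.
  transitivity (\int[\d_(0%R : GR)]_x (x ^+ 2)%:E)%E.
    apply: eq_measure_integral => A mA _ /=.
    by rewrite [LHS](lawX A mA) /centered_gaussian_law sE eqxx.
  by rewrite integral_dirac //= diracT mul1e sE.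
rewrite -integral_sqr_normal_prob //.
apply: eq_measure_integral => A mA _ /=.
by rewrite [LHS](lawX A mA) /centered_gaussian_law (negbTE sN).
Qed.

(** The parameter hidden in [centered_gaussian] is the L2 norm, so that tails can
    be expressed with quantities that Assumptions A and C bound. *)
Lemma gaussian_law_L2norm X : measurable_fun setT X -> centered_gaussian P X ->
  forall B, measurable B -> P (X @^-1` B) = centered_gaussian_law (L2norm P X) B.
Proof.
move=> mX [s s0 lawX] B mB.
rewrite /L2norm unlock (gaussian_second_moment mX s0 lawX) /= sqrtr_sqr ger0_norm //.
exact: lawX.
Qed.

Definition square_integrable X :=
  measurable_fun setT X /\ (\int[P]_w (X w ^+ 2)%:E < +oo)%E.

Lemma gaussian_square_integrable X : measurable_fun setT X ->
  centered_gaussian P X -> square_integrable X.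
Proof.
by move=> mX [s s0 lawX]; split => //; rewrite (gaussian_second_moment mX s0 lawX) ltry.
Qed.

Lemma L2norm_ge0 X : 0 <= L2norm P X. Proof. exact: sqrtr_ge0. Qed.

Lemma square_integrableD X Y : square_integrable X -> square_integrable Y ->
  square_integrable (fun w => X w + Y w).
Proof.
move=> [mX X2] [mY Y2]; split; first exact: measurable_funD.
have mX2 : measurable_fun setT (fun w => (X w ^+ 2)%:E).
  by apply/measurable_EFinP; exact: measurable_funX.
have mY2 : measurable_fun setT (fun w => (Y w ^+ 2)%:E).
  by apply/measurable_EFinP; exact: measurable_funX.
apply: (@le_lt_trans _ _ (\int[P]_w (2%:E * (X w ^+ 2)%:E + 2%:E * (Y w ^+ 2)%:E))%E).
  apply: ge0_le_integral => //.
  - by move=> w _; rewrite lee_fin sqr_ge0.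
  - by apply/measurable_EFinP; apply: measurable_funX; exact: measurable_funD.
  - by apply: emeasurable_funD; exact: measurable_funeM.
  - move=> w _; rewrite -!EFinM -EFinD lee_fin.
    by have := sqr_ge0 (X w - Y w); rewrite !expr2; lra.
rewrite ge0_integralD //; last 4 first.
- by move=> w _; rewrite -EFinM lee_fin mulr_ge0 // sqr_ge0.
- exact: measurable_funeM.
- by move=> w _; rewrite -EFinM lee_fin mulr_ge0 // sqr_ge0.
- exact: measurable_funeM.
have Z0 (Z : Omega -> R) w : [set: Omega] w -> (0 <= (Z w ^+ 2)%:E)%E.
  by rewrite lee_fin sqr_ge0.
rewrite !ge0_integralZl //; try exact: Z0.
by rewrite lte_add_pinfty // lte_mul_pinfty.
Qed.

Lemma square_integrableZ c X : square_integrable X ->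
  square_integrable (fun w => c * X w).
Proof.
move=> [mX X2]; split; first exact: measurable_funM.
under eq_integral do rewrite exprMn EFinM.
rewrite ge0_integralZl ?lte_mul_pinfty ?lee_fin ?sqr_ge0 //.
  by apply/measurable_EFinP; exact: measurable_funX.
by move=> w _; rewrite lee_fin sqr_ge0.
Qed.

Lemma L2normZ c X : square_integrable X ->
  L2norm P (fun w => c * X w) = `|c| * L2norm P X.
Proof.
move=> [mX X2]; rewrite /L2norm unlock /=.
under eq_integral do rewrite exprMn EFinM.
rewrite ge0_integralZl ?lee_fin ?sqr_ge0 //; last 2 first.
- by apply/measurable_EFinP; exact: measurable_funX.
- by move=> w _; rewrite lee_fin sqr_ge0.
have /fineK <- : (\int[P]_w (X w ^+ 2)%:E)%E \is a fin_num.
  by rewrite ge0_fin_numE // integral_ge0 // => w _; rewrite lee_fin sqr_ge0.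
by rewrite -EFinM /= sqrtrM ?sqr_ge0 // sqrtr_sqr.
Qed.

Lemma square_integrableN X : square_integrable X ->
  square_integrable (fun w => - X w).
Proof.
move=> /(square_integrableZ (-1)).
by congr square_integrable; apply/funext => w; rewrite mulN1r.
Qed.

Lemma L2normN X : L2norm P (fun w => - X w) = L2norm P X.
Proof.
rewrite /L2norm; congr (Num.sqrt (fine _)); congr expectation.
by apply/funext => w; rewrite sqrrN.
Qed.

Lemma L2norm_sub_sym X Y :
  L2norm P (fun w => X w - Y w) = L2norm P (fun w => Y w - X w).
Proof. by rewrite -L2normN; congr L2norm; apply/funext => w; rewrite opprB. Qed.

Lemma L2norm_Lnorm X : square_integrable X ->
  (L2norm P X)%:E = Lnorm P 2%:E (EFin \o X).
Proof.
move=> [mX Xoo]; rewrite /L2norm unlock /=.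
have I0 : (0 <= \int[P]_w (X w ^+ 2)%:E)%E.
  by apply: integral_ge0 => w _; rewrite lee_fin sqr_ge0.
rewrite unlock /Lnorm.
have -> : (\int[P]_x `|(EFin \o X) x| `^ 2 = \int[P]_x (X x ^+ 2)%:E)%E.
  apply: eq_integral => x _ /=.
  by rewrite -poweR_EFin poweR_EFin powR_mulrn // real_normK // num_real.
have /fineK <- : (\int[P]_w (X w ^+ 2)%:E)%E \is a fin_num by rewrite ge0_fin_numE.
by rewrite poweR_EFin powR12_sqrt // fine_ge0.
Qed.

Lemma L2norm_triangle X Y : square_integrable X -> square_integrable Y ->
  L2norm P (fun w => X w + Y w) <= L2norm P X + L2norm P Y.
Proof.
move=> sX sY; rewrite -lee_fin EFinD !L2norm_Lnorm //; last exact: square_integrableD.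
by apply: minkowski_EFin; [exact: sX.1|exact: sY.1|rewrite ler1n].
Qed.

Lemma L2norm_eq0 X : square_integrable X -> L2norm P X = 0 ->
  {ae P, forall w, X w = 0}.
Proof.
move=> sX X0.
have mX := sX.1.
have /(Lnorm_eq0_eq0 _ _) : Lnorm P 2%:E (EFin \o X) = 0%E by rewrite -L2norm_Lnorm // X0.
move=> /(_ _ _) XE; have : ae_eq P setT (EFin \o X) (cst 0%E).
  by apply: XE => //; exact/measurable_EFinP.
by apply: filterS => w /(_ I) /= -[].
Qed.

Lemma probability_ae_le (A B : set Omega) : measurable A -> measurable B ->
  {ae P, forall w, A w -> B w} -> (P A <= P B)%E.
Proof.
move=> mA mB [N [mN N0 NAB]].
rewrite -(measureU0 mB mN N0); apply: le_measure; rewrite ?inE //.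
  exact: measurableU.
move=> w Aw; have [Bw|nBw] := pselect (B w); first by left.
by right; apply: NAB => /= /(_ Aw).
Qed.

Lemma probability_ae_eq (A B : set Omega) : measurable A -> measurable B ->
  {ae P, forall w, A w <-> B w} -> P A = P B.
Proof.
move=> mA mB AB; apply/eqP; rewrite eq_le !probability_ae_le //.
  by apply: filterS AB => w [].
by apply: filterS AB => w [].
Qed.

Lemma L2norm_ae X Y : measurable_fun setT X -> measurable_fun setT Y ->
  {ae P, forall w, X w = Y w} -> L2norm P X = L2norm P Y.
Proof.
move=> mX mY XY; rewrite /L2norm unlock; congr (Num.sqrt (fine _)).
apply: ae_eq_integral => //.
- by apply/measurable_EFinP; exact: measurable_funX.
- by apply/measurable_EFinP; exact: measurable_funX.
- by apply: filterS XY => w -> _.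
Qed.

Lemma centered_gaussian_ae X Y : measurable_fun setT X -> measurable_fun setT Y ->
  {ae P, forall w, X w = Y w} -> centered_gaussian P X -> centered_gaussian P Y.
Proof.
move=> mX mY XY [s s0 lawX]; exists s => // B mB; rewrite -lawX //.
have mXB : measurable (X @^-1` B) by rewrite -[X in measurable X]setTI; exact: mX.
have mYB : measurable (Y @^-1` B) by rewrite -[X in measurable X]setTI; exact: mY.
by apply: probability_ae_eq => //; apply: filterS XY => w /= ->.
Qed.

(** On [A] the density centered at 0 is at most [expR (- (m ^+ 2 / (2 sigma ^+ 2)))]
    times the one centered at [m], whose total mass is 1.  For [A] a half-line that
    starts at [m] this is the Gaussian tail bound. *)
Lemma normal_prob_shift_le (sigma m : R) (A : set (measurableTypeR R)) :
  sigma != 0 -> measurable A -> (forall x, A x -> 0 <= m * (x - m)) ->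
  (normal_prob 0 sigma A <= (expR (- (m ^+ 2 / (sigma ^+ 2 *+ 2))))%:E)%E.
Proof.
move=> s0 mA Am; set c := expR _.
have c0 : 0 <= c by exact: expR_ge0.
have mpdf n s : measurable_fun A (fun x => (normal_pdf n s x)%:E : \bar R).
  by apply/measurable_funTS/measurable_EFinP; exact: measurable_normal_pdf.
apply: (@le_trans _ _ (\int[lebesgue_measure]_(x in A) (c%:E * (normal_pdf m sigma x)%:E))%E).
  apply: ge0_le_integral => //=.
  - by move=> x _; rewrite lee_fin normal_pdf_ge0.
  - by apply: measurable_funeM.
  - move=> x Ax; rewrite -EFinM lee_fin !normal_pdfE //= /normal_fun mulrCA.
    rewrite ler_wpM2l ?normal_peak_ge0 // /c -expRD ler_expR subr0.
    rewrite -(mulNr (m ^+ 2)) -mulrDl ler_wpM2r ?invr_ge0 ?mulrn_wge0 ?sqr_ge0 //.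
    by have := Am _ Ax; rewrite !expr2; lra.
rewrite ge0_integralZl //; last by move=> x _; rewrite lee_fin normal_pdf_ge0.
rewrite -[leRHS]mule1 lee_wpmul2l ?lee_fin //.
exact: (@probability_le1 _ _ _ (normal_prob m sigma)).
Qed.

Lemma measurable_norm_gt (X : Omega -> R) (a : R) : measurable_fun setT X ->
  measurable [set w | a < `|X w|].
Proof.
move=> mX; have -> : [set w | a < `|X w|] = setT `&` (fun w => `|X w|) @^-1` `]a, +oo[%classic.
  by apply/seteqP; split => w; rewrite /= in_itv /= andbT // => -[].
by apply: (measurableT_comp (@normr_measurable R setT) mX).
Qed.

(** Stated with an upper bound [s] of the standard deviation, which absorbs the
    degenerate case where the law is a Dirac mass. *)
Lemma gaussian_tail X (s t : R) : measurable_fun setT X -> centered_gaussian P X ->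
  L2norm P X <= s -> 0 <= t ->
  (P [set w | (s * t < `|X w|)%R] <= (2 * expR (- (t ^+ 2 / 2)))%:E)%E.
Proof.
move=> mX gX Xs t0; set sg := L2norm P X.
have sg0 : 0 <= sg := L2norm_ge0 X.
pose B : set (measurableTypeR R) := [set y | s * t < `|y|].
have mB : measurable B.
  have -> : B = setT `&` (@Num.norm _ R) @^-1` `]s * t, +oo[%classic.
    by apply/seteqP; split => y; rewrite /B /= in_itv /= andbT // => -[].
  by apply: normr_measurable => //; exact: measurable_itv.
have -> : P [set w | s * t < `|X w|] = P (X @^-1` B) by [].
rewrite gaussian_law_L2norm // -/sg /centered_gaussian_law.
have [sE|sN] := eqVneq sg 0.
  rewrite /B diracE memNset ?lee_fin ?mulr_ge0 ?expR_ge0 //=.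
  by rewrite normr0; apply/negP; rewrite -leNgt mulr_ge0 // (le_trans _ Xs).
pose m := sg * t.
have m0 : 0 <= m by rewrite mulr_ge0.
pose B1 : set (measurableTypeR R) := `[m, +oo[%classic.
pose B2 : set (measurableTypeR R) := `]-oo, (- m)]%classic.
have mB1 : measurable B1 by exact: measurable_itv.
have mB2 : measurable B2 by exact: measurable_itv.
have E1 : m ^+ 2 / (sg ^+ 2 *+ 2) = t ^+ 2 / 2.
  by rewrite /m -(mulr_natr (sg ^+ 2)); field.
apply: (@le_trans _ _ (normal_prob 0 sg (B1 `|` B2))).
  apply: le_measure; rewrite ?inE //; first exact: measurableU.
  move=> y; rewrite /B /B1 /B2 /= !in_itv /= andbT => sty.
  have : m < `|y| by rewrite (le_lt_trans _ sty) // ler_wpM2r.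
  by rewrite ltr_normr => /orP[] h; [left|right]; lra.
apply: (le_trans (measureU2 _ mB1 mB2)).
rewrite mulr2n mulrDl mul1r EFinD; apply: leeD.
  rewrite -E1; apply: normal_prob_shift_le => // x; rewrite /B1 /= in_itv /= andbT => h.
  by rewrite mulr_ge0 // subr_ge0.
rewrite -E1 -(sqrrN m); apply: normal_prob_shift_le => // x; rewrite /B2 /= in_itv /= => h.
by rewrite mulr_le0 // ?oppr_le0 //; lra.
Qed.

(** The mass of the interval of length [L2norm P X] above the threshold is at least
    its length times the density at its right end.  This is sharp in the exponent up
    to the shift by 1, which is harmless on a logarithmic scale. *)
Lemma gaussian_lower_tail X (t : R) : measurable_fun setT X -> centered_gaussian P X ->
  0 < L2norm P X -> 0 <= t ->
  ((normal_peak 1 * expR (- ((t + 1) ^+ 2 / 2)))%:E <= P [set w | (L2norm P X * t < X w)%R])%E.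
Proof.
move=> mX gX; set sg := L2norm P X => sg0 t0.
have sN : sg != 0 by rewrite gt_eqF.
pose B : set (measurableTypeR R) := `]sg * t, +oo[%classic.
have mB : measurable B by exact: measurable_itv.
have -> : P [set w | sg * t < X w] = P (X @^-1` B).
  by congr (P _); apply/seteqP; split => w; rewrite /B /= in_itv /= andbT.
rewrite gaussian_law_L2norm // -/sg /centered_gaussian_law (negbTE sN).
pose B1 : set (measurableTypeR R) := `]sg * t, sg * (t + 1)]%classic.
have mB1 : measurable B1 by exact: measurable_itv.
apply: (@le_trans _ _ (normal_prob 0 sg B1)); last first.
  apply: le_measure; rewrite ?inE // /B /B1 => y /=; rewrite !in_itv /= andbT.
  by case/andP.
set c := normal_pdf 0 sg (sg * (t + 1)).
apply: (@le_trans _ _ (\int[lebesgue_measure]_(x in B1) c%:E)%E); last first.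
  apply: ge0_le_integral => //=.
  - by move=> x _; rewrite lee_fin normal_pdf_ge0.
  - by apply/measurable_funTS/measurable_EFinP; exact: measurable_normal_pdf.
  - move=> x; rewrite /B1 /= in_itv /= => /andP[x1 x2].
    rewrite lee_fin /c !normal_pdfE //= /normal_fun.
    rewrite ler_wpM2l ?normal_peak_ge0 // ler_expR !subr0.
    rewrite ler_wpM2r ?invr_ge0 ?mulrn_wge0 ?sqr_ge0 // lerN2.
    have x0 : 0 <= x by rewrite (le_trans _ (ltW x1)) // mulr_ge0 // ltW.
    by rewrite lerXn2r ?nnegrE // (le_trans x0 x2).
rewrite integral_cst //= lebesgue_measure_itv /= lte_fin ltr_pM2l // ltrDl ltr01.
rewrite -EFinB -EFinM lee_fin /c normal_pdfE //= /normal_fun subr0.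
rewrite le_eqVlt; apply/orP; left; apply/eqP.
have -> : - (sg * (t + 1)) ^+ 2 / (sg ^+ 2 *+ 2) = - ((t + 1) ^+ 2 / 2).
  by rewrite -(mulr_natr (sg ^+ 2)); field.
(* the interval has length [sg] *)
have -> : normal_peak 1 = normal_peak sg * sg.
  rewrite /normal_peak expr1n mul1r -mulrnAr sqrtrM ?sqr_ge0 // sqrtr_sqr gtr0_norm //.
  by rewrite invfM mulrAC mulVf ?mul1r.
by ring.
Qed.

End gaussian_variables.

(** * Borel-Cantelli lemmas *)

Section borel_cantelli_lemmas.
Context {d : measure_display} {Omega : measurableType d} {R : realType}.
Variable P : probability Omega R.

Lemma borel_cantelli_first (E : nat -> set Omega) (u : nat -> R) :
  (forall n, measurable (E n)) -> (forall n, 0 <= u n) -> cvgn (series u) ->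
  (\forall n \near \oo, (P (E n) <= (u n)%:E)%E) ->
  {ae P, forall w, \forall n \near \oo, ~ E n w}.
Proof.
move=> mE u0 cu [n0 _ Eu].
pose F n := if (n0 <= n)%N then E n else set0.
have mF n : measurable (F n) by rewrite /F; case: ifP.
have Fu n : (P (F n) <= (u n)%:E)%E.
  by rewrite /F; case: ifPn => [/Eu//|_]; rewrite measure0 lee_fin.
exists (lim_sup_set F); split.
- by apply: bigcapT_measurable => n; apply: bigcup_measurable.
- apply: lim_sup_set_cvg0 => //.
  apply: (@le_lt_trans _ _ (\sum_(n <oo) (u n)%:E)%E).
    by apply: lee_nneseries => // n *; exact: Fu.
  have -> : (\sum_(n <oo) (u n)%:E)%E = (limn (series u))%:E.
    rewrite -EFin_lim //; apply/congr_lim/funext => n /=.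
    by rewrite /series /= sumEFin.
  exact: ltry.
- move=> w /= nE n _; apply: contrapT => nF; apply: nE.
  exists (maxn n n0) => // j /=; rewrite geq_max => /andP[nj n0j] Ejw.
  by apply: nF; exists j => //; rewrite /F n0j.
Qed.

(** The series of [n ^ (- 1 - e)] written with [expR] and [ln]; it is dominated by the
    telescoping series of [e^-1 * ((n - 1) ^ (- e) - n ^ (- e))]. *)
Lemma cvg_series_expR_ln (e C : R) : 0 < e -> 0 <= C ->
  cvgn (series (fun n => C * expR (- ((1 + e) * ln n%:R)))).
Proof.
move=> e0 C0.
have step n : expR (- ((1 + e) * ln n.+2%:R)) <=
    e^-1 * (expR (- (e * ln n.+1%:R)) - expR (- (e * ln n.+2%:R))) :> R.
  set a := ln n.+2%:R; set b := ln n.+1%:R.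
  have ab : n.+2%:R^-1 <= a - b.
    have -> : a - b = - ln (1 - n.+2%:R^-1).
      have -> : 1 - n.+2%:R^-1 = n.+1%:R / n.+2%:R :> R.
        have h : (n.+2%:R : R) != 0 by rewrite pnatr_eq0.
        by apply: (mulIf h); rewrite divfK // mulrBl mulVf // mul1r -(natr1 n.+1) addrK.
      by rewrite ln_div ?posrE ?ltr0n // opprB.
    rewrite lerNr; have := @le_ln1Dx R (- n.+2%:R^-1); apply.
    by rewrite ltrNl opprK invf_lt1 ?ltr0n // ltr1n.
  have -> : expR (- (e * b)) = expR (- (e * a)) * expR (e * (a - b)).
    by rewrite -expRD; congr expR; ring.
  have h1 : 1 + e * (a - b) <= expR (e * (a - b)) by exact: expR_ge1Dx.
  have -> : expR (- ((1 + e) * a)) = expR (- (e * a)) * n.+2%:R^-1.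
    rewrite -[n.+2%:R in RHS]lnK ?posrE ?ltr0n // -expRN -expRD; congr expR.
    by rewrite -/a; ring.
  have -> : e^-1 * (expR (- (e * a)) * expR (e * (a - b)) - expR (- (e * a))) =
      expR (- (e * a)) * (e^-1 * (expR (e * (a - b)) - 1)) by ring.
  rewrite ler_wpM2l ?expR_ge0 //.
  rewrite (le_trans ab) // ler_pdivlMl //.
  by rewrite lerBrDl.
have bnd n : series (fun n => expR (- ((1 + e) * ln n%:R))) n.+2 <=
    2 + e^-1 * (1 - expR (- (e * ln n.+1%:R))) :> R.
  elim: n => [|n IH].
    rewrite /series /= !big_nat_recr //= big_nil ln1 ln0 // !mulr0 oppr0 expR0.
    by rewrite subrr mulr0; lra.
  rewrite /series /= big_nat_recr //=; rewrite /series /= in IH.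
  have h : 0 < e^-1 by rewrite invr_gt0.
  by have := step n; move: IH; rewrite !mulrBr; lra.
have -> : series (fun n => C * expR (- ((1 + e) * ln n%:R))) =
    (fun n => C * series (fun n => expR (- ((1 + e) * ln n%:R))) n) :> (R^nat).
  by apply/funext => n; rewrite /series /= mulr_sumr.
apply: is_cvgMr; apply: nondecreasing_is_cvgn.
  by apply/nondecreasing_seqP => n; rewrite /series /= big_nat_recr //= lerDl expR_ge0.
exists (2 + e^-1) => _ [n _ <-].
apply: (@le_trans _ _ (series (fun n => expR (- ((1 + e) * ln n%:R))) n.+2)).
  by rewrite /series /= !big_nat_recr //= -addrA lerDl addr_ge0 ?expR_ge0.
rewrite (le_trans (bnd n)) // lerD2l ler_piMr ?invr_ge0 ?(ltW e0) //.
Qed.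

(** Chebyshev's argument: the number of the first [N] events that occur has
    variance at most its mean [mu], while it vanishes on [B] and so deviates there
    by [mu]. *)
Lemma pairwise_second_moment_bound (E : nat -> set Omega) (N : nat) (B : set Omega)
    (p : nat -> R) :
  (forall n, measurable (E n)) -> measurable B ->
  (forall n, P (E n) = (p n)%:E) ->
  (forall n m, n != m -> P (E n `&` E m) = (P (E n) * P (E m))%E) ->
  (forall n, B `&` E n = set0) ->
  (((\sum_(n < N) p n) ^+ 2)%:E * P B <= (\sum_(n < N) p n)%:E)%E.
Proof.
move=> mE mB Ep indE BE; set mu : R := \sum_(n < N) p n.
have p0 n : 0 <= p n by rewrite -lee_fin -Ep.
have mu0 : 0 <= mu by apply: sumr_ge0.
have EpLe n : (P (E n) <= (p n)%:E)%E by rewrite Ep.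
have EijLe i j : i != j -> (P (E i `&` E j) <= (p i * p j)%:E)%E.
  by move=> /indE ->; rewrite !Ep.
pose T w : R := \sum_(n < N) \1_(E n) w.
have mT : measurable_fun setT T by apply: measurable_sum => n; exact: measurable_indic.
have IT : (\int[P]_w (T w)%:E)%E = mu%:E.
  rewrite /T; under eq_integral do rewrite -sumEFin.
  rewrite ge0_integral_sum //; last first.
    by move=> n; apply/measurable_EFinP; exact: measurable_indic.
  rewrite /mu -sumEFin; apply: eq_bigr => n _.
  by rewrite integral_indic // setIT; exact: Ep.
have IT2 : (\int[P]_w (T w ^+ 2)%:E <= (mu ^+ 2 + mu)%:E)%E.
  have TE w : T w ^+ 2 = \sum_(i < N) \sum_(j < N) \1_(E i `&` E j) w.
    rewrite expr2 /T mulr_suml; apply: eq_bigr => i _.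
    by rewrite mulr_sumr; apply: eq_bigr => j _; rewrite indicI.
  under eq_integral do rewrite TE -sumEFin.
  have mI i j : measurable (E i `&` E j) by exact: measurableI.
  have mS i : measurable_fun setT (fun w => (\sum_(j < N) \1_(E i `&` E j) w)%:E : \bar R).
    by apply/measurable_EFinP; apply: measurable_sum => j; exact: measurable_indic.
  rewrite ge0_integral_sum //; last first.
    by move=> i w _; rewrite lee_fin sumr_ge0.
  have -> : mu ^+ 2 + mu = \sum_(i < N) (p i * mu + p i).
    by rewrite big_split /= -mulr_suml -expr2.
  rewrite -sumEFin; apply: lee_sum => i _.
  under eq_integral do rewrite -sumEFin.
  rewrite ge0_integral_sum //; last first.
    by move=> j; apply/measurable_EFinP; exact: measurable_indic.
  rewrite (bigD1 i) //= integral_indic // setIT setIid.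
  rewrite (addrC _ (p i)) EFinD; apply: leeD; first exact: EpLe.
  have -> : p i * mu = p i * p i + \sum_(j < N | j != i) p i * p j.
    by rewrite /mu mulr_sumr (bigD1 i).
  rewrite EFinD -[leLHS]add0e.
  apply: leeD; first by rewrite lee_fin mulr_ge0.
  rewrite -sumEFin; apply: lee_sum => j ji.
  rewrite integral_indic // setIT; apply: EijLe.
  by rewrite eq_sym.
(* integrate [mu ^+ 2 * \1_B + 2 * mu * T <= mu ^+ 2 + T ^+ 2], which holds pointwise as [T]
vanishes on [B] *)
have key : ((mu ^+ 2)%:E * P B + (2 * mu)%:E * mu%:E <= (mu ^+ 2)%:E + (mu ^+ 2 + mu)%:E)%E.
  apply: le_trans (leeD (lexx _) IT2).
  have h2 : (mu ^+ 2)%:E = (\int[P]_w (mu ^+ 2)%:E)%E.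
    by rewrite integral_cst //= probability_setT mule1.
  rewrite -IT -ge0_integralZl_EFin //; last 3 first.
  - by move=> w _; rewrite lee_fin sumr_ge0.
  - exact/measurable_EFinP.
  - by rewrite mulr_ge0.
  have h1 : ((mu ^+ 2)%:E * P B = \int[P]_w ((mu ^+ 2)%:E * (\1_B w)%:E))%E.
    rewrite ge0_integralZl_EFin ?sqr_ge0 //.
      by rewrite integral_indic // setIT.
    by apply/measurable_EFinP; exact: measurable_indic.
  have mB1 : measurable_fun setT (fun w => (mu ^+ 2)%:E * (\1_B w)%:E : \bar R)%E.
    by apply: measurable_funeM; apply/measurable_EFinP; exact: measurable_indic.
  have mT1 : measurable_fun setT (fun w => (2 * mu)%:E * (T w)%:E : \bar R)%E.
    by apply: measurable_funeM; exact/measurable_EFinP.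
  have mT2 : measurable_fun setT (fun w => (T w ^+ 2)%:E : \bar R).
    by apply/measurable_EFinP; exact: measurable_funX.
  have T0 w : 0 <= T w by apply: sumr_ge0.
  rewrite h1 [X in (_ <= X + _)%E]h2 -!ge0_integralD //; last 4 first.
  - by move=> w _; rewrite lee_fin sqr_ge0.
  - by move=> w _; rewrite lee_fin sqr_ge0.
  - by move=> w _; rewrite -EFinM lee_fin mulr_ge0 // sqr_ge0.
  - by move=> w _; rewrite -EFinM lee_fin !mulr_ge0.
  apply: ge0_le_integral => //.
  - move=> w _; rewrite -!EFinM -EFinD lee_fin addr_ge0 ?mulr_ge0 ?sqr_ge0 //.
  - exact: emeasurable_funD.
  - exact: emeasurable_funD.
  move=> w _; rewrite -!EFinM -!EFinD lee_fin indicE.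
  have [/set_mem Bw|_] := boolP (w \in B); last first.
    by have := sqr_ge0 (mu - T w); rewrite !expr2 /= mulr0; lra.
  have -> : T w = 0.
    apply: big1 => n _; rewrite indicE memNset // => Ew.
    by have := BE n; rewrite -subset0; apply; split; first exact: Bw.
  by rewrite !mulr0 mulr1 addr0 expr0n addr0.
move: key.
have /fineK <- : P B \is a fin_num by rewrite fin_num_measure.
by rewrite -!EFinM -!EFinD !lee_fin; lra.
Qed.

(** Pairwise independence suffices, through the variance of the number of events
    that occur. *)
Lemma borel_cantelli_second (E : nat -> set Omega) :
  (forall n, measurable (E n)) ->
  (forall n m, n != m -> P (E n `&` E m) = (P (E n) * P (E m))%E) ->
  (forall M : R, exists N, M <= \sum_(n < N) fine (P (E n))) ->
  {ae P, forall w, forall m, exists2 n, (m <= n)%N & E n w}.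
Proof.
move=> mE indE divE; apply: ae_foralln => m.
pose F n := E (m + n)%N; pose B := \bigcap_n ~` F n.
have mF n : measurable (F n) by exact: mE.
have mB : measurable B by apply: bigcapT_measurable => n; exact: measurableC.
exists B; split => //; last first.
  move=> w /= nE n _ Fn; apply: nE; exists (m + n)%N => //; exact: leq_addr.
pose p n := fine (P (F n)).
have Fp n : P (F n) = (p n)%:E by rewrite /p fineK // fin_num_measure.
have pB : P B = (fine (P B))%:E by rewrite fineK // fin_num_measure.
have B0 : 0 <= fine (P B) by rewrite fine_ge0.
have key N : 0 < \sum_(n < N) p n -> fine (P B) <= (\sum_(n < N) p n)^-1.
  move=> mu0; have := @pairwise_second_moment_bound F N B p mF mB Fp _ _.
  rewrite /= pB -EFinM lee_fin => h.
  rewrite /= -(ler_pM2l mu0) divff ?gt_eqF // -(ler_pM2l mu0) mulr1 mulrA -expr2.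
  apply: h => [i j ij|n]; first by apply: indE; rewrite eqn_add2l.
  by apply/seteqP; split => // w [/(_ n I)].
apply: (eq_trans pB); congr EFin; apply/eqP; rewrite eq_le B0 andbT.
apply/ler_addgt0Pr => e e0; rewrite add0r.
have [N hN] := divE (\sum_(n < m) fine (P (E n)) + e^-1).
have hm : e^-1 <= \sum_(n < N) p n.
  have p0 n : 0 <= p n by rewrite /p fine_ge0.
  rewrite -(lerD2l (\sum_(n < m) fine (P (E n)))) (le_trans hN) //.
  have -> : \sum_(n < m) fine (P (E n)) + \sum_(n < N) p n = \sum_(n < m + N) fine (P (E n)).
    by rewrite big_split_ord.
  rewrite -!(big_mkord xpredT (fun n => fine (P (E n)))) [leRHS](@big_cat_nat _ _ _ N) //= ?leq_addl //.
  by rewrite lerDl sumr_ge0 // => i _; rewrite fine_ge0.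
have e1 : 0 < e^-1 by rewrite invr_gt0.
rewrite (le_trans (key N _)) ?(lt_le_trans e1) //.
by rewrite -[leRHS]invrK lef_pV2 ?posrE // (lt_le_trans e1).
Qed.

End borel_cantelli_lemmas.

(** * Rounding toward a center and anisotropic grids *)

Section truncation.
Context {R : realType}.
Implicit Types h c x : R.

(** Rounding toward [c] rather than down: the result lies between [c] and [x], so that
    it stays in every interval that contains both, and its distance to [c] does not
    exceed that of [x]. *)
Definition trunc_toward h c x : R :=
  c + (-1) ^+ (x < c)%R * ((Num.truncn (`|x - c| / h))%:R * h).

Lemma trunc_towardE h c x : 0 < h -> exists2 u : R, 0 <= u <= 1 &
  (trunc_toward h c x = c + u * (x - c) /\ (1 - u) * `|x - c| <= h).
Proof.
move=> h0; rewrite /trunc_toward.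
have [->|xc] := eqVneq x c.
  exists 0; first by rewrite lexx ler01.
  by rewrite subrr normr0 !mul0r truncn0 ltxx mul0r !mulr0 ltW.
set y : R := `|x - c|; have y0 : 0 < y by rewrite normr_gt0 subr_eq0.
have yh : 0 <= y / h by rewrite divr_ge0 // ltW.
have /andP[n1 n2] := truncn_itv yh; set n := Num.truncn _ in n1 n2 *.
have {}n1 : n%:R * h <= y by rewrite -ler_pdivlMr.
have {}n2 : y <= n%:R * h + h.
  by rewrite -[X in _ + X]mul1r -mulrDl natr1 -ler_pdivrMr // ltW.
exists (n%:R * h / y).
  by rewrite divr_ge0 ?mulr_ge0 ?ler0n ?(ltW h0) ?(ltW y0) //= ler_pdivrMr // mul1r.
split; last by rewrite mulrBl mul1r divfK ?gt_eqF //; lra.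
congr (_ + _).
have [xlc|cx] := ltP x c.
  have -> : x - c = - y by rewrite /y ltr0_norm ?opprK // subr_lt0.
  by rewrite expr1 mulN1r mulrN divfK // gt_eqF.
have -> : x - c = y by rewrite /y ger0_norm // subr_ge0.
by rewrite expr0 mul1r divfK // gt_eqF.
Qed.

Lemma trunc_toward_dist h c x : 0 < h -> `|x - trunc_toward h c x| <= h.
Proof.
move=> h0; have [u /andP[u0 u1] [-> d]] := trunc_towardE c x h0.
have -> : x - (c + u * (x - c)) = (1 - u) * (x - c) by ring.
by rewrite normrM ger0_norm // subr_ge0.
Qed.

Lemma trunc_toward_shrink h c x : 0 < h -> `|trunc_toward h c x - c| <= `|x - c|.
Proof.
move=> h0; have [u /andP[u0 u1] [-> _]] := trunc_towardE c x h0.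
by rewrite addrC addKr normrM ger0_norm // ler_piMl.
Qed.

Lemma trunc_toward_itv h c x a b : 0 < h -> a <= c <= b -> a <= x <= b ->
  a <= trunc_toward h c x <= b.
Proof.
move=> h0 /andP[ac cb] /andP[ax xb].
have [u /andP[u0 u1] [-> _]] := trunc_towardE c x h0.
have -> : c + u * (x - c) = (1 - u) * c + u * x by ring.
apply/andP; split.
  have : 0 <= (1 - u) * (c - a) + u * (x - a).
    by rewrite addr_ge0 // mulr_ge0 // subr_ge0.
  by lra.
have : 0 <= (1 - u) * (b - c) + u * (b - x).
  by rewrite addr_ge0 // mulr_ge0 // subr_ge0.
by lra.
Qed.

Lemma trunc_towardK h c x : 0 < h ->
  trunc_toward h c (trunc_toward h c x) = trunc_toward h c x.
Proof.
move=> h0.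
set n := Num.truncn (`|x - c| / h).
have E : trunc_toward h c x = c + (-1) ^+ (x < c)%R * (n%:R * h) by [].
have D : `|trunc_toward h c x - c| / h = n%:R.
  rewrite E addrC addKr normrM normrX normrN1 expr1n mul1r ger0_norm.
    by rewrite mulfK // gt_eqF.
  by rewrite mulr_ge0 // ltW.
rewrite {1}/trunc_toward D natrK [in RHS]E; congr (_ + _).
case: (posnP n) => [->|n0]; first by rewrite !mul0r !mulr0.
congr (_ ^+ nat_of_bool _ * _).
rewrite E -subr_gt0 opprD addNKr.
have nh : 0 < n%:R * h by rewrite mulr_gt0 // ltr0n.
case: (x < c); rewrite ?expr1 ?expr0 ?mulN1r ?opprK ?mul1r //.
by apply/negbTE; rewrite -leNgt oppr_le0 ltW.
Qed.
End truncation.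

Section grid.
Context {R : realType} {k : nat}.
Variables (gamma : 'I_k -> R) (q : R).
Hypotheses (gamma0 : forall j, 0 < gamma j) (q0 : 0 < q) (q1 : q < 1).
Implicit Types (x y c : 'rV[R]_k) (l n i : nat) (j : 'I_k).

(** The side whose power [alpha gamma j] is [q ^+ l]: one cell contributes [q ^+ l] to
    [Delta] in each direction. *)
Definition mesh l j : R := (q ^+ l) `^ (gamma j + 1).

Lemma mesh_gt0 l j : 0 < mesh l j.
Proof. by rewrite powR_gt0 // exprn_gt0. Qed.

Lemma alpha_gt0 j : 0 < alpha gamma j.
Proof. by rewrite invr_gt0 addr_gt0. Qed.

Lemma alpha_le1 j : alpha gamma j <= 1.
Proof. by rewrite invf_le1 ?addr_gt0 // lerDr ltW. Qed.

Lemma powR_alphaK a j : 0 <= a -> (a `^ (gamma j + 1)) `^ alpha gamma j = a.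
Proof.
by move=> a0; rewrite -powRrM mulfV ?powRr1 // gt_eqF // addr_gt0.
Qed.

Lemma mesh_alpha l j : mesh l j `^ alpha gamma j = q ^+ l.
Proof. by rewrite powR_alphaK // exprn_ge0 // ltW. Qed.

Lemma alphaK_powR a j : 0 <= a -> (a `^ alpha gamma j) `^ (gamma j + 1) = a.
Proof.
by move=> a0; rewrite -powRrM mulVf ?powRr1 // gt_eqF // addr_gt0.
Qed.

Lemma mesh_le l j : mesh l.+1 j <= mesh l j.
Proof.
rewrite ge0_ler_powR ?nnegrE ?exprn_ge0 ?(ltW q0) //.
  by rewrite addr_ge0 // ltW.
by rewrite ler_wiXn2l // ltW.
Qed.

(** The grid point with given sign and number of steps from [c] in each direction. *)
Definition node c l (s : {ffun 'I_k -> bool * nat}) : 'rV[R]_k :=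
  \row_j (c 0 j + (-1) ^+ (s j).1 * ((s j).2%:R * mesh l j)).

Definition grid c l x : 'rV[R]_k := \row_j trunc_toward (mesh l j) (c 0 j) (x 0 j).

Definition grid_index c l x : {ffun 'I_k -> bool * nat} :=
  [ffun j => (x 0 j < c 0 j, Num.truncn (`|x 0 j - c 0 j| / mesh l j))].

Lemma gridE c l x : grid c l x = node c l (grid_index c l x).
Proof. by apply/rowP => j; rewrite !mxE ffunE. Qed.

Lemma gridK c l x : grid c l (grid c l x) = grid c l x.
Proof. by apply/rowP => j; rewrite !mxE trunc_towardK // mesh_gt0. Qed.

Lemma grid_rectangle lo hi c l x : rectangle lo hi c -> rectangle lo hi x ->
  rectangle lo hi (grid c l x).
Proof. by move=> Tc Tx j; rewrite mxE trunc_toward_itv // mesh_gt0. Qed.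

Lemma Delta_ge0 x y : 0 <= Delta gamma x y.
Proof. by apply: sumr_ge0 => j _; exact: powR_ge0. Qed.

Lemma Delta_le_sum x y (a : 'I_k -> R) :
  (forall j, `|x 0 j - y 0 j| <= a j) ->
  Delta gamma x y <= \sum_j a j `^ alpha gamma j.
Proof.
move=> xya; apply: ler_sum => j _.
rewrite ge0_ler_powR ?nnegrE ?(ltW (alpha_gt0 _)) ?xya //.
by rewrite (le_trans _ (xya j)).
Qed.

Lemma Delta_grid c l x : Delta gamma (grid c l x) x <= k%:R * q ^+ l.
Proof.
apply: (le_trans (@Delta_le_sum _ _ (mesh l) _)) => [j|].
  by rewrite mxE distrC trunc_toward_dist // mesh_gt0.
under eq_bigr do rewrite mesh_alpha.
by rewrite sumr_const card_ord mulr_natl.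
Qed.

(** The factor [2 `^ alpha gamma j] is bounded by 2, which avoids constants depending
    on [gamma]. *)
Lemma Delta_grid_step c l x :
  Delta gamma (grid c l.+1 x) (grid c l x) <= 2 * k%:R * q ^+ l.
Proof.
apply: (le_trans (@Delta_le_sum _ _ (fun j => 2 * mesh l j) _)) => [j|].
  rewrite !mxE.
  have h1 := trunc_toward_dist (c 0 j) (x 0 j) (mesh_gt0 l j).
  have h2 := trunc_toward_dist (c 0 j) (x 0 j) (mesh_gt0 l.+1 j).
  have h3 := mesh_le l j.
  rewrite (le_trans (ler_distD (x 0 j) _ _)) //.
  by rewrite mulr_natl mulr2n lerD // distrC (le_trans h2).
have E j : (2 * mesh l j) `^ alpha gamma j <= 2 * q ^+ l.
  rewrite powRM ?(ltW (mesh_gt0 _ _)) // mesh_alpha ler_wpM2r ?exprn_ge0 ?(ltW q0) //.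
  by rewrite ler1_powR ?ler1n // alpha_le1.
apply: (le_trans (ler_sum _ (fun j _ => E j))).
by rewrite sumr_const card_ord -[leLHS]mulr_natr mulrAC.
Qed.

Lemma Delta_grid_shrink c l x : Delta gamma (grid c l x) c <= Delta gamma x c.
Proof.
apply: Delta_le_sum => j.
by rewrite mxE trunc_toward_shrink // mesh_gt0.
Qed.

(** The exponent [gamma j + 1] exceeds 1: near the diagonal a coordinate is much smaller
    than [Delta]. *)
Lemma coord_le_Delta x y j : `|x 0 j - y 0 j| <= Delta gamma x y `^ (gamma j + 1).
Proof.
rewrite -[leLHS](alphaK_powR j (normr_ge0 _)).
rewrite ge0_ler_powR ?nnegrE ?powR_ge0 ?Delta_ge0 //.
  by rewrite addr_ge0 // ltW.
by rewrite /Delta (bigD1 j) //= lerDl sumr_ge0 // => i _; exact: powR_ge0.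
Qed.

Lemma Delta_eq0 x y : Delta gamma x y = 0 -> x = y.
Proof.
move=> D0; apply/rowP => j; apply/eqP.
rewrite -subr_eq0 -normr_le0 (le_trans (coord_le_Delta x y j)) //.
by rewrite D0 powR0 // gt_eqF // addr_gt0.
Qed.

Lemma Deltaxx x : Delta gamma x x = 0.
Proof.
by apply: big1 => j _; rewrite subrr normr0 powR0 // gt_eqF // alpha_gt0.
Qed.

Lemma exprn_powR a i (g : R) : 0 <= a -> (a ^+ i) `^ g = (a `^ g) ^+ i.
Proof.
by move=> a0; rewrite -(powR_mulrn i a0) -powRrM mulrC powRrM powR_mulrn // powR_ge0.
Qed.

(** Measured in cells of level [n], the ball of radius [C * q ^+ n] has a size that does
    not depend on [n], and each refinement multiplies the number of cells per
    direction by a fixed factor. *)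
Lemma grid_index_bound c (C : R) : exists K : nat, (0 < K)%N /\
  forall n i x, Delta gamma x c <= C * q ^+ n ->
    forall j, ((grid_index c (n + i) x j).2 < K ^ i.+1)%N.
Proof.
pose c1 := Num.max 1 C / q.
have c11 : 1 <= Num.max 1 C by rewrite le_max lexx.
have c1ge1 : 0 <= c1 by rewrite divr_ge0 ?(ltW q0) // (le_trans _ c11).
pose K := (\sum_j (Num.truncn (c1 `^ (gamma j + 1))).+1).+1.
exists K; split => // n i x xC j; rewrite ffunE /=.
have y0 : 0 <= `|x 0 j - c 0 j| / mesh (n + i) j by rewrite divr_ge0 // ltW // mesh_gt0.
rewrite truncn_lt_nat // natrX.
apply: (@le_lt_trans _ _ ((c1 `^ (gamma j + 1)) ^+ i.+1)); last first.
  rewrite ltr_pXn2r ?nnegrE ?powR_ge0 ?ler0n //.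
  rewrite (lt_le_trans (truncnS_gt _)) // ler_nat /K (bigD1 j) //= -addSn.
  by rewrite ltnW // ltnS leq_addr.
rewrite ler_pdivrMr ?mesh_gt0 // -exprn_powR // /mesh -powRM ?exprn_ge0 // ?(ltW q0) //.
have e1 : c1 ^+ i.+1 * q ^+ (n + i) = Num.max 1 C ^+ i.+1 * q^-1 * q ^+ n.
  rewrite /c1 expr_div_n exprD (exprS q i); move: (Num.max 1 C ^+ i.+1) => A.
    by field; rewrite expf_neq0 gt_eqF.
apply: (le_trans (coord_le_Delta _ _ _)).
have xC' : Delta gamma x c <= c1 ^+ i.+1 * q ^+ (n + i).
  apply: (le_trans xC); rewrite e1 ler_wpM2r ?exprn_ge0 ?(ltW q0) //.
  apply: (@le_trans _ _ (Num.max 1 C)); first by rewrite le_max lexx orbT.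
  rewrite -[leLHS]mulr1 ler_pM //.
  - by rewrite (le_trans _ c11).
  - by rewrite exprS ler_peMr ?(le_trans _ c11) // exprn_ege1.
  - by rewrite invf_ge1 // ltW.
rewrite ge0_ler_powR ?nnegrE ?Delta_ge0 //.
  by rewrite addr_ge0 // ltW.
by rewrite mulr_ge0 ?exprn_ge0 // ltW.
Qed.

Lemma cvg_mesh j : mesh l j @[l --> \oo] --> (0 : R).
Proof.
rewrite /mesh; under eq_fun do rewrite exprn_powR ?(ltW q0) //.
apply: cvg_expr; rewrite ger0_norm ?powR_ge0 //.
rewrite [ltRHS](_ : 1 = 1 `^ (gamma j + 1)); last by rewrite powR1.
rewrite gt0_ltr_powR ?nnegrE ?ler01 ?(ltW q0) //.
by rewrite addr_gt0.
Qed.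

Lemma cvg_grid c x : grid c l x @[l --> \oo] --> x.
Proof.
apply/cvg_ballP => e e0.
have : \forall l \near \oo, forall j, mesh l j < e.
  apply: filter_forall => j.
  by apply: (cvgr_lt _ (cvg_mesh j)).
apply: filterS => l lt_e; split=> // i j; rewrite ord1 !mxE /ball /=.
by rewrite (le_lt_trans (trunc_toward_dist _ _ (mesh_gt0 l j))).
Qed.
End grid.

(** * Chaining over the grids *)

Section chaining.
Context {d : measure_display} {Omega : measurableType d} {R : realType}.
Variables (P : probability Omega R) (k : nat).

Lemma finite_union_bound (I : finType) (A : I -> set Omega) (b : R) :
  (forall i, measurable (A i)) -> (forall i, (P (A i) <= b%:E)%E) ->
  (P (\big[setU/set0]_i A i) <= (#|I|%:R * b)%:E)%E.
Proof.
move=> mA Ab; rewrite -sum1_card.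
suff [] : measurable (\big[setU/set0]_i A i) /\
  (P (\big[setU/set0]_i A i) <= ((\sum_(i : I) 1)%N%:R * b)%:E)%E by [].
elim/big_ind2 : _ => [|U1 n1 U2 n2 [mU1 U1n] [mU2 U2n]|i _].
- by rewrite measure0 mul0r.
- split; first exact: measurableU.
  by rewrite natrD mulrDl EFinD (le_trans (measureU2 _ _ _)) // leeD.
- by rewrite mul1r.
Qed.

Lemma subset_big_setU (I : finType) (A : I -> set Omega) i : A i `<=` \big[setU/set0]_i A i.
Proof. by move=> w Aw; rewrite (bigD1 i) //=; left. Qed.

Variables (gamma : 'I_k -> R) (rho : R).
Hypotheses (gamma0 : forall j, 0 < gamma j) (rho0 : 0 < rho) (rho1 : rho < 1).
Let q := rho ^+ 2.
Let q0 : 0 < q. Proof. by rewrite exprn_gt0. Qed.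
Let q1 : q < 1. Proof. by rewrite expr_lt1 // ltW. Qed.
Variables (lo hi c : 'rV[R]_k).
Hypothesis Tc : rectangle lo hi c.
Local Notation T := (rectangle lo hi).
Local Notation grid := (grid gamma q c).
Local Notation node := (node gamma q c).
Local Notation Delta := (Delta gamma).

Definition box_index M (s : {ffun 'I_k -> bool * 'I_M}) : {ffun 'I_k -> bool * nat} :=
  [ffun j => ((s j).1, val (s j).2)].

Lemma card_box M : #|{: {ffun 'I_k -> bool * 'I_M}}| = ((2 * M) ^ k)%N.
Proof. by rewrite card_ffun card_prod card_bool !card_ord. Qed.

Lemma grid_box (M l : nat) (x : 'rV[R]_k) :
  (forall j, ((grid_index gamma q c l x j).2 < M)%N) ->
  exists s : {ffun 'I_k -> bool * 'I_M}, grid l x = node l (box_index s).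
Proof.
move=> xM; exists [ffun j => ((grid_index gamma q c l x j).1, Ordinal (xM j))].
by rewrite gridE; apply/rowP => j; rewrite !mxE [box_index _ j]ffunE [X in (X j).1]/= !ffunE /= ffunE.
Qed.

Definition gaussian_increments (Z : 'rV[R]_k -> {RV P >-> R}) :=
  forall x y, T x -> T y -> centered_gaussian P (fun w => Z x w - Z y w).

Lemma measurable_increment (Z : 'rV[R]_k -> {RV P >-> R}) x y :
  measurable_fun setT (fun w => Z x w - Z y w).
Proof. exact: measurable_funB. Qed.

Lemma measurable_increment_gt (Z : 'rV[R]_k -> {RV P >-> R}) x y (a : R) :
  measurable [set w | a < `|Z x w - Z y w|].
Proof.
by apply: measurable_norm_gt; exact: measurable_increment.
Qed.

(** At a fixed refinement [m] the number of relevant grid points is bounded in [n];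
    the union bound keeps the summability of the Gaussian tails [n ^ (- 1 - e)]. *)
Lemma coarse_net_bound (Z : 'rV[R]_k -> {RV P >-> R}) (C e : R) (m : nat) (s : nat -> R) :
  gaussian_increments Z -> 0 < e ->
  {ae P, forall w, \forall n \near \oo, forall x, T x -> Delta x c <= C * q ^+ n ->
     L2norm P (fun w => Z (grid (n + m) x) w - Z c w) <= s n ->
     `|Z (grid (n + m) x) w - Z c w| <= s n * Num.sqrt (2 * ((1 + e) * ln n%:R))}.
Proof.
move=> gZ e0; have [K [K0 HK]] := grid_index_bound gamma0 q0 q1 c C.
pose t n : R := Num.sqrt (2 * ((1 + e) * ln n%:R)).
pose I := {ffun 'I_k -> bool * 'I_(K ^ m.+1)}.
pose y n (b : I) := node (n + m) (box_index b).
(* box points outside the rectangle or too far from [c] are discarded *)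
pose A n (b : I) : set Omega :=
  if `[< T (y n b) /\ L2norm P (fun w => Z (y n b) w - Z c w) <= s n >]
  then [set w | s n * t n < `|Z (y n b) w - Z c w|] else set0.
have mA n b : measurable (A n b).
  by rewrite /A; case: ifP => // _; exact: measurable_increment_gt.
have bA n b : (0 < n)%N -> (P (A n b) <= (2 * expR (- ((1 + e) * ln n%:R)))%:E)%E.
  move=> n0; rewrite /A; case: ifPn => [/asboolP[Ty sy]|_]; last first.
    by rewrite measure0 lee_fin mulr_ge0 // expR_ge0.
  have l0 : (0 : R) <= (1 + e) * ln n%:R.
    by rewrite mulr_ge0 ?ln_ge0 ?ler1n // addr_ge0 // ltW.
  have -> : (1 + e) * ln n%:R = t n ^+ 2 / 2.
    by rewrite /t sqr_sqrtr; [field|rewrite mulr_ge0].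
  apply: gaussian_tail => //; first exact: measurable_increment.
    exact: gZ.
  exact: sqrtr_ge0.
have BC : {ae P, forall w, \forall n \near \oo, ~ (\big[setU/set0]_(b : I) A n b) w}.
  apply: (@borel_cantelli_first _ _ _ P _
    (fun n => (#|{: I}|%:R * 2) * expR (- ((1 + e) * ln n%:R)))).
  - by move=> n; apply: bigsetU_measurable.
  - by move=> n; rewrite !mulr_ge0 // expR_ge0.
  - by apply: cvg_series_expR_ln => //; rewrite mulr_ge0.
  - by exists 1%N => // n /= n0; rewrite -mulrA; apply: finite_union_bound => // b; exact: bA.
apply: filterS BC => w; apply: filterS => n nF x Tx xC sx.
rewrite leNgt; apply/negP => h; apply: nF.
have [b Eb] := grid_box (HK n m x xC).
apply: (@subset_big_setU I (A n) b).
rewrite /A ifT; first by rewrite /= /y -Eb.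
by apply/asboolP; rewrite /y -Eb; split => //; exact: grid_rectangle.
Qed.

(** The left-hand side bounds the probability that one of the links between the
    levels [n + i] and [n + i.+1] is too long.  Their number grows geometrically in [i],
    but the exponent [Q * ln n / q ^+ i] grows at least like [Q * ln n * (1 + i * la)] by
    Bernoulli's inequality, so a large [Q] wins. *)
Lemma link_count_decay (K : nat) : (0 < K)%N -> exists Q : R, 2 <= Q /\
  forall n i : nat, 1 <= ln n%:R :> R ->
    ((2 * K ^ i.+1) ^ k * (2 * K ^ i.+2) ^ k)%N%:R *
      (2 * expR (- (Q * ln n%:R / q ^+ i))) <=
    ((2 ^ k * 2 ^ k * K ^ (3 * k))%N%:R * 4) * expR (- ((1 + 1) * ln n%:R)) * 2^-1 ^+ i.+1.
Proof.
move=> K0.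
pose H : R := (K ^ (2 * k))%N%:R.
have H1 : 1 <= H by rewrite ler1n expn_gt0 K0.
have H0 : 0 < H by rewrite (lt_le_trans _ H1).
pose la : R := q^-1 - 1.
have la0 : 0 < la by rewrite subr_gt0 invf_gt1.
exists (2 + ln (2 * H) / la).
have lH : 0 <= ln (2 * H) by rewrite ln_ge0 //; lra.
set Q := 2 + _; have Q2 : 2 <= Q by rewrite lerDl divr_ge0 // ltW.
split => // n i ln1; set L := ln n%:R in ln1 *.
have EN : ((2 * K ^ i.+1) ^ k * (2 * K ^ i.+2) ^ k)%N%:R =
    (2 ^ k * 2 ^ k * K ^ (3 * k))%N%:R * H ^+ i :> R.
  rewrite /H -natrX -natrM; congr (_%:R).
  rewrite !expnMn -!expnM mulnACA -!mulnA; congr (_ * (_ * _))%N.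
  by rewrite -!expnD; congr (_ ^ _)%N; ring.
rewrite EN.
have bern : 1 + i%:R * la <= (q ^+ i)^-1.
  rewrite -exprVn; have -> : q^-1 = 1 + la by rewrite addrC subrK.
  elim: i {EN} => [|i IH]; first by rewrite mul0r addr0 expr0.
  rewrite exprS; apply: (@le_trans _ _ ((1 + la) * (1 + i%:R * la))); last first.
    by rewrite ler_wpM2l // addr_ge0 // ltW.
  rewrite -(natr1 i); have : 0 <= i%:R * la * la by rewrite !mulr_ge0 // ltW.
  by lra.
have e1 : 2 * L + i%:R * ln (2 * H) <= Q * L / q ^+ i.
  apply: (@le_trans _ _ (Q * L * (1 + i%:R * la))); last first.
    by rewrite ler_wpM2l // mulr_ge0 //; lra.
  rewrite mulrDr mulr1 lerD //; first by rewrite ler_wpM2r //; lra.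
  have -> : Q * L * (i%:R * la) = i%:R * (L * (2 * la + ln (2 * H))).
    by rewrite /Q; field; rewrite gt_eqF.
  rewrite ler_wpM2l //.
  apply: (@le_trans _ _ (1 * (2 * la + ln (2 * H)))); first by lra.
  by rewrite ler_wpM2r //; lra.
have e2 : expR (- (Q * L / q ^+ i)) <= expR (- ((1 + 1) * L)) * (2 * H) ^- i.
  rewrite (_ : (2 * H) ^- i = expR (- (i%:R * ln (2 * H)))).
    by rewrite -expRD ler_expR; lra.
  rewrite expRN expRM_natl lnK.
  by [].
  by rewrite posrE mulr_gt0.
set A := _%:R; have A0 : 0 <= A by exact: ler0n.
apply: (@le_trans _ _ (A * H ^+ i * (2 * (expR (- ((1 + 1) * L)) * (2 * H) ^- i)))).
  by rewrite ler_wpM2l ?mulr_ge0 ?exprn_ge0 ?(ltW H0) // ler_wpM2l.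
rewrite le_eqVlt; apply/orP; left; apply/eqP.
by rewrite exprMn exprVn exprS; field; rewrite !expf_neq0 // gt_eqF.
Qed.

(** A link at level [n + i] has standard deviation of order [a * q ^+ (n + i)].  It is
    allowed [rho ^- i] times more standard deviations than a link at level [n]; as
    [q = rho ^+ 2], the allowed lengths still decay like [rho ^+ i] and sum up, while
    the exceptional probabilities are summable in [i] and [n].  The constant [B] does not
    depend on the field, so the bound is proportional to [a]: this is what makes
    fields with negligible increments negligible. *)
Lemma chaining_bound (C : R) : exists2 B : R, 0 < B &
  forall (Z : 'rV[R]_k -> {RV P >-> R}) (a eps : R),
  gaussian_increments Z -> 0 < a -> 0 < eps ->
  (forall x y, T x -> T y -> Delta x y <= eps ->
     L2norm P (fun w => Z x w - Z y w) <= a * Delta x y) ->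
  {ae P, forall w, \forall n \near \oo, forall x, T x -> Delta x c <= C * q ^+ n ->
     forall m L : nat,
     `|Z (grid (n + m + L) x) w - Z (grid (n + m) x) w|
       <= a * B * rho ^+ m * (q ^+ n * Num.sqrt (ln n%:R))}.
Proof.
have [K [K0 HK]] := grid_index_bound gamma0 q0 q1 c C.
have [Q [Q2 HQ]] := link_count_decay K0.
pose kR : R := 2 * k%:R.
have kR0 : 0 <= kR by rewrite mulr_ge0.
pose B : R := (kR + 1) * Num.sqrt (2 * Q) / (1 - rho).
have r1 : 0 < 1 - rho by rewrite subr_gt0.
have sQ : 0 < Num.sqrt (2 * Q) by rewrite sqrtr_gt0; lra.
exists B; first by rewrite divr_gt0 // mulr_gt0 //; lra.
move=> Z a eps gZ a0 eps0 Za.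
pose t n i : R := Num.sqrt (2 * Q) * Num.sqrt (ln n%:R) / rho ^+ i.
pose s n i : R := a * (kR * q ^+ (n + i)).
pose I i := {ffun 'I_k -> bool * 'I_(K ^ i.+1)}.
pose y n i (b : I i) := node (n + i) (box_index b).
pose good n i (b : I i * I i.+1) := [/\ T (y n i b.1), T (y n i.+1 b.2)
   & Delta (y n i.+1 b.2) (y n i b.1) <= kR * q ^+ (n + i)].
pose A n i (b : I i * I i.+1) : set Omega :=
  if `[< good n i b >]
  then [set w | s n i * t n i < `|Z (y n i.+1 b.2) w - Z (y n i b.1) w|] else set0.
have mA n i b : measurable (A n i b).
  by rewrite /A; case: ifP => // _; exact: measurable_increment_gt.
have small : \forall n \near \oo, kR * q ^+ n <= eps.
  have : kR * q ^+ n @[n --> \oo] --> (0 : R).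
    rewrite -(mulr0 kR); apply: cvgM; first exact: cvg_cst.
    by apply: cvg_expr; rewrite gtr0_norm.
  by move=> /cvgr_le; apply.
have large : \forall n \near \oo, (1 : R) <= ln n%:R.
  near=> n; rewrite -[leLHS]expRK ler_ln ?posrE ?expR_gt0 //.
    by near: n; exact: nbhs_infty_ger.
  by rewrite ltr0n; near: n; exact: nbhs_infty_gt.
have bA : \forall n \near \oo, forall i b,
    (P (A n i b) <= (2 * expR (- (Q * ln n%:R / q ^+ i)))%:E)%E.
  near=> n => i b; rewrite /A; case: ifPn => [/asboolP[Ty Ty' yy]|_]; last first.
    by rewrite measure0 lee_fin mulr_ge0 // expR_ge0.
  have sn : kR * q ^+ n <= eps by near: n.
  have ln1 : 1 <= ln n%:R :> R by near: n.
  have -> : Q * ln n%:R / q ^+ i = t n i ^+ 2 / 2.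
    rewrite /t expr_div_n [X in _ = X / _ / _]exprMn.
    rewrite !sqr_sqrtr; last 2 first.
    - by rewrite (le_trans _ ln1).
    - by rewrite mulr_ge0 //; lra.
    rewrite exprAC -/q; field.
    by rewrite expf_neq0 // gt_eqF.
  apply: gaussian_tail; first exact: measurable_increment.
  - exact: gZ.
  - apply: (le_trans (Za _ _ Ty' Ty _)).
      rewrite (le_trans yy) // (le_trans _ sn) // ler_wpM2l // exprD.
      by rewrite ler_piMr ?exprn_ge0 ?exprn_ile1 // ltW.
    by rewrite /s ler_wpM2l // ltW.
  - by rewrite /t !mulr_ge0 ?invr_ge0 ?exprn_ge0 ?sqrtr_ge0 // ltW.
pose F n i := \big[setU/set0]_(b : I i * I i.+1) A n i b.
have mF n i : measurable (F n i) by apply: bigsetU_measurable.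
pose M : R := (2 ^ k * 2 ^ k * K ^ (3 * k))%N%:R * 4.
have M0 : 0 <= M by rewrite mulr_ge0.
have BC : {ae P, forall w, \forall n \near \oo, ~ (\bigcup_i F n i) w}.
  apply: (@borel_cantelli_first _ _ _ P _ (fun n => M * expR (- ((1 + 1) * ln n%:R)))).
  - by move=> n; exact: bigcupT_measurable.
  - by move=> n; rewrite mulr_ge0 // expR_ge0.
  - exact: cvg_series_expR_ln.
  - near=> n.
    have ln1 : 1 <= ln n%:R :> R by near: n.
    have bAn : forall i b, (P (A n i b) <= (2 * expR (- (Q * ln n%:R / q ^+ i)))%:E)%E.
      by near: n.
    set E := M * _; have E0 : 0 <= E by rewrite mulr_ge0 // expR_ge0.
    apply: (@le_trans _ _ (\sum_(i <oo) (P (F n i)))%E).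
      by apply: measure_sigma_subadditive => //; exact: bigcupT_measurable.
    apply: (@le_trans _ _ (\sum_(i <oo) (E / (2 ^ i.+1)%:R)%:E)%E); last first.
      exact: epsilon_trick0.
    apply: lee_nneseries => // i _.
    apply: (le_trans (finite_union_bound _ (bAn i))) => //.
    rewrite lee_fin card_prod !card_box (le_trans (HQ n i ln1)) //.
    by rewrite natrX exprVn.
apply: filterS BC => w nF; near=> n => x Tx xC m L.
have nFn : ~ (\bigcup_i F n i) w by near: n.
have ln1 : 1 <= ln n%:R :> R by near: n.
have link i : `|Z (grid (n + i.+1) x) w - Z (grid (n + i) x) w| <= s n i * t n i.
  rewrite leNgt; apply/negP => h; apply: nFn; exists i => //.
  have [b Eb] := grid_box (HK n i x xC).
  have [b' Eb'] := grid_box (HK n i.+1 x xC).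
  apply: (@subset_big_setU _ (A n i) (b, b')).
  rewrite /A ifT; first by rewrite /= /y -Eb -Eb'.
  apply/asboolP; rewrite /good /y /= -Eb -Eb'; split; try exact: grid_rectangle.
  by rewrite addnS; exact: Delta_grid_step.
(* [kR + 1] rather than [kR] keeps [B] positive when [k] is 0 *)
pose D : R := a * (kR + 1) * Num.sqrt (2 * Q) * (q ^+ n * Num.sqrt (ln n%:R)).
have qn0 : 0 <= q ^+ n by rewrite exprn_ge0 // ltW.
have D0 : 0 <= D.
  by rewrite /D !mulr_ge0 ?sqrtr_ge0 // ?ltr_wpDl // ltW // ltr_wpDl.
have stD i : s n i * t n i <= D * rho ^+ i.
  have -> : s n i * t n i = a * kR * Num.sqrt (2 * Q) * (q ^+ n * Num.sqrt (ln n%:R)) * rho ^+ i.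
    rewrite /s /t exprD (_ : q ^+ i = rho ^+ i * rho ^+ i); last first.
      by rewrite -exprD addnn -muln2 mulnC exprM.
    by field; rewrite expf_neq0 // gt_eqF.
  rewrite ler_wpM2r ?exprn_ge0 ?(ltW rho0) // /D.
  rewrite ler_wpM2r ?(mulr_ge0 qn0 (sqrtr_ge0 _)) //.
  by rewrite ler_wpM2r ?sqrtr_ge0 // ler_wpM2l ?(ltW a0) // lerDl.
have sumL : `|Z (grid (n + m + L) x) w - Z (grid (n + m) x) w| <=
    D * rho ^+ m * ((1 - rho ^+ L) / (1 - rho)).
  elim: L => [|L IH]; first by rewrite addn0 subrr normr0 expr0 subrr mul0r mulr0.
  have -> : Z (grid (n + m + L.+1) x) w - Z (grid (n + m) x) w =
    (Z (grid (n + (m + L).+1) x) w - Z (grid (n + (m + L)) x) w) +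
    (Z (grid (n + m + L) x) w - Z (grid (n + m) x) w).
    by rewrite addnS -addnA addrA subrK addnS.
  rewrite (le_trans (ler_normD _ _)) //.
  have -> : D * rho ^+ m * ((1 - rho ^+ L.+1) / (1 - rho)) =
    D * rho ^+ (m + L) + D * rho ^+ m * ((1 - rho ^+ L) / (1 - rho)).
    by rewrite exprD exprS; field; rewrite gt_eqF.
  by rewrite lerD // (le_trans (link _)).
apply: (le_trans sumL).
have -> : a * B * rho ^+ m * (q ^+ n * Num.sqrt (ln n%:R)) = D * rho ^+ m * (1 / (1 - rho)).
  by rewrite /B /D; ring.
rewrite (ler_wpM2l (mulr_ge0 D0 (exprn_ge0 m (ltW rho0)))) //.
by rewrite ler_wpM2r ?invr_ge0 ?(ltW r1) // gerBl exprn_ge0 // ltW.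
Unshelve. all: by end_near. Qed.

End chaining.

(** * The noise representation of the field *)

Section gaussian_fields.
Context {d : measure_display} {Omega : measurableType d} {R : realType}.
Variable P : probability Omega R.

(** Four terms are what the increment of [W A - v] between two points needs. *)
Lemma gaussian_comb4 (I : Type) (D : set I) (X : I -> {RV P >-> R}) (c1 c2 c3 c4 : R) i1 i2 i3 i4 :
  centered_gaussian_field D X -> D i1 -> D i2 -> D i3 -> D i4 ->
  centered_gaussian P (fun w => c1 * X i1 w + c2 * X i2 w + c3 * X i3 w + c4 * X i4 w).
Proof.
move=> gX D1 D2 D3 D4.
have := gX 4%N (fun i => nth 0 [:: c1; c2; c3; c4] i) (fun i => nth i1 [:: i1; i2; i3; i4] i).
have -> : (fun w => \sum_(i < 4) nth 0 [:: c1; c2; c3; c4] i * X (nth i1 [:: i1; i2; i3; i4] i) w)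
  = (fun w => c1 * X i1 w + c2 * X i2 w + c3 * X i3 w + c4 * X i4 w).
  by apply/funext => w; rewrite !big_ord_recl big_ord0 /= addr0 !addrA.
by apply; case=> [[|[|[|[|//]]]]].
Qed.

Lemma gaussian_diff (I : Type) (D : set I) (X : I -> {RV P >-> R}) i1 i2 :
  centered_gaussian_field D X -> D i1 -> D i2 ->
  centered_gaussian P (fun w => X i1 w - X i2 w).
Proof.
move=> gX D1 D2; have := gaussian_comb4 1 (-1) 0 0 gX D1 D2 D1 D1.
by congr centered_gaussian; apply/funext => w; rewrite !mul0r !addr0 mul1r mulN1r.
Qed.

Lemma gaussian_single (I : Type) (D : set I) (X : I -> {RV P >-> R}) i :
  centered_gaussian_field D X -> D i -> centered_gaussian P (X i).
Proof.
move=> gX D1; have := gaussian_comb4 1 0 0 0 gX D1 D1 D1 D1.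
by congr centered_gaussian; apply/funext => w; rewrite !mul0r !addr0 mul1r.
Qed.

Variables (k : nat) (v : 'rV[R]_k -> {RV P >-> R}) (T : set 'rV[R]_k).
Variable (W : set R -> 'rV[R]_k -> {RV P >-> R}).
Hypothesis hW : gaussian_noise_field v T W.

Lemma noise_square_integrable A x : borel_Rplus A -> T x -> square_integrable P (W A x).
Proof.
move=> bA Tx; apply: gaussian_square_integrable => //.
exact: (@gaussian_single _ _ (fun p => W p.1 p.2) (A, x) (noise_gaussian hW)).
Qed.

Lemma borel_Rplus_set0 : borel_Rplus (set0 : set R).
Proof. by split. Qed.

(** Countable additivity for the constant family [set0] says that
    [`|1 - n| * L2norm (W set0 x)] tends to 0. *)
Lemma noise_set0 x : T x -> {ae P, forall w, W set0 x w = 0}.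
Proof.
move=> Tx; have s0 := noise_square_integrable borel_Rplus_set0 Tx.
apply: L2norm_eq0 => //.
have := noise_additive hW Tx (fun=> borel_Rplus_set0).
rewrite bigcup0 //.
have -> : (fun n : nat => L2norm P (fun w => W set0 x w - \sum_(i < n) W set0 x w)) =
    (fun n : nat => `|1 - n%:R| * L2norm P (W set0 x)).
  apply/funext => n; rewrite -L2normZ //; congr L2norm; apply/funext => w.
  by rewrite sumr_const card_ord mulrBl mul1r mulr_natl.
have tI : trivIset setT (fun _ : nat => set0 : set R) by move=> i j _ _ [? []].
move=> /(_ tI)/cvgr_le h.
apply/eqP; rewrite eq_le L2norm_ge0 andbT; apply/ler_addgt0Pr => e e0; rewrite add0r.
have [N _ /(_ (maxn N 2) (leq_maxl _ _))] := h e e0.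
apply: le_trans; rewrite ler_peMl ?L2norm_ge0 //.
have : (2 : R) <= (maxn N 2)%:R by rewrite ler_nat leq_maxr.
by move=> N2; rewrite distrC ger0_norm; lra.
Qed.

Lemma noise_setU A B x : borel_Rplus A -> borel_Rplus B -> A `&` B = set0 -> T x ->
  {ae P, forall w, W (A `|` B) x w = W A x w + W B x w}.
Proof.
move=> bA bB AB Tx.
have bAB : borel_Rplus (A `|` B).
  split; first by apply: measurableU; [exact: bA.1|exact: bB.1].
  by rewrite subUset; split; [exact: bA.2|exact: bB.2].
pose F := bigcup2 A B.
have bF i : borel_Rplus (F i) by rewrite /F /bigcup2;
  case: i => [//|[//|i]] /=; exact: borel_Rplus_set0.
have tF : trivIset setT F.
  apply/trivIsetP => -[|[|i]] [|[|j]] _ _ // _; rewrite /F /bigcup2 /= ?setI0 ?set0I //.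
  by rewrite setIC.
have := noise_additive hW Tx bF tF.
rewrite bigcup2E => h.
have sAB := noise_square_integrable bAB Tx.
have sA := noise_square_integrable bA Tx.
have sB := noise_square_integrable bB Tx.
have sD : square_integrable P (fun w => W (A `|` B) x w - (W A x w + W B x w)).
  by apply: square_integrableD => //; apply/square_integrableN/square_integrableD.
suff /(L2norm_eq0 sD) : L2norm P (fun w => W (A `|` B) x w - (W A x w + W B x w)) = 0.
  by apply: filterS => w /eqP; rewrite subr_eq0 => /eqP.
apply: (@cvg_unique _ _ _ _ _ _ _ h) => //.
apply: (@cvg_trans _ ((fun=> L2norm P (fun w => W (A `|` B) x w - (W A x w + W B x w))) @ \oo));
  last exact: cvg_cst.
apply: near_eq_cvg; exists 2%N => // n /= n2.
apply: L2norm_ae.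
- exact: sD.1.
- apply: measurable_funB => //; apply: measurable_sum => i; exact: measurable_funP.
apply: filterS (noise_set0 Tx) => w w0.
congr (_ - _); rewrite -(big_mkord xpredT (fun i => W (F i) x w)) (@big_cat_nat _ _ _ 2) //=.
rewrite [X in _ = _ + X]big_nat_cond [X in _ = _ + X]big1 ?addr0.
  by rewrite big_nat_recl // big_nat1.
by move=> [|[|i]] // _; rewrite /F /bigcup2 /=.
Qed.

Lemma Ico_measurable (a : R) b : measurable (Ico a b).
Proof.
case: b => [b||].
- have -> : Ico a b%:E = `[a, b[%classic.
    by apply/seteqP; split => t; rewrite /Ico /= in_itv /= lte_fin; [move=> [-> ->]|move=> /andP[]].
  exact: measurable_itv.
- have -> : Ico a +oo%E = `[a, +oo[%classic.
    apply/seteqP; split => t; rewrite /Ico /= in_itv /= andbT; first by case.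
    by move=> ->; rewrite ltry.
  exact: measurable_itv.
- have -> : Ico a -oo%E = set0 by apply/seteqP; split => t // -[].
  exact: measurable0.
Qed.

Lemma borel_Rplus_Ico (a : R) b : 0 <= a -> borel_Rplus (Ico a b).
Proof.
move=> a0; split; first exact: Ico_measurable.
by move=> t [at_ _]; rewrite /= in_itv /= andbT (le_trans a0).
Qed.

Lemma Ico_cat (a : R) (b : R) (c : \bar R) : a <= b -> (b%:E <= c)%E ->
  Ico a c = Ico a b%:E `|` Ico b c.
Proof.
move=> ab bc; apply/seteqP; split => t.
  move=> [at_ tc]; have [tb|bt] := ltP t b; [left|right]; split => //.
by move=> [[at_ tb]|[bt tc]]; split => //; [rewrite (lt_le_trans tb)|rewrite (le_trans ab)].
Qed.

Lemma Ico_disjoint (a : R) (b c : R) (e : \bar R) : b <= c -> Ico a b%:E `&` Ico c e = set0.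
Proof.
move=> bc; apply/seteqP; split => t // [[_ tb] [ct _]].
by move: tb; rewrite lte_fin ltNge (le_trans bc ct).
Qed.

Lemma noise_Ico_cat (a b : R) (c : \bar R) x : 0 <= a -> a <= b -> (b%:E <= c)%E -> T x ->
  {ae P, forall w, W (Ico a c) x w = W (Ico a b%:E) x w + W (Ico b c) x w}.
Proof.
move=> a0 ab bc Tx; rewrite (Ico_cat ab bc); apply: noise_setU => //.
- exact: borel_Rplus_Ico.
- by apply: borel_Rplus_Ico; rewrite (le_trans a0).
- exact: Ico_disjoint.
Qed.

Lemma noise_Ico0y x : T x -> {ae P, forall w, W (Ico 0 +oo%E) x w = v x w}.
Proof.
move=> Tx; have -> : Ico 0 +oo%E = `[(0 : R), +oo[%classic.
  apply/seteqP; split => t; rewrite /Ico /= in_itv /= andbT; first by case.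
  by move=> ->; rewrite ltry.
exact: (noise_total hW).
Qed.

Lemma noise_split (b : R) x : 0 <= b -> T x ->
  {ae P, forall w, v x w = W (Ico 0 b%:E) x w + W (Ico b +oo%E) x w}.
Proof.
move=> b0 Tx; have h1 := noise_Ico0y Tx; have h2 := noise_Ico_cat (lexx 0) b0 (leey b%:E) Tx.
by apply: filterS2 h1 h2 => w <- ->.
Qed.

Lemma noise_diff_gaussian A x y : borel_Rplus A -> T x -> T y ->
  centered_gaussian P (fun w => W A x w - W A y w).
Proof.
move=> bA Tx Ty.
exact: (@gaussian_diff _ _ (fun p => W p.1 p.2) (A, x) (A, y) (noise_gaussian hW)).
Qed.

(** [v] is jointly Gaussian with the noise because it is almost surely the noise of
    the whole half-line. *)
Lemma noise_residual_gaussian A x y : borel_Rplus A -> T x -> T y ->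
  centered_gaussian P (fun w => W A x w - v x w - W A y w + v y w).
Proof.
move=> bA Tx Ty.
have bR : borel_Rplus (Ico (0 : R) +oo%E) by exact: borel_Rplus_Ico.
have g := @gaussian_comb4 _ _ (fun p => W p.1 p.2) 1 (-1) (-1) 1 (A, x) (Ico 0 +oo%E, x)
  (A, y) (Ico 0 +oo%E, y) (noise_gaussian hW) (conj bA Tx) (conj bR Tx) (conj bA Ty) (conj bR Ty).
have mf (X1 X2 X3 X4 : {RV P >-> R}) : measurable_fun setT (fun w => X1 w - X2 w - X3 w + X4 w).
  by apply: measurable_funD => //; apply: measurable_funB => //; exact: measurable_funB.
apply: centered_gaussian_ae g.
- do 3! (apply: measurable_funD; last by apply: measurable_funM).
  exact: measurable_funM.
- exact: mf.
- have h1 := noise_Ico0y Tx; have h2 := noise_Ico0y Ty.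
  by apply: filterS2 h1 h2 => w /= -> ->; rewrite !mul1r !mulN1r.
Qed.

Lemma cvg_noise_Ico0 x : T x ->
  L2norm P (fun w => v x w - W (Ico 0 n%:R%:E) x w) @[n --> \oo] --> 0.
Proof.
move=> Tx.
pose A (n : nat) := Ico (n%:R : R) n.+1%:R%:E.
have bA n : borel_Rplus (A n) by exact: borel_Rplus_Ico.
have tA : trivIset setT A.
  apply/trivIsetP => i j _ _ ij; wlog ltij : i j ij / (i < j)%N.
    by move=> h; case: (ltngtP i j) ij => // lij _; [|rewrite setIC]; apply: h; rewrite // ltn_eqF.
  by apply: Ico_disjoint; rewrite ler_nat.
have UA : \bigcup_n A n = Ico 0 +oo%E.
  apply/seteqP; split => t.
    by move=> [n _ [nt _]]; split; rewrite ?ltry // (le_trans _ nt).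
  move=> [t0 _]; have /andP[n1 n2] := truncn_itv t0.
  by exists (Num.truncn t) => //; split.
have := noise_additive hW Tx bA tA; rewrite UA.
apply: cvg_trans; apply: near_eq_cvg; apply: nearW => n.
apply: L2norm_ae.
- by apply: measurable_funB => //; apply: measurable_sum => i; exact: measurable_funP.
- exact: measurable_funB.
have h : {ae P, forall w, \sum_(i < n) W (A i) x w = W (Ico 0 n%:R%:E) x w}.
  elim: n => [|n IH].
    have -> : Ico 0 0%:E = set0 :> set R.
      apply/seteqP; split => t // -[t0]; rewrite lte_fin ltNge t0 //.
    by apply: filterS (noise_set0 Tx) => w ->; rewrite big_ord0.
  have h2 := noise_Ico_cat (lexx 0) (ler0n R n) (_ : (n%:R%:E <= n.+1%:R%:E)%E) Tx.
  have {}h2 := h2 ltac:(by rewrite lee_fin ler_nat).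
  by apply: filterS2 IH h2 => w E1 ->; rewrite big_ord_recr /= E1.
by apply: filterS2 h (noise_Ico0y Tx) => w -> ->.
Qed.

End gaussian_fields.

(** * Increments carried by a frequency band *)

Section frequency_bands.
Context {d : measure_display} {Omega : measurableType d} {R : realType}.
Variables (P : probability Omega R) (k : nat).
Variables (v : 'rV[R]_k -> {RV P >-> R}) (T : set 'rV[R]_k) (gamma : 'I_k -> R).
Variable (W : set R -> 'rV[R]_k -> {RV P >-> R}).
Hypothesis hW : gaussian_noise_field v T W.
Variables c0 a0 : R.
Hypotheses (c0_gt0 : 0 < c0) (a0_ge0 : 0 <= a0) (gamma0 : forall j, 0 < gamma j).
Hypothesis hb : forall (a : R) (b : \bar R) (x y : 'rV[R]_k),
  a0 <= a -> (a%:E < b)%E -> T x -> T y ->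
  L2norm P (fun w => W (Ico a b) x w - v x w - W (Ico a b) y w + v y w)
  <= c0 * (\sum_(j < k) a `^ gamma j * `|x 0 j - y 0 j| + fine b^-1%E).
Local Notation Delta := (Delta gamma).
Implicit Types x y : 'rV[R]_k.

Definition powR_sum (u : R) : R := \sum_(j < k) u `^ gamma j.

Lemma powR_sum_le (u u' : R) : 0 <= u -> u <= u' -> powR_sum u <= powR_sum u'.
Proof.
move=> u0 uu'; apply: ler_sum => j _; rewrite ge0_ler_powR ?nnegrE //.
  exact: ltW.
exact: le_trans uu'.
Qed.

Lemma powR_sum1 : powR_sum 1 = k%:R.
Proof.
rewrite /powR_sum; under eq_bigr do rewrite powR1.
by rewrite sumr_const card_ord.
Qed.

Lemma powR_sum_small (e : R) : 0 < e -> exists2 u, 0 < u & powR_sum u <= e.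
Proof.
move=> e0.
have k1 : (0 : R) < k.+1%:R by rewrite ltr0n.
have e1 : 0 < e / k.+1%:R by rewrite divr_gt0.
have h : \forall u \near 0^'+, forall j, u `^ gamma j <= e / k.+1%:R.
  apply: filter_forall => j.
  by have /cvgr_le/(_ _ e1) := powR_cvg0 (gamma0 j).
have [u [u0 hu]] := filter_ex (filterI (nbhs_right_gt (0 : R)) h).
exists u => //; rewrite /powR_sum.
apply: (le_trans (ler_sum _ (fun j _ => hu j))).
rewrite sumr_const card_ord -[leLHS]mulr_natr mulrAC ler_pdivrMr //.
by rewrite ler_wpM2l ?ler_nat // ltW.
Qed.

(** By [coord_le_Delta], [a `^ gamma j * Delta `^ (gamma j + 1)] equals
    [(a * Delta) `^ gamma j * Delta]: the anisotropic bound of Assumption A becomes a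
    function of the single number [a * Delta]. *)
Lemma weighted_increment_le (a : R) x y : 0 <= a ->
  \sum_(j < k) a `^ gamma j * `|x 0 j - y 0 j| <= powR_sum (a * Delta x y) * Delta x y.
Proof.
move=> a_ge0; have D0 := Delta_ge0 gamma x y.
rewrite /powR_sum mulr_suml; apply: ler_sum => j _.
rewrite powRM // -mulrA ler_wpM2l ?powR_ge0 //.
rewrite (le_trans (coord_le_Delta gamma0 x y j)) //.
rewrite powRD ?powRr1 //.
by apply/implyP => /eqP h; have := gamma0 j; lra.
Qed.

(** Assumption A with [b = +oo], where the residual is minus the noise below [a]. *)
Lemma low_frequency_bound (a : R) x y : a0 <= a -> T x -> T y ->
  L2norm P (fun w => W (Ico 0 a%:E) x w - W (Ico 0 a%:E) y w) <=
  c0 * (powR_sum (a * Delta x y) * Delta x y).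
Proof.
move=> a0a Tx Ty; have a_ge0 : 0 <= a := le_trans a0_ge0 a0a.
have := hb a0a (ltry a) Tx Ty; rewrite invey /= addr0.
have -> : L2norm P (fun w => W (Ico a +oo%E) x w - v x w - W (Ico a +oo%E) y w + v y w) =
  L2norm P (fun w => W (Ico 0 a%:E) x w - W (Ico 0 a%:E) y w).
  rewrite -(L2normN _ (fun w => W (Ico 0 a%:E) x w - W (Ico 0 a%:E) y w)).
  apply: L2norm_ae.
  - apply: measurable_funD => //; apply: measurable_funB => //; exact: measurable_funB.
  - by apply: measurableT_comp => //; exact: measurable_funB.
  by apply: filterS2 (noise_split hW a_ge0 Tx) (noise_split hW a_ge0 Ty) => w -> ->; ring.
move=> /le_trans; apply; rewrite ler_wpM2l ?(ltW c0_gt0) //.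
exact: weighted_increment_le.
Qed.

Lemma band_approximation (a b : R) x y : a0 <= a -> a < b -> T x -> T y ->
  L2norm P (fun w => W (Ico a b%:E) x w - v x w - W (Ico a b%:E) y w + v y w) <=
  c0 * (powR_sum (a * Delta x y) * Delta x y + b^-1).
Proof.
move=> a0a ab Tx Ty; have a_ge0 : 0 <= a := le_trans a0_ge0 a0a.
have b0 : 0 < b := le_lt_trans a_ge0 ab.
have := @hb a b%:E x y a0a ab Tx Ty; rewrite inver gt_eqF //=.
move=> /le_trans; apply; rewrite ler_wpM2l ?(ltW c0_gt0) // lerD2r.
exact: weighted_increment_le.
Qed.

(** For fixed [a] the factor [powR_sum (a * Delta)] tends to 0 with [Delta]. *)
Lemma low_frequency_negligible (a e : R) : a0 <= a -> 0 < e -> exists2 eps, 0 < eps &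
  forall x y, T x -> T y -> Delta x y <= eps ->
    L2norm P (fun w => W (Ico 0 a%:E) x w - W (Ico 0 a%:E) y w) <= e * Delta x y.
Proof.
move=> a0a e0; have a_ge0 : 0 <= a := le_trans a0_ge0 a0a.
have [u u0 hu] := powR_sum_small (divr_gt0 e0 c0_gt0).
have a1 : 0 < a + 1 by rewrite ltr_wpDl.
exists (u / (a + 1)); first by rewrite divr_gt0.
move=> x y Tx Ty xy; have D0 := Delta_ge0 gamma x y.
apply: (le_trans (low_frequency_bound a0a Tx Ty)).
rewrite mulrA ler_wpM2r // mulrC -ler_pdivlMr // (le_trans _ hu) //.
apply: powR_sum_le; first by rewrite mulr_ge0.
apply: (@le_trans _ _ ((a + 1) * Delta x y)); first by rewrite ler_wpM2r // lerDl.
by rewrite mulrC -ler_pdivlMr.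
Qed.

(** Cut the frequencies at [a0] and at [b = Delta^-1]: for this [b] both terms of the
    band bound are of order [Delta]. *)
Lemma canonical_metric_le_Delta :
  exists2 c1 : R, 0 < c1 & exists2 eps, 0 < eps & forall x y, T x -> T y ->
    Delta x y <= eps -> canonical_metric v x y <= c1 * Delta x y.
Proof.
exists (c0 * (3 * k%:R + 1)).
  by rewrite mulr_gt0 // ltr_wpDl // mulr_ge0.
exists (a0 + 1)^-1; first by rewrite invr_gt0 ltr_wpDl.
move=> x y Tx Ty xy; set D := Delta x y in xy *.
have D0 : 0 <= D := Delta_ge0 gamma x y.
have [DE|DN] := eqVneq D 0.
  rewrite DE mulr0 (Delta_eq0 gamma0 DE) /canonical_metric /L2norm unlock.
  by under eq_integral do rewrite subrr expr0n /=; rewrite integral0 /= sqrtr0.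
have Dgt0 : 0 < D by rewrite lt_neqAle eq_sym DN.
pose b := D^-1.
have ba0 : a0 < b.
  rewrite /b (@lt_le_trans _ _ (a0 + 1)) ?ltrDl //.
  by rewrite -[leLHS]invrK lef_pV2 ?posrE // invr_gt0 ltr_wpDl.
have b0 : 0 <= b by rewrite invr_ge0.
have bA : borel_Rplus (Ico 0 b%:E) by exact: borel_Rplus_Ico.
have aA : borel_Rplus (Ico 0 a0%:E) by exact: borel_Rplus_Ico.
have abA : borel_Rplus (Ico a0 b%:E) by exact: borel_Rplus_Ico.
pose X1 w := W (Ico 0 b%:E) x w - W (Ico 0 b%:E) y w.
pose X2 w := W (Ico a0 b%:E) x w - v x w - W (Ico a0 b%:E) y w + v y w.
pose X3 w := W (Ico 0 a0%:E) x w - W (Ico 0 a0%:E) y w.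
have mX2 : measurable_fun setT X2.
  apply: measurable_funD => //; apply: measurable_funB => //; exact: measurable_funB.
have sX1 : square_integrable P X1.
  by apply: gaussian_square_integrable; [exact: measurable_funB|exact: (noise_diff_gaussian hW)].
have sX2 : square_integrable P X2.
  by apply: gaussian_square_integrable => //; exact: (noise_residual_gaussian hW).
have sX3 : square_integrable P X3.
  by apply: gaussian_square_integrable; [exact: measurable_funB|exact: (noise_diff_gaussian hW)].
have S1 : powR_sum (b * D) = k%:R by rewrite /b mulVf // powR_sum1.
have Sa : powR_sum (a0 * D) <= k%:R.
  rewrite -powR_sum1 powR_sum_le ?mulr_ge0 //.
  by rewrite -ler_pdivlMr // mul1r ltW.
(* [W [0, b) = W [0, a0) + W [a0, b)] *)
have -> : canonical_metric v x y = L2norm P (fun w => X1 w + (- X2 w + - X3 w)).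
  apply: L2norm_ae.
  - exact: measurable_funB.
  - apply: measurable_funD; first exact: sX1.1.
    by apply: measurable_funD; apply: measurableT_comp => //; [exact: sX3.1].
  apply: filterS2 (noise_Ico_cat hW (lexx 0) a0_ge0 (ltW ba0 : (a0%:E <= b%:E)%E) Tx)
    (noise_Ico_cat hW (lexx 0) a0_ge0 (ltW ba0 : (a0%:E <= b%:E)%E) Ty) => w h1 h2.
  by rewrite /X1 /X2 /X3 h1 h2; ring.
apply: le_trans (L2norm_triangle _ _) _ => //.
  by apply: square_integrableD; exact: square_integrableN.
have h23 : L2norm P (fun w => - X2 w + - X3 w) <= L2norm P X2 + L2norm P X3.
  rewrite -(L2normN _ X2) -(L2normN _ X3).
  by apply: L2norm_triangle; exact: square_integrableN.
have h1 : L2norm P X1 <= c0 * (k%:R * D).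
  by rewrite -S1; apply: low_frequency_bound => //; exact: ltW.
have h2 : L2norm P X2 <= c0 * (k%:R * D + D).
  apply: (le_trans (band_approximation (lexx a0) ba0 Tx Ty)).
  by rewrite ler_wpM2l ?(ltW c0_gt0) // /b invrK lerD2r ler_wpM2r.
have h3 : L2norm P X3 <= c0 * (k%:R * D).
  apply: (le_trans (low_frequency_bound (lexx a0) Tx Ty)).
  by rewrite ler_wpM2l ?(ltW c0_gt0) // ler_wpM2r.
have -> : c0 * (3 * k%:R + 1) * D = c0 * (k%:R * D) + (c0 * (k%:R * D + D) + c0 * (k%:R * D)).
  by ring.
by rewrite lerD // (le_trans h23) // lerD.
Qed.

End frequency_bands.

(** * The iterated logarithm along geometric scales *)

Section iterated_logarithm.
Context {R : realType}.
Implicit Types u c t x y : R.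

Definition lnln u : R := ln (ln u^-1).

(** [ln] takes the value 0 at nonpositive reals, so monotonicity only needs the larger
    argument to be at least 1. *)
Lemma le_ln_ge1 x y : 1 <= y -> x <= y -> ln x <= ln y.
Proof.
move=> y1 xy; have y0 : 0 < y by rewrite (lt_le_trans _ y1).
have [x0|x0] := ltP 0 x; first by rewrite ler_ln ?posrE.
by rewrite ln0 // ln_ge0.
Qed.

Lemma ln_natr_pinfty (M : R) : \forall n \near \oo, M <= ln n%:R.
Proof.
near=> n; rewrite -[leLHS]expRK ler_ln ?posrE ?expR_gt0 //.
  by near: n; exact: nbhs_infty_ger.
by rewrite ltr0n; near: n; exact: nbhs_infty_gt.
Unshelve. all: by end_near. Qed.

Variable q : R.
Hypotheses (q0 : 0 < q) (q1 : q < 1).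

Let lam : R := ln q^-1.
Let lam0 : 0 < lam.
Proof. by rewrite ln_gt0 // invf_gt1. Qed.

Lemma lnVq n : ln (q ^+ n)^-1 = n%:R * lam.
Proof. by rewrite -exprVn lnXn ?invr_gt0 // mulr_natl. Qed.

(** [ln (q ^+ n)^-1] is [n * ln q^-1], so the iterated logarithm at [q ^+ n] differs from
    [ln n] by a constant, which the factor [1 + t] absorbs for large [n]. *)
Lemma ln_le_lnln t : 0 < t -> \forall n \near \oo, forall u, 0 < u -> u <= q ^+ n ->
  ln n%:R <= (1 + t) * lnln u.
Proof.
move=> t0; have t1 : 0 < 1 + t by rewrite ltr_wpDl.
near=> n => u u0 un.
have n0 : (0 : R) < n%:R by rewrite ltr0n; near: n; exact: nbhs_infty_gt.
have h : - (1 + t) * ln lam / t <= ln n%:R by near: n; exact: ln_natr_pinfty.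
have qn : 0 < q ^+ n by rewrite exprn_gt0.
apply: (@le_trans _ _ ((1 + t) * ln (n%:R * lam))).
  rewrite lnM ?posrE //.
  by move: h; rewrite ler_pdivrMr //; lra.
rewrite ler_wpM2l ?(ltW t1) // /lnln ler_ln ?posrE ?mulr_gt0 //.
  by rewrite -lnVq ler_ln ?posrE ?invr_gt0 // lef_pV2 ?posrE.
rewrite (@lt_le_trans _ _ (n%:R * lam)) ?mulr_gt0 //.
by rewrite -lnVq ler_ln ?posrE ?invr_gt0 // lef_pV2 ?posrE.
Unshelve. all: by end_near. Qed.

Lemma lnln_le_ln c t : 0 < c -> 0 < t -> \forall n \near \oo, forall u, c * q ^+ n <= u ->
  lnln u <= (1 + t) * ln n%:R.
Proof.
move=> c0 t0; pose M : R := lam + `|ln c|.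
have M0 : 0 < M by rewrite ltr_wpDr.
near=> n => u cu.
have n1 : (1 : R) <= n%:R by rewrite ler1n; near: n; exact: nbhs_infty_gt.
have n0 : (0 : R) < n%:R by rewrite (lt_le_trans _ n1).
have h : ln M / t <= ln n%:R by near: n; exact: ln_natr_pinfty.
have h1 : M^-1 <= n%:R by near: n; exact: nbhs_infty_ger.
have qn : 0 < q ^+ n by rewrite exprn_gt0.
have cq : 0 < c * q ^+ n by rewrite mulr_gt0.
have nM : 1 <= n%:R * M by rewrite -ler_pdivrMr // mul1r.
apply: (@le_trans _ _ (ln (n%:R * M))).
  apply: le_ln_ge1 => //.
  apply: (@le_trans _ _ (ln (c * q ^+ n)^-1)).
    by rewrite ler_ln ?posrE ?invr_gt0 ?(lt_le_trans cq) // lef_pV2 ?posrE ?(lt_le_trans cq).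
  rewrite invfM lnM ?posrE ?invr_gt0 // lnVq /M lnV ?posrE //.
  rewrite mulrDr addrC lerD2l (@le_trans _ _ `|ln c|) //.
    by rewrite -normrN ler_norm.
  by rewrite ler_peMl.
rewrite lnM ?posrE //.
by move: h; rewrite ler_pdivrMr //; lra.
Unshelve. all: by end_near. Qed.

(** The iterated logarithm does not feel constant factors: [ln (c * u)^-1] is at most
    [2 * ln u^-1] for small [u]. *)
Lemma lnln_scale c t : 0 < c -> 0 < t -> exists2 r : R, 0 < r &
  forall u u', 0 < u -> u <= r -> c * u <= u' -> lnln u' <= (1 + t) * lnln u.
Proof.
move=> c0 t0; pose M : R := Num.max (`|ln c| + 1) (expR (ln 2 / t)).
have M1 : 1 <= M by rewrite le_max lerDr normr_ge0.
exists (expR (- M)); first exact: expR_gt0.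
move=> u u' u0 ur cu; set y := ln u^-1.
have My : M <= y.
  by rewrite /y lnV ?posrE // lerNr -[leRHS]expRK ler_ln ?posrE ?expR_gt0.
have y1 : 1 <= y by exact: le_trans My.
have y0 : 0 < y by rewrite (lt_le_trans _ y1).
have cu0 : 0 < c * u by rewrite mulr_gt0.
apply: (@le_trans _ _ (ln (2 * y))).
  apply: le_ln_ge1; first by lra.
  apply: (@le_trans _ _ (ln (c * u)^-1)).
    by rewrite ler_ln ?posrE ?invr_gt0 ?(lt_le_trans cu0) // lef_pV2 ?posrE ?(lt_le_trans cu0).
  rewrite invfM lnM ?posrE ?invr_gt0 // -/y lnV ?posrE //.
  have h1 : - ln c <= `|ln c| by rewrite -normrN ler_norm.
  have h2 : `|ln c| + 1 <= M by rewrite le_max lexx.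
  by lra.
rewrite lnM ?posrE // /lnln -/y.
have h3 : ln 2 / t <= ln y.
  rewrite -[leLHS]expRK ler_ln ?posrE ?expR_gt0 // (le_trans _ My) //.
  by rewrite le_max lexx orbT.
by move: h3; rewrite ler_pdivrMr //; lra.
Qed.

Lemma lnln_gt0 : exists2 r : R, 0 < r & forall u, 0 < u -> u <= r -> 0 < lnln u.
Proof.
exists (expR (- 2)); first exact: expR_gt0.
move=> u u0 ur; rewrite /lnln ln_gt0 //.
rewrite (@lt_le_trans _ _ 2) ?ltr1n //.
by rewrite lnV ?posrE // lerNr -[leRHS]expRK ler_ln ?posrE ?expR_gt0.
Qed.

Lemma geometric_bracket u N : 0 < u -> u <= q ^+ N -> exists2 n, (N <= n)%N &
  q ^+ n.+1 < u <= q ^+ n.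
Proof.
move=> u0 uN.
have qN : exists n, q ^+ n < u.
  have : q ^+ n @[n --> \oo] --> (0 : R) by apply: cvg_expr; rewrite gtr0_norm.
  move=> /cvgr_lt /(_ _ u0)[n _ /(_ n)] /(_ (leqnn n)) h; by exists n.
case: (ex_minnP qN) => -[|n] hn hmin.
  have : q ^+ 0 < q ^+ 0.
    rewrite (lt_le_trans hn) // (le_trans uN) // expr0 exprn_ile1 // ltW //.
  by rewrite ltxx.
have un : u <= q ^+ n by rewrite leNgt; apply/negP => /hmin; rewrite ltnn.
exists n; last by rewrite hn un.
rewrite leqNgt; apply/negP => nN.
have := lt_le_trans hn uN; apply/negP; rewrite -leNgt.
by rewrite ler_wiXn2l // ltW.
Qed.
End iterated_logarithm.

(** * Events generated by a field *)

Section generated_sigma_algebra.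
Context {d : measure_display} {Omega : measurableType d} {R : realType}.
Variables (P : probability Omega R) (I : Type) (D : set I) (Z : I -> {RV P >-> R}).

(** The generators of [sigma_generated], named so that the generated sigma-algebra can
    be used as a measurable type. *)
Definition generating_system : set (set Omega) :=
  \bigcup_(i in D) preimage_set_system setT (Z i) measurable.

Lemma measurable_generated i : D i ->
  @measurable_fun _ _ (g_sigma_algebraType generating_system) R setT (Z i : Omega -> R).
Proof.
move=> Di _ B mB; apply: sub_sigma_algebra; exists i => //.
by exists B.
Qed.

Lemma sigma_generated_sub A : sigma_generated D Z A -> measurable A.
Proof.
apply: smallest_sub; first exact: sigma_algebra_measurable.
move=> _ [i _ [B mB <-]].
have mZ : measurable_fun setT (Z i) by [].
exact: mZ.
Qed.

Lemma sigma_generated_gt i j (a : R) : D i -> D j ->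
  sigma_generated D Z [set w | a < Z i w - Z j w].
Proof.
move=> Di Dj; pose S := g_sigma_algebraType generating_system.
have mD : @measurable_fun _ _ S R setT (fun w => Z i w - Z j w).
  by apply: measurable_funB; exact: measurable_generated.
have -> : [set w | a < Z i w - Z j w] = setT `&` (fun w => Z i w - Z j w) @^-1` `]a, +oo[%classic.
  by apply/seteqP; split => w; rewrite /= in_itv /= andbT // => -[].
by apply: mD => //; exact: measurable_itv.
Qed.

Lemma sigma_generated_norm_gt i j (a : R) : D i -> D j ->
  sigma_generated D Z [set w | a < `|Z i w - Z j w|].
Proof.
move=> Di Dj; pose S := g_sigma_algebraType generating_system.
have mD : @measurable_fun _ _ S R setT (fun w => `|Z i w - Z j w|).
  apply: measurableT_comp; first exact: normr_measurable.
  by apply: measurable_funB; exact: measurable_generated.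
have -> : [set w | a < `|Z i w - Z j w|] =
    setT `&` (fun w => `|Z i w - Z j w|) @^-1` `]a, +oo[%classic.
  by apply/seteqP; split => w; rewrite /= in_itv /= andbT // => -[].
by apply: mD => //; exact: measurable_itv.
Qed.

Lemma sigma_generated_le i (a : R) : D i -> sigma_generated D Z [set w | Z i w <= a].
Proof.
move=> Di; pose S := g_sigma_algebraType generating_system.
have -> : [set w | Z i w <= a] = setT `&` (Z i : Omega -> R) @^-1` `]-oo, a]%classic.
  by apply/seteqP; split => w; rewrite /= in_itv /= // => -[].
by apply: (measurable_generated Di) => //; exact: measurable_itv.
Qed.

Lemma sigma_generated_bigcap (F : nat -> set Omega) :
  (forall n, sigma_generated D Z (F n)) -> sigma_generated D Z (\bigcap_n F n).
Proof.
move=> mF; exact: (@bigcapT_measurable _ (g_sigma_algebraType generating_system)).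
Qed.

Lemma sigma_generated_bigcup (F : nat -> set Omega) :
  (forall n, sigma_generated D Z (F n)) -> sigma_generated D Z (\bigcup_n F n).
Proof.
move=> mF; exact: (@bigcupT_measurable _ (g_sigma_algebraType generating_system)).
Qed.

End generated_sigma_algebra.

(** * The upper half of the law for the canonical metric *)

Section upper_bound.
Context {d : measure_display} {Omega : measurableType d} {R : realType}.
Variables (P : probability Omega R) (k : nat).
Variables (gamma : 'I_k -> R) (lo hi c : 'rV[R]_k).
Hypotheses (gamma0 : forall j, 0 < gamma j) (Tc : rectangle lo hi c).
Local Notation T := (rectangle lo hi).
Local Notation Delta := (Delta gamma).
Implicit Types x y : 'rV[R]_k.

Lemma cvg_norm_le (u : nat -> R) (l b : R) (a : R) : u n @[n --> \oo] --> l ->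
  (\forall n \near \oo, `|u n - a| <= b) -> `|l - a| <= b.
Proof.
move=> ul ub; have h : `|u n - a| @[n --> \oo] --> `|l - a|.
  by apply: cvg_norm; apply: cvgB => //; exact: cvg_cst.
exact: (cvgr_to_le h ub).
Qed.

(** The total loss in [lil_upper]: five factors [1 + t] from the comparison of scales,
    standard deviations and logarithms, and one summand [t] from the chaining. *)
Lemma lil_constant_le (t : R) : 0 <= t -> t <= 1 ->
  (1 + t) ^+ 3 * (Num.sqrt 2 * (1 + t) ^+ 2 + t) <= Num.sqrt 2 + 60 * t.
Proof.
move=> t0 t1.
have s2 : Num.sqrt 2 <= (3 / 2 : R).
  rewrite -(@ler_pXn2r _ 2) ?nnegrE ?sqrtr_ge0 ?divr_ge0 // sqr_sqrtr //.
  by rewrite expr2; lra.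
have s0 : 0 <= Num.sqrt 2 :> R := sqrtr_ge0 _.
have p n : t ^+ n.+1 <= t by rewrite exprS ler_piMr // exprn_ile1.
have h1 : (1 + t) ^+ 5 <= 1 + 31 * t.
  have -> : (1 + t) ^+ 5 = 1 + 5 * t + 10 * t ^+ 2 + 10 * t ^+ 3 + 5 * t ^+ 4 + t ^+ 5 by ring.
  by have := p 1%N; have := p 2%N; have := p 3%N; have := p 4%N; lra.
have h2 : (1 + t) ^+ 3 * t <= 8 * t.
  rewrite ler_wpM2r //.
  have -> : (1 + t) ^+ 3 = 1 + 3 * t + 3 * t ^+ 2 + t ^+ 3 by ring.
  by have := p 1%N; have := p 2%N; lra.
have -> : (1 + t) ^+ 3 * (Num.sqrt 2 * (1 + t) ^+ 2 + t) =
  Num.sqrt 2 * (1 + t) ^+ 5 + (1 + t) ^+ 3 * t by ring.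
have h3 : Num.sqrt 2 * (1 + t) ^+ 5 <= Num.sqrt 2 * (1 + 31 * t) by rewrite ler_wpM2l.
have h4 : Num.sqrt 2 * t <= 3 / 2 * t by rewrite ler_wpM2r.
by move: h3; rewrite mulrDr mulr1 mulrCA; lra.
Qed.

Lemma sqrt_le_scale (t x y : R) : 0 <= t -> 0 <= y -> x <= (1 + t) * y ->
  Num.sqrt x <= (1 + t) * Num.sqrt y.
Proof.
move=> t0 y0 xy; have t1 : 0 <= 1 + t by rewrite addr_ge0.
have -> : (1 + t) * Num.sqrt y = Num.sqrt ((1 + t) ^+ 2 * y).
  by rewrite sqrtrM ?sqr_ge0 // sqrtr_sqr ger0_norm.
rewrite ler_wsqrtr // (le_trans xy) // ler_wpM2r // expr2 ler_peMl //.
by rewrite lerDl.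
Qed.

(** In the shell [q ^+ n.+1 < d(x, c) <= q ^+ n], split the increment at the grid point
    [y] of level [n + m] near [x]: the part from [c] to [y] is a point of the net, with
    standard deviation at most [(1 + t) * q ^+ n]; the part from [y] to [x] is bounded by
    chaining and continuity. *)
Lemma lil_upper (v : 'rV[R]_k -> {RV P >-> R}) (c1 c3 eps t : R) :
  gaussian_increments lo hi v -> continuous_field v ->
  0 < c1 -> 0 < eps -> (forall x y, T x -> T y -> Delta x y <= eps ->
    canonical_metric v x y <= c1 * Delta x y) ->
  0 < c3 -> (forall x y, T x -> T y -> c3 * Delta x y <= canonical_metric v x y) ->
  0 < t -> t <= 1 ->
  {ae P, forall w, exists2 r : R, 0 < r & forall x, T x ->
    0 < canonical_metric v x c -> canonical_metric v x c <= r ->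
    `|v x w - v c w| <= (Num.sqrt 2 + 60 * t) *
      (canonical_metric v x c * Num.sqrt (lnln (canonical_metric v x c)))}.
Proof.
move=> gv cv c10 eps0 dc1 c30 dc3 t0 t1.
have tp : 0 < 1 + t by rewrite ltr_wpDl.
(* consecutive shells then differ by the factor [(1 + t) ^+ 2] *)
pose rho : R := (1 + t)^-1; pose q := rho ^+ 2.
have rho0 : 0 < rho by rewrite invr_gt0.
have rho1 : rho < 1 by rewrite invf_lt1 // ltrDl.
have q0 : 0 < q by rewrite exprn_gt0.
have q1 : q < 1 by rewrite expr_lt1 // ltW.
have [B B0 HB] := @chaining_bound _ _ _ P _ gamma rho gamma0 rho0 rho1 lo hi c Tc c3^-1.
have cvgq : q ^+ n @[n --> \oo] --> (0 : R) by apply: cvg_expr; rewrite gtr0_norm.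
have cvgrho : rho ^+ n @[n --> \oo] --> (0 : R) by apply: cvg_expr; rewrite gtr0_norm.
(* refine until both the chaining remainder and the displacement of [x] cost at most [t] *)
have [m [m1 m2]] : exists m, c1 * B * rho ^+ m <= t /\ c1 * k%:R * q ^+ m <= t.
  have h1 : \forall m \near \oo, c1 * B * rho ^+ m <= t.
    have : c1 * B * rho ^+ n @[n --> \oo] --> (0 : R).
      by rewrite -(mulr0 (c1 * B)); apply: cvgM => //; exact: cvg_cst.
    by move=> /cvgr_le /(_ _ t0).
  have h2 : \forall m \near \oo, c1 * k%:R * q ^+ m <= t.
    have : c1 * k%:R * q ^+ n @[n --> \oo] --> (0 : R).
      by rewrite -(mulr0 (c1 * k%:R)); apply: cvgM => //; exact: cvg_cst.
    by move=> /cvgr_le /(_ _ t0).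
  by have [m [? ?]] := filter_ex (filterI h1 h2); exists m.
have chain := HB v c1 eps gv c10 eps0 dc1.
have net := @coarse_net_bound _ _ _ P _ gamma rho gamma0 rho0 rho1 lo hi c Tc v c3^-1 t m
  (fun n => q ^+ n * (1 + t)) gv t0.
have small : \forall n \near \oo, k%:R * q ^+ n <= eps.
  have : k%:R * q ^+ n @[n --> \oo] --> (0 : R).
    by rewrite -(mulr0 k%:R); apply: cvgM => //; exact: cvg_cst.
  by move=> /cvgr_le /(_ _ eps0).
have lnbig := ln_le_lnln q0 q1 t0.
apply: filterS3 cv chain net => w cw chainw netw.
have [N _ HN] := filterI (filterI chainw netw) (filterI small (filterI lnbig (@ln_natr_pinfty R 0))).
exists (q ^+ N); first by rewrite exprn_gt0.
move=> x Tx; set dx := canonical_metric v x c => dx0 dxN.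
have [n Nn /andP[dn1 dn2]] := geometric_bracket q0 q1 dx0 dxN.
have [[{}chainw {}netw] [smalln [lnn ln0]]] := HN n Nn.
have qn0 : 0 < q ^+ n by rewrite exprn_gt0.
have Dx : Delta x c <= c3^-1 * q ^+ n.
  rewrite mulrC ler_pdivlMr // mulrC (le_trans (dc3 x c Tx Tc)) //.
set y := grid gamma q c (n + m) x.
have Ty : T y by exact: grid_rectangle.
have Dyx : Delta y x <= k%:R * q ^+ (n + m) by exact: Delta_grid.
have dyx : canonical_metric v y x <= t * q ^+ n.
  apply: (le_trans (dc1 y x Ty Tx _)).
    rewrite (le_trans Dyx) // (le_trans _ smalln) // ler_wpM2l // exprD.
    by rewrite ler_piMr ?exprn_ile1 // ltW.
  apply: (@le_trans _ _ (c1 * (k%:R * q ^+ (n + m)))); first by rewrite ler_wpM2l // ltW.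
  have -> : c1 * (k%:R * q ^+ (n + m)) = c1 * k%:R * q ^+ m * q ^+ n by rewrite exprD; ring.
  by rewrite ler_wpM2r // ltW.
have dyc : canonical_metric v y c <= q ^+ n * (1 + t).
  have -> : canonical_metric v y c = L2norm P (fun w => (v y w - v x w) + (v x w - v c w)).
    by congr L2norm; apply/funext => w'; rewrite addrA subrK.
  apply: (le_trans (L2norm_triangle _ _)).
  - by apply: gaussian_square_integrable; [exact: measurable_funB|exact: gv].
  - by apply: gaussian_square_integrable; [exact: measurable_funB|exact: gv].
  rewrite mulrDr mulr1 addrC lerD // mulrC; exact: dyx.
have bnet := netw x Tx Dx dyc.
have bchain : `|v x w - v y w| <= t * (q ^+ n * Num.sqrt (ln n%:R)).
  have h : `|v x w - v y w| <= c1 * B * rho ^+ m * (q ^+ n * Num.sqrt (ln n%:R)).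
    apply: (@cvg_norm_le (fun l => v (grid gamma q c l x) w)).
      have cx : v z w @[z --> x] --> v x w by exact: cw.
      exact: (cvg_comp _ _ (@cvg_grid _ _ _ _ gamma0 q0 q1 c x) cx).
    exists (n + m)%N => // l /= nml; rewrite -(subnKC nml); exact: chainw.
  by rewrite (le_trans h) // ler_wpM2r // mulr_ge0 ?sqrtr_ge0 // ltW.
have LL0 : 0 <= lnln dx.
  by rewrite -(pmulr_rge0 _ tp) (le_trans ln0) // lnn.
have sln : Num.sqrt (ln n%:R) <= (1 + t) * Num.sqrt (lnln dx).
  by apply: sqrt_le_scale => //; [exact: ltW|exact: lnn].
have bnet' : `|v y w - v c w| <= (q ^+ n * Num.sqrt (ln n%:R)) * (Num.sqrt 2 * (1 + t) ^+ 2).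
  apply: (le_trans bnet); rewrite sqrtrM //.
  have h : Num.sqrt ((1 + t) * ln n%:R) <= (1 + t) * Num.sqrt (ln n%:R).
    by apply: sqrt_le_scale => //; exact: ltW.
  apply: (@le_trans _ _ (q ^+ n * (1 + t) * (Num.sqrt 2 * ((1 + t) * Num.sqrt (ln n%:R))))).
    by rewrite ler_wpM2l ?ler_wpM2l ?sqrtr_ge0 // mulr_ge0 // ltW.
  by rewrite le_eqVlt; apply/orP; left; apply/eqP; ring.
have -> : v x w - v c w = (v x w - v y w) + (v y w - v c w) by rewrite addrA subrK.
apply: (le_trans (ler_normD _ _)); apply: (le_trans (lerD bchain bnet')).
have -> : t * (q ^+ n * Num.sqrt (ln n%:R)) +
    q ^+ n * Num.sqrt (ln n%:R) * (Num.sqrt 2 * (1 + t) ^+ 2) =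
  (q ^+ n * Num.sqrt (ln n%:R)) * (Num.sqrt 2 * (1 + t) ^+ 2 + t) by ring.
have qd : q ^+ n <= (1 + t) ^+ 2 * dx.
  have -> : (1 + t) ^+ 2 = q^-1 by rewrite /q /rho exprVn invrK.
  by rewrite ler_pdivlMl // -exprS ltW.
apply: (@le_trans _ _ ((1 + t) ^+ 2 * dx * ((1 + t) * Num.sqrt (lnln dx)) *
    (Num.sqrt 2 * (1 + t) ^+ 2 + t))).
  rewrite ler_wpM2r ?addr_ge0 ?mulr_ge0 ?sqrtr_ge0 ?sqr_ge0 ?(ltW t0) ?(ltW tp) //.
  by rewrite ler_pM ?sqrtr_ge0 // ltW.
have -> : (1 + t) ^+ 2 * dx * ((1 + t) * Num.sqrt (lnln dx)) * (Num.sqrt 2 * (1 + t) ^+ 2 + t) =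
  ((1 + t) ^+ 3 * (Num.sqrt 2 * (1 + t) ^+ 2 + t)) * (dx * Num.sqrt (lnln dx)) by ring.
rewrite ler_wpM2r ?mulr_ge0 ?sqrtr_ge0 ?(ltW dx0) //.
by apply: lil_constant_le => //; exact: ltW.
Qed.

End upper_bound.

(** * A zero-one law *)

Section zero_one_law.
Context {d : measure_display} {Omega : measurableType d} {R : realType}.
Variables (P : probability Omega R) (J : Type) (D : set J).
Implicit Types (Z : J -> {RV P >-> R}) (s : seq (J * R)).

Definition indices_in s : Prop := foldr (fun p Q => D p.1 /\ Q) True s.

(** Finite intersections of half-space conditions, shifted by [a] so that a small
    perturbation of the variables can be absorbed. *)
Definition orthant Z (a : R) s : set Omega :=
  foldr (fun p A => [set w | Z p.1 w <= p.2 + a] `&` A) setT s.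

Lemma indices_in_cat s1 s2 : indices_in s1 -> indices_in s2 -> indices_in (s1 ++ s2).
Proof. by elim: s1 => //= p s1 IH [Dp /IH h] /h. Qed.

Lemma orthant_cat Z a s1 s2 : orthant Z a (s1 ++ s2) = orthant Z a s1 `&` orthant Z a s2.
Proof. by elim: s1 => [|p s1 IH] /=; rewrite ?setTI // IH setIA. Qed.

Lemma sigma_generated_orthant Z a s : indices_in s -> sigma_generated D Z (orthant Z a s).
Proof.
elim: s => [_|p s IH /= [Dp /IH h]].
  exact: (@measurableT _ (g_sigma_algebraType (generating_system D Z))).
apply: (@measurableI _ (g_sigma_algebraType (generating_system D Z))) => //.
exact: sigma_generated_le.
Qed.

Lemma measurable_orthant Z a s : measurable (orthant Z a s).
Proof.
elim: s => [|p s IH] /=; first exact: measurableT.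
apply: measurableI => //.
have mZ : measurable_fun setT (Z p.1) by [].
have -> : [set w | Z p.1 w <= p.2 + a] = setT `&` Z p.1 @^-1` `]-oo, p.2 + a]%classic.
  by apply/seteqP; split => w; rewrite /= in_itv /= // => -[].
by apply: mZ => //; exact: measurable_itv.
Qed.

Lemma orthant_le Z a b s : a <= b -> orthant Z a s `<=` orthant Z b s.
Proof.
move=> ab; elim: s => [//|p s IH] w /= [h1 h2]; split; last exact: IH.
by rewrite (le_trans h1) // lerD2l.
Qed.

Lemma chebyshev_L2norm (X : Omega -> R) (e : R) : square_integrable P X -> 0 < e ->
  (P [set w | (e < `|X w|)%R] <= (L2norm P X ^+ 2 / e ^+ 2)%:E)%E.
Proof.
move=> [mX X2] e0.
have mX2 : measurable_fun setT (fun w => (X w ^+ 2)%:E : \bar R).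
  by apply/measurable_EFinP; exact: measurable_funX.
have mA := measurable_norm_gt e mX.
have I0 : (0 <= \int[P]_w (X w ^+ 2)%:E)%E.
  by apply: integral_ge0 => w _; rewrite lee_fin sqr_ge0.
have -> : L2norm P X ^+ 2 = fine (\int[P]_w (X w ^+ 2)%:E)%E.
  by rewrite /L2norm unlock sqr_sqrtr // fine_ge0.
rewrite mulrC EFinM fineK ?ge0_fin_numE // lee_pdivlMl ?exprn_gt0 //.
apply: (@le_trans _ _ (\int[P]_(w in [set w | (e < `|X w|)%R]) (e ^+ 2)%:E)%E).
  by rewrite integral_cst // lexx.
apply: (@le_trans _ _ (\int[P]_(w in [set w | (e < `|X w|)%R]) (X w ^+ 2)%:E)%E).
  apply: ge0_le_integral => //.
  - by move=> w _; rewrite lee_fin sqr_ge0.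
  - exact: measurable_funTS.
  - move=> w /= ew; rewrite lee_fin -(real_normK (num_real (X w))).
    by rewrite lerXn2r ?nnegrE ?normr_ge0 // ltW.
by apply: ge0_subset_integral => // w _; rewrite lee_fin sqr_ge0.
Qed.

(** A point of the first orthant outside the second one has a coordinate that moved by
    more than [e]. *)
Lemma orthant_perturbation (X Y : J -> {RV P >-> R}) (a e : R) s : 0 < e ->
  (forall i, D i -> square_integrable P (fun w => X i w - Y i w)) -> indices_in s ->
  (P (orthant X a s `\` orthant Y (a + e) s) <=
   (\sum_(p <- s) L2norm P (fun w => X p.1 w - Y p.1 w) ^+ 2 / e ^+ 2)%:E)%E.
Proof.
move=> e0 sXY; elim: s => [_|p s IH /= [Dp Ds]].
  by rewrite big_nil setDv measure0.
rewrite big_cons EFinD.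
have mp : measurable [set w | e < `|X p.1 w - Y p.1 w|].
  by apply: measurable_norm_gt; exact: measurable_funB.
apply: (@le_trans _ _ (P ([set w | (e < `|X p.1 w - Y p.1 w|)%R] `|`
    (orthant X a s `\` orthant Y (a + e) s)))).
  apply: le_measure; rewrite ?inE.
  - by apply: measurableD; exact: (measurable_orthant _ _ (p :: s)).
  - by apply: measurableU => //; apply: measurableD; exact: measurable_orthant.
  - move=> w /= [[Xp Xs] nY].
    have [h|h] := ltP e `|X p.1 w - Y p.1 w|; [by left|right; split => // Ys].
    apply: nY; split => //; move: h; rewrite ler_norml => /andP[h1 h2].
    by lra.
apply: (le_trans (measureU2 _ _ _)) => //.
  by apply: measurableD; exact: measurable_orthant.
apply: leeD; last exact: IH.
by apply: chebyshev_L2norm => //; exact: sXY.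
Qed.

Lemma orthant_bigcap Z s : orthant Z 0 s = \bigcap_n orthant Z n.+1%:R^-1 s.
Proof.
apply/seteqP; split => [w w0 n _|].
  by apply: orthant_le w0; rewrite invr_ge0.
elim: s => [//|p s IH] w /= h; split; last by apply: IH => n _; have [] := h n Logic.I.
rewrite addr0 leNgt; apply/negP => /ltr_add_invr[n] hn.
have [hp _] := h n Logic.I.
by move: hp; rewrite /= leNgt => /negP; apply.
Qed.

Lemma fine_probability_le (A B : set Omega) : measurable A -> measurable B ->
  fine (P A) <= fine (P B) + fine (P (A `\` B)).
Proof.
move=> mA mB; have mD := measurableD mA mB.
rewrite -lee_fin EFinD !fineK ?fin_num_measure //.
apply: le_trans (measureU2 _ mB mD); apply: le_measure; rewrite ?inE //.
  exact: measurableU.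
by move=> w Aw; have [Bw|nBw] := pselect (B w); [left|right].
Qed.

(** [E] is independent of [U N] for every [N], because up to a null set it is determined by
    [V N].  As [U N] approximates [X], [E] is independent of the orthants of [X], which
    are stable under intersection and generate the sigma-algebra of [X]; hence [E] is
    independent of itself. *)
Lemma zero_one_law (X : J -> {RV P >-> R}) (U V : nat -> J -> {RV P >-> R}) (E : set Omega) :
  sigma_generated D X E ->
  (forall N, exists2 E', sigma_generated D (V N) E' & {ae P, forall w, E w <-> E' w}) ->
  (forall N, independent_processes D D (U N) (V N)) ->
  (forall N i, D i -> square_integrable P (fun w => X i w - U N i w)) ->
  (forall i, D i -> L2norm P (fun w => X i w - U n i w) @[n --> \oo] --> (0 : R)) ->
  P E = 0%E \/ P E = 1%E.
Proof.
move=> EX EV indUV sXU cXU.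
have mE : measurable E := sigma_generated_sub EX.
have indU N s a : indices_in s -> P (E `&` orthant (U N) a s) = (P E * P (orthant (U N) a s))%E.
  move=> Ds; have [E' VE' EE'] := EV N.
  have mE' : measurable E' := sigma_generated_sub VE'.
  have mO := measurable_orthant (U N) a s.
  have -> : P (E `&` orthant (U N) a s) = P (orthant (U N) a s `&` E').
    apply: probability_ae_eq; [exact: measurableI|exact: measurableI|].
    by apply: filterS EE' => w h; split => -[? ?]; split => //; apply/h.
  rewrite (indUV N) //; last exact: sigma_generated_orthant.
  by rewrite muleC; congr (_ * _)%E; apply/esym/probability_ae_eq.
(* for large [N] the orthants of [X] and of [U N] are close up to a shift by [e] *)
have close s e : indices_in s -> 0 < e -> \forall N \near \oo,
    (P (orthant X 0 s `\` orthant (U N) e s) <= e%:E)%E /\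
    (P (orthant (U N) e s `\` orthant X (e + e) s) <= e%:E)%E.
  move=> Ds e0.
  have /cvgr_le /(_ e e0) : \sum_(p <- s) L2norm P (fun w => X p.1 w - U N p.1 w) ^+ 2 / e ^+ 2
      @[N --> \oo] --> (0 : R).
    elim: s Ds => [_|p s IH /= [Dp Ds]].
      by under eq_fun do rewrite big_nil; exact: cvg_cst.
    have c1 : L2norm P (fun w => X p.1 w - U N p.1 w) @[N --> \oo] --> (0 : R) by exact: cXU.
    rewrite [X in _ --> X](_ : 0 = 0 * 0 * (e ^+ 2)^-1 + 0); last by rewrite !mul0r addr0.
    apply: cvg_trans (cvgD (cvgM (cvgM c1 c1) (cvg_cst (e ^+ 2)^-1)) (IH Ds)).
    by apply: near_eq_cvg; apply: nearW => N; rewrite big_cons expr2.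
  apply: filterS => N hN; split.
    rewrite -{1}(add0r e); apply: le_trans (orthant_perturbation 0 e0 _ Ds) _.
      by move=> i Di; exact: sXU.
    by rewrite lee_fin.
  apply: le_trans (orthant_perturbation e e0 _ Ds) _.
    move=> i Di; have := square_integrableN (sXU N i Di).
    by congr square_integrable; apply/funext => w; rewrite opprB.
  rewrite lee_fin (le_trans _ hN) // le_eqVlt; apply/orP; left; apply/eqP.
  by apply: eq_bigr => p _; rewrite L2norm_sub_sym.
have prE A : measurable A -> P A = (fine (P A))%:E by move=> mA; rewrite fineK // fin_num_measure.
have indX s : indices_in s -> P (E `&` orthant X 0 s) = (P E * P (orthant X 0 s))%E.
  move=> Ds; set F := orthant X 0 s.
  have mF : measurable F by exact: measurable_orthant.
  pose G n := orthant X n.+1%:R^-1 s.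
  have mG n : measurable (G n) by exact: measurable_orthant.
  have mEF : measurable (E `&` F) by exact: measurableI.
  have mEG n : measurable (E `&` G n) by exact: measurableI.
  have niG : nonincreasing_seq G.
    move=> m n mn; apply/subsetPset/orthant_le.
    by rewrite lef_pV2 ?posrE ?ltr0n // ler_nat.
  have cG : fine (P (G n)) @[n --> \oo] --> fine (P F).
    apply: fine_cvg; rewrite -prE //.
    rewrite /F orthant_bigcap; apply: nonincreasing_cvg_mu => //.
      by rewrite (le_lt_trans (probability_le1 _ _)) // ltry.
    exact: bigcapT_measurable.
  have cEG : fine (P (E `&` G n)) @[n --> \oo] --> fine (P (E `&` F)).
    apply: fine_cvg; rewrite -prE //.
    have -> : E `&` F = \bigcap_n (E `&` G n).
      rewrite /F orthant_bigcap; apply/seteqP; split => w.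
        by move=> [Ew h] n _; split => //; exact: h.
      by move=> h; split => [|n _]; [have [] := h 0%N Logic.I|have [] := h n Logic.I].
    apply: nonincreasing_cvg_mu => //.
    - by rewrite (le_lt_trans (probability_le1 _ _)) // ltry.
    - exact: bigcapT_measurable.
    - by move=> m n mn; have /subsetPset h := niG _ _ mn; apply/subsetPset; exact: setIS.
  have step n : fine (P (E `&` F)) <= fine (P E) * fine (P (G n)) + n.+1%:R^-1 /\
      fine (P E) * fine (P F) <= fine (P (E `&` G n)) + n.+1%:R^-1.
    pose e : R := n.+1%:R^-1 / 2.
    have e0 : 0 < e by rewrite divr_gt0 ?invr_gt0.
    have ee : e + e = n.+1%:R^-1 by rewrite /e -splitr.
    have [N [h1 h2]] := filter_ex (close s e Ds e0).
    rewrite ee in h2; set O := orthant (U N) e s in h1 h2.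
    have mO : measurable O by exact: measurable_orthant.
    have {}h1 : fine (P (F `\` O)) <= e by rewrite -lee_fin -prE //; exact: measurableD.
    have {}h2 : fine (P (O `\` G n)) <= e by rewrite -lee_fin -prE //; exact: measurableD.
    have hi : fine (P (E `&` O)) = fine (P E) * fine (P O).
      by rewrite indU // fineM // fin_num_measure.
    have pE0 : 0 <= fine (P E) by exact: fine_ge0.
    have pE1 : fine (P E) <= 1 by rewrite -lee_fin -prE // probability_le1.
    have mEO : measurable (E `&` O) by exact: measurableI.
    have sub A B C : measurable A -> measurable B -> measurable C ->
        fine (P ((A `&` B) `\` (A `&` C))) <= fine (P (B `\` C)).
      move=> mA mB mC.
      have m1 : measurable ((A `&` B) `\` (A `&` C)) by apply: measurableD; exact: measurableI.
      have m2 : measurable (B `\` C) by exact: measurableD.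
      rewrite -lee_fin -!prE //; apply: le_measure; rewrite ?inE //.
      by move=> w [[Aw Bw] nAC]; split => // Cw; apply: nAC.
    have k1 := fine_probability_le mEF mEO; have k2 := fine_probability_le mO (mG n).
    have k3 := fine_probability_le mF mO; have k4 := fine_probability_le mEO (mEG n).
    have s1 := sub _ _ _ mE mF mO; have s2 := sub _ _ _ mE mO (mG n).
    have q1 : fine (P E) * fine (P O) <= fine (P E) * fine (P (G n)) + e.
      apply: (@le_trans _ _ (fine (P E) * (fine (P (G n)) + e))).
        by rewrite ler_wpM2l // (le_trans k2) // lerD2l.
      by rewrite mulrDr lerD2l ler_piMl // ltW.
    have q2 : fine (P E) * fine (P F) <= fine (P E) * fine (P O) + e.
      apply: (@le_trans _ _ (fine (P E) * (fine (P O) + e))).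
        by rewrite ler_wpM2l // (le_trans k3) // lerD2l.
      by rewrite mulrDr lerD2l ler_piMl // ltW.
    rewrite -ee; move: k1 k4 s1 s2 q1 q2 h1 h2; rewrite hi.
    move: (fine (P (E `&` F `\` E `&` O))) (fine (P (E `&` O `\` E `&` G n))).
    move: (fine (P (F `\` O))) (fine (P (O `\` G n))) (fine (P (E `&` F))) (fine (P (E `&` G n))).
    move: (fine (P E) * _) (fine (P E) * _) (fine (P E) * _).
    by move=> *; split; lra.
  have ch : n.+1%:R^-1 @[n --> \oo] --> (0 : R) by exact: cvg_harmonic.
  rewrite (prE _ mEF) (prE _ mE) (prE _ mF) -EFinM; congr EFin.
  apply/eqP; rewrite eq_le; apply/andP; split.
    rewrite -[leRHS]addr0; apply: (ler_cvg_to (cvg_cst (fine (P (E `&` F))))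
      (cvgD (cvgM (cvg_cst (fine (P E))) cG) ch)).
    by apply: nearW => n; have [] := step n.
  rewrite -[leRHS]addr0; apply: (ler_cvg_to (cvg_cst (fine (P E) * fine (P F))) (cvgD cEG ch)).
  by apply: nearW => n; have [] := step n.
(* the orthants of X form a pi-system generating its sigma-algebra *)
pose H : set (set Omega) := [set F | exists2 s, indices_in s & F = orthant X 0 s].
have HI : setI_closed H.
  move=> _ _ [s1 D1 ->] [s2 D2 ->]; exists (s1 ++ s2); first exact: indices_in_cat.
  by rewrite orthant_cat.
have HT : H setT by exists [::].
have Hm : H `<=` measurable by move=> _ [s _ ->]; exact: measurable_orthant.
have mX i : D i -> @measurable_fun _ _ (g_sigma_algebraType H) R setT (X i : Omega -> R).
  move=> Di; apply: (measurability _ (RGenOInfty.measurableE R)) => //.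
  move=> _ [_ [x ->] <-].
  have -> : setT `&` (X i : Omega -> R) @^-1` `]x, +oo[%classic = ~` orthant X 0 [:: (i, x)].
    apply/seteqP; split => w; rewrite /= in_itv /= andbT addr0.
      by move=> [_ xw] [h _]; move: h; rewrite leNgt xw.
    by move=> h; split => //; rewrite ltNge; apply/negP => h'; apply: h.
  apply: (@measurableC _ (g_sigma_algebraType H)); apply: sub_sigma_algebra.
  by exists [:: (i, x)].
have HE : <<s H >> E.
  apply: (smallest_sub _ _ EX); first exact: smallest_sigma_algebra.
  by move=> _ [i Di [B mB <-]]; exact: mX.
have PE0 : 0 <= fine (P E) by exact: fine_ge0.
have cover : \bigcup_(_ : nat) [set: Omega] = setT by apply/seteqP; split => // w _; exists 0%N.
(* two finite measures that agree on the orthants agree on [E] *)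
have key : P (E `&` E) = ((fine (P E))%:E * P E)%E.
  apply: (@g_sigma_algebra_measure_unique _ _ _ H Hm (fun=> setT) (fun=> HT)
    cover (mrestr P mE) (mscale (NngNum PE0) P) HI _ _ E HE).
  - move=> _ [s Ds ->].
    have h : P (orthant X 0 s `&` E) = ((fine (P E))%:E * P (orthant X 0 s))%E.
      by rewrite setIC indX // -prE.
    exact: h.
  - by move=> _; rewrite /mrestr /= (le_lt_trans (probability_le1 _ _)) ?ltry // setTI.
move: key; rewrite setIid (prE E mE) -EFinM => -[] /eqP.
rewrite -subr_eq0 -[X in X - _]mulr1 -mulrBr mulf_eq0 => /orP[/eqP ->|].
  by left.
by rewrite subr_eq0 => /eqP <-; right.
Qed.
End zero_one_law.

(** * Negligible fields and the exceedance event *)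

Section negligible_fields.
Context {d : measure_display} {Omega : measurableType d} {R : realType}.
Variables (P : probability Omega R) (k : nat).
Variables (gamma : 'I_k -> R) (lo hi c : 'rV[R]_k) (rho : R).
Hypotheses (gamma0 : forall j, 0 < gamma j) (Tc : rectangle lo hi c).
Hypotheses (rho0 : 0 < rho) (rho1 : rho < 1).
Local Notation T := (rectangle lo hi).
Local Notation Delta := (Delta gamma).
Implicit Types x y : 'rV[R]_k.
Let q := rho ^+ 2.
Let q0 : 0 < q. Proof. by rewrite exprn_gt0. Qed.
Let q1 : q < 1. Proof. by rewrite expr_lt1 // ltW. Qed.

Lemma ex_invS_lt (e : R) : 0 < e -> exists p : nat, p.+1%:R^-1 < e.
Proof. by move=> e0; have := @ltr_add_invr R 0 e e0; under eq_exists do rewrite add0r. Qed.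

Definition grid_point x := exists l, grid gamma q c l x = x.

(** If [l < n], the coordinates of [x] are within one cell of level [l] from [c] and are
    rounded to [c], whereas [x] is fixed by the rounding and differs from [c]. *)
Lemma grid_point_level l n x : grid gamma q c l x = x -> 0 < Delta x c ->
  Delta x c <= q ^+ n -> (n <= l)%N.
Proof.
move=> gx x0 xn; rewrite leqNgt; apply/negP => lln.
suff xc : x = c by move: x0; rewrite xc Deltaxx // ltxx.
rewrite -gx; apply/rowP => j; rewrite mxE /trunc_toward.
have -> : Num.truncn (`|x 0 j - c 0 j| / mesh gamma q l j) = 0%N.
  apply: truncn_def; have m0 := mesh_gt0 gamma q0 l j.
  rewrite divr_ge0 ?(ltW m0) //= ltr_pdivrMr // mul1r.
  apply: (le_lt_trans (coord_le_Delta gamma0 x c j)).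
  rewrite gt0_ltr_powR ?nnegrE ?Delta_ge0 ?(ltW (exprn_gt0 l q0)) ?addr_gt0 //.
  by rewrite (le_lt_trans xn) // ltr_iXn2l.
by rewrite mul0r mulr0 addr0.
Qed.

(** Only grid points are considered because the paths of [Z] need not be continuous: a
    point of the grid of level [l] is reached by finitely many links. *)
Lemma lil_negligible (Z : 'rV[R]_k -> {RV P >-> R}) (t : R) :
  gaussian_increments lo hi Z ->
  (forall e, 0 < e -> exists2 eps, 0 < eps & forall x y, T x -> T y -> Delta x y <= eps ->
    L2norm P (fun w => Z x w - Z y w) <= e * Delta x y) -> 0 < t ->
  {ae P, forall w, exists2 r : R, 0 < r & forall x, T x -> grid_point x ->
    0 < Delta x c -> Delta x c <= r ->
    `|Z x w - Z c w| <= t * (Delta x c * Num.sqrt (lnln (Delta x c)))}.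
Proof.
move=> gZ smallZ t0.
have [B B0 HB] := @chaining_bound _ _ _ P _ gamma rho gamma0 rho0 rho1 lo hi c Tc 1.
(* the chaining and the first grid point cost [e * B] and [e * 2]; a factor [2 / q] is
lost between [q ^+ n * sqrt (ln n)] and the modulus at [x] *)
pose e := t * q / (2 * (B + 2)).
have B2 : 0 < 2 * (B + 2) by rewrite mulr_gt0 // ltr_wpDl // ltW.
have e0 : 0 < e by rewrite divr_gt0 // mulr_gt0.
have [eps eps0 Ze] := smallZ e e0.
have chain := HB Z e eps gZ e0 eps0 Ze.
have net := @coarse_net_bound _ _ _ P _ gamma rho gamma0 rho0 rho1 lo hi c Tc Z 1 1 0
  (fun n => e * q ^+ n) gZ ltr01.
have cvgq : q ^+ n @[n --> \oo] --> (0 : R) by apply: cvg_expr; rewrite gtr0_norm.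
have small : \forall n \near \oo, q ^+ n <= eps.
  by move: cvgq => /cvgr_le /(_ _ eps0).
have lnbig := ln_le_lnln q0 q1 (@ltr01 R).
apply: filterS2 chain net => w chainw netw.
have [N _ HN] := filterI (filterI chainw netw) (filterI small (filterI lnbig (@ln_natr_pinfty R 0))).
exists (q ^+ N); first by rewrite exprn_gt0.
move=> x Tx [l gx]; set dx := Delta x c => dx0 dxN.
have [n Nn /andP[dn1 dn2]] := geometric_bracket q0 q1 dx0 dxN.
have [[{}chainw {}netw] [smalln [lnn ln0]]] := HN n Nn.
have qn0 : 0 < q ^+ n by rewrite exprn_gt0.
have nl : (n <= l)%N := grid_point_level gx dx0 dn2.
have Dx : Delta x c <= 1 * q ^+ n by rewrite mul1r.
have bchain := chainw x Tx Dx 0%N (l - n)%N.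
rewrite addn0 subnKC // gx expr0 mulr1 in bchain.
have bnet := netw x Tx Dx; rewrite addn0 in bnet.
have dn : Delta (grid gamma q c n x) c <= q ^+ n.
  by rewrite (le_trans (Delta_grid_shrink gamma0 q0 c n x)).
have {}bnet : `|Z (grid gamma q c n x) w - Z c w| <= e * 2 * (q ^+ n * Num.sqrt (ln n%:R)).
  have -> : e * 2 * (q ^+ n * Num.sqrt (ln n%:R)) =
    e * q ^+ n * Num.sqrt (2 * ((1 + 1) * ln n%:R)).
    rewrite (mulrA 2 (1 + 1)) sqrtrM; last by rewrite mulr_ge0 // addr_ge0.
    have -> : Num.sqrt (2 * (1 + 1)) = 2 :> R.
      by rewrite (_ : 2 * (1 + 1) = 2 ^+ 2) ?sqrtr_sqr ?ger0_norm // expr2.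
    by ring.
  apply: bnet.
  have Ty : T (grid gamma q c n x) by exact: grid_rectangle.
  apply: (le_trans (Ze _ _ Ty Tc _)); first exact: le_trans smalln.
  by rewrite ler_wpM2l // ltW.
have sln : Num.sqrt (ln n%:R) <= 2 * Num.sqrt (lnln dx).
  have LL0 : 0 <= lnln dx.
    by have := le_trans ln0 (lnn _ dx0 dn2); rewrite pmulr_rge0.
  by apply: sqrt_le_scale => //; exact: lnn.
have -> : Z x w - Z c w = (Z x w - Z (grid gamma q c n x) w) +
  (Z (grid gamma q c n x) w - Z c w) by rewrite addrA subrK.
apply: (le_trans (ler_normD _ _)); apply: (le_trans (lerD bchain bnet)).
have -> : e * B * (q ^+ n * Num.sqrt (ln n%:R)) + e * 2 * (q ^+ n * Num.sqrt (ln n%:R)) =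
  (e * (B + 2)) * (q ^+ n * Num.sqrt (ln n%:R)) by ring.
have qd : q ^+ n <= q^-1 * dx by rewrite ler_pdivlMl // -exprS ltW.
apply: (@le_trans _ _ (e * (B + 2) * (q^-1 * dx * (2 * Num.sqrt (lnln dx))))).
  have eB : 0 <= e * (B + 2) by rewrite (mulr_ge0 (ltW e0)) // addr_ge0 // ltW.
  by rewrite (ler_wpM2l eB) // ler_pM ?sqrtr_ge0 // ltW.
rewrite le_eqVlt; apply/orP; left; apply/eqP.
have B2' : B + 2 != 0 by rewrite gt_eqF // ltr_wpDl // ltW.
by rewrite /e; field; rewrite B2' gt_eqF.
Qed.

Definition lil_modulus x : R := Delta x c * Num.sqrt (lnln (Delta x c)).

Lemma lil_modulus_ge0 x : 0 <= lil_modulus x.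
Proof. by rewrite mulr_ge0 ?sqrtr_ge0 // Delta_ge0. Qed.

Definition grid_enum (i : nat) : 'rV[R]_k :=
  if (unpickle i : option (nat * {ffun 'I_k -> bool * nat})) is Some (l, s)
  then node gamma q c l s else c.

Lemma grid_enum_surj x : grid_point x -> exists i, grid_enum i = x.
Proof.
move=> [l gx]; exists (pickle (l, grid_index gamma q c l x)).
by rewrite /grid_enum pickleK -gridE.
Qed.

Definition punctured_grid : set 'rV[R]_k :=
  [set x | [/\ T x, grid_point x & 0 < Delta x c]].

(** The event that the normalized increments of [Z] at [c] have a limsup larger than [t]
    along the grids.  Only countably many points are involved, which makes it an event of
    the field without any regularity of the paths.  The margin [p.+1%:R^-1] makes it
    insensitive to perturbations negligible with respect to [lil_modulus]. *)
Definition exceeds (Z : 'rV[R]_k -> {RV P >-> R}) (t : R) : set Omega :=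
  \bigcup_p \bigcap_n \bigcup_(x in punctured_grid `&` [set x | Delta x c <= n.+1%:R^-1])
    [set w | (t + p.+1%:R^-1) * lil_modulus x < `|Z x w - Z c w|].

Lemma sigma_generated_exceeds Z t : sigma_generated T Z (exceeds Z t).
Proof.
apply: sigma_generated_bigcup => p; apply: sigma_generated_bigcap => n.
set S := _ `&` _; pose A x := [set w | (t + p.+1%:R^-1) * lil_modulus x < `|Z x w - Z c w|].
have -> : \bigcup_(x in S) A x = \bigcup_i (if `[< S (grid_enum i) >] then A (grid_enum i) else set0).
  apply/seteqP; split => w.
    move=> [x Sx Ax]; have [i Ei] := grid_enum_surj (let: conj (And3 _ g _) _ := Sx in g).
    by exists i => //; rewrite Ei ifT //; exact/asboolP.
  by move=> [i _]; case: ifPn => [/asboolP Si Ai|//]; exists (grid_enum i).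
apply: sigma_generated_bigcup => i; case: ifPn => [/asboolP [[Ti _ _] _]|_].
  exact: sigma_generated_norm_gt.
exact: (@measurable0 _ (g_sigma_algebraType (generating_system T Z))).
Qed.

Lemma exceeds_nonincreasing Z t t' : t <= t' -> exceeds Z t' `<=` exceeds Z t.
Proof.
move=> tt' w [p _ h]; exists p => // n _; have [x Sx Ax] := h n Logic.I.
exists x => //; rewrite /= (le_lt_trans _ Ax) // ler_wpM2r ?lil_modulus_ge0 //.
by rewrite lerD2r.
Qed.

Lemma exceedsP Z t w : exceeds Z t w -> forall r, 0 < r -> exists2 x, T x /\ 0 < Delta x c <= r &
  t * lil_modulus x <= `|Z x w - Z c w|.
Proof.
move=> [p _ h] r r0; have [n hn] := ex_invS_lt r0.
have [x [[Tx _ x0] xn] Ax] := h n Logic.I.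
exists x; first by rewrite x0 (le_trans xn) // ltW.
rewrite (le_trans _ (ltW Ax)) // ler_wpM2r ?lil_modulus_ge0 //.
by rewrite lerDl invr_ge0.
Qed.

Lemma exceeds_perturbation_sub (Z1 Z2 : 'rV[R]_k -> {RV P >-> R}) (t : R) w :
  (forall e : R, 0 < e -> exists2 r, 0 < r & forall x, T x -> grid_point x -> 0 < Delta x c ->
     Delta x c <= r -> `|(Z1 x w - Z1 c w) - (Z2 x w - Z2 c w)| <= e * lil_modulus x) ->
  exceeds Z1 t w -> exceeds Z2 t w.
Proof.
move=> small [p _ h]; pose e : R := p.+1%:R^-1 / 2.
have e0 : 0 < e by rewrite divr_gt0 ?invr_gt0.
have [r r0 hr] := small e e0.
have [N hN] := ex_invS_lt r0.
(* half of the margin [p.+1%:R^-1] pays for the perturbation *)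
exists (p.*2.+1) => // n _.
have [x [[Tx gx x0] xn] Ax] := h (maxn n N) Logic.I.
have xn' : Delta x c <= n.+1%:R^-1.
  by rewrite (le_trans xn) // lef_pV2 ?posrE ?ltr0n // ler_nat ltnS leq_maxl.
have xr : Delta x c <= r.
  by rewrite (le_trans xn) // (le_trans _ (ltW hN)) // lef_pV2 ?posrE ?ltr0n // ler_nat ltnS leq_maxr.
exists x => //=; have := hr x Tx gx x0 xr; move: Ax => /=.
have -> : p.*2.+2%:R^-1 = e.
  by rewrite /e -[p.*2.+2]/(p.+1.*2) -muln2 natrM invfM.
have -> : p.+1%:R^-1 = e + e by rewrite /e -splitr.
move: (Z1 x w - Z1 c w) (Z2 x w - Z2 c w) (lil_modulus x) => a b m Ax ab.
have h3 : `|a| <= `|b| + `|a - b|.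
  by rewrite -{1}(subrK b a) addrC (le_trans (ler_normD _ _)) // addrC.
by lra.
Qed.

Lemma cvg_Delta_grid x : Delta (grid gamma q c l x) c @[l --> \oo] --> Delta x c.
Proof.
rewrite /Delta; apply: cvg_big; first exact: add_continuous.
move=> j _; have a0 := alpha_gt0 gamma0 j.
have [xc|xc] := eqVneq (x 0 j) (c 0 j).
  rewrite xc subrr normr0 powR0 ?gt_eqF //.
  apply: (@cvg_trans _ ((fun=> 0 : R) @ \oo)); last exact: cvg_cst.
  apply: near_eq_cvg; apply: nearW => l.
  have := trunc_toward_shrink (c 0 j) (x 0 j) (mesh_gt0 gamma q0 l j).
  by rewrite mxE xc subrr normr0 normr_le0 => /eqP ->; rewrite normr0 powR0 // gt_eqF.
have n0 : 0 < `|x 0 j - c 0 j| by rewrite normr_gt0 subr_eq0.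
have cp : {for `|x 0 j - c 0 j|, continuous (fun z : R => z `^ alpha gamma j)}.
  apply: differentiable_continuous; apply/derivable1_diffP.
  by apply: derivable_powR; rewrite in_itv /= andbT.
have cx : `|grid gamma q c l x 0 j - c 0 j| @[l --> \oo] --> `|x 0 j - c 0 j|.
  apply: cvg_norm; apply: cvgB; last exact: cvg_cst.
  apply/cvgrPdist_le => e e0.
  have /cvgr_le /(_ e e0) := @cvg_mesh _ _ _ _ gamma0 q0 q1 j.
  apply: filterS => l me; rewrite mxE (le_trans _ me) //.
  exact: trunc_toward_dist (mesh_gt0 gamma q0 l j).
exact: (cvg_comp _ _ cx cp).
Qed.

(** Continuity of the path carries the bound from the grids to the rectangle: the
    roundings of [x] converge to [x], and their distances to [c] do not exceed [Delta x c]. *)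
Lemma not_exceeds_bound (v : 'rV[R]_k -> {RV P >-> R}) (t : R) w (e : R) :
  continuous (fun x => v x w) -> ~ exceeds v t w -> 0 < e ->
  exists2 r, 0 < r & forall x, T x -> 0 < Delta x c -> Delta x c <= r ->
    `|v x w - v c w| <= (t + e) * lil_modulus x.
Proof.
move=> cw nE e0.
have [p hp] := ex_invS_lt e0.
have [n hn] : exists n : nat, forall x, punctured_grid x -> Delta x c <= n.+1%:R^-1 ->
    `|v x w - v c w| <= (t + p.+1%:R^-1) * lil_modulus x.
  apply: contrapT => hn; apply: nE; exists p => // n _; apply: contrapT => hx.
  apply: hn; exists n => x Gx xn; rewrite leNgt; apply/negP => Ax.
  by apply: hx; exists x.
have r1 : 0 < expR (- 1) :> R := expR_gt0 _.
(* below [expR (- 1)] the inner logarithm exceeds 1 and [lnln] is continuous *)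
exists (Num.min n.+1%:R^-1 (expR (- 1) / 2)).
  by rewrite lt_min invr_gt0 ltr0n divr_gt0.
move=> x Tx x0; rewrite le_min => /andP[xn xr].
have cD := @cvg_Delta_grid x.
have cm : lil_modulus (grid gamma q c l x) @[l --> \oo] --> lil_modulus x.
  apply: cvgM => //; set D := Delta x c.
  have iD : 1 < D^-1.
    rewrite invf_gt1 // (le_lt_trans xr) // ltr_pdivrMr //.
    by rewrite (@le_lt_trans _ _ 1) ?mulr_natr ?expR_le1 //; lra.
  have cL : {for D, continuous (fun u : R => Num.sqrt (lnln u))}.
    apply: (@continuous_comp _ _ _ (@lnln R) Num.sqrt); last exact: sqrt_continuous.
    apply: (@continuous_comp _ _ _ (fun u : R => ln u^-1) (@ln R)); last first.
      by apply: continuous_ln; rewrite ln_gt0.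
    apply: (@continuous_comp _ _ _ (@GRing.inv R) (@ln R)); last first.
      by apply: continuous_ln; rewrite invr_gt0.
    by apply: inv_continuous; rewrite gt_eqF.
  exact: (cvg_comp _ _ cD cL).
have cx : v z w @[z --> x] --> v x w by exact: cw.
have cv := cvg_comp _ _ (@cvg_grid _ _ _ _ gamma0 q0 q1 c x) cx.
have cn : `|v (grid gamma q c l x) w - v c w| @[l --> \oo] --> `|v x w - v c w|.
  by apply: cvg_norm; apply: cvgB; [exact: cv|exact: cvg_cst].
have h : `|v x w - v c w| <= (t + p.+1%:R^-1) * lil_modulus x.
  apply: (ler_cvg_to cn (cvgM (cvg_cst (t + p.+1%:R^-1)) cm)).
  have /(cvgr_gt _ cD) : 0 < Delta x c by [].
  apply: filterS => l l0; apply: hn.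
    split => //; first exact: grid_rectangle.
    by exists l; rewrite gridK.
  by rewrite (le_trans (Delta_grid_shrink gamma0 q0 c l x)).
rewrite (le_trans h) // ler_wpM2r ?lil_modulus_ge0 //.
by rewrite lerD2l ltW.
Qed.

End negligible_fields.

(** * The lower half of the law for the canonical metric *)

Section lower_bound.
Context {d : measure_display} {Omega : measurableType d} {R : realType}.
Variables (P : probability Omega R) (k : nat).

Lemma harmonic_minorant_diverges (p : nat -> R) (b : R) (N : nat) : 0 < b ->
  (forall n, 0 <= p n) -> (forall n, (N <= n)%N -> b / n.+1%:R <= p n) ->
  forall M : R, exists K, M <= \sum_(n < K) p n.
Proof.
move=> b0 p0 bp M; apply: contrapT => nK.
have bnd K : \sum_(n < K) p n <= M.
  by rewrite leNgt; apply/negP => h; apply: nK; exists K; exact: ltW.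
have head K : \sum_(n < K) (if (n < N)%N then b else 0) = (minn K N)%:R * b.
  elim: K => [|K IH]; first by rewrite big_ord0 min0n mul0r.
  rewrite big_ord_recr /= IH; case: ltnP => KN.
    by rewrite (minn_idPl KN) -(natr1 K) mulrDl mul1r.
  by rewrite addr0 (minn_idPr (leqW KN)).
have ch : cvgn (series (fun n => b * harmonic n)).
  apply: nondecreasing_is_cvgn.
    apply/nondecreasing_seqP => n; rewrite /series /= big_nat_recr //= lerDl.
    by rewrite mulr_ge0 ?harmonic_ge0 // ltW.
  exists (N%:R * b + M) => _ [K _ <-]; rewrite /series /= big_mkord.
  apply: (@le_trans _ _ (\sum_(n < K) ((if (n < N)%N then b else 0) + p n))).
    apply: ler_sum => n _; case: ltnP => nN; last by rewrite add0r; exact: bp.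
    rewrite -[leLHS]addr0 lerD // /harmonic ger_pMr // invf_le1 ?ltr0n //.
    by rewrite ler1n.
  rewrite big_split /= head lerD ?bnd //.
  by rewrite ler_wpM2r ?(ltW b0) // ler_nat geq_minr.
apply: (@dvg_harmonic R).
have -> : harmonic = b^-1 *: (fun n => b * harmonic n) :> (R^nat).
  by apply/funext => n; rewrite -[RHS]/(b^-1 * (b * harmonic n)) mulKf // gt_eqF.
exact: is_cvg_seriesZ.
Qed.

Variables (v : 'rV[R]_k -> {RV P >-> R}) (gamma : 'I_k -> R) (lo hi c : 'rV[R]_k).
Variable (W : set R -> 'rV[R]_k -> {RV P >-> R}).
Hypotheses (gamma0 : forall j, 0 < gamma j) (Tc : rectangle lo hi c).
Hypothesis lohi : forall j, lo 0 j < hi 0 j.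
Local Notation T := (rectangle lo hi).
Local Notation Delta := (Delta gamma).
Implicit Types x y : 'rV[R]_k.
Hypothesis hW : gaussian_noise_field v T W.
Variables c0 a0 : R.
Hypotheses (c0_gt0 : 0 < c0) (a0_ge0 : 0 <= a0).
Hypothesis hb : forall (a : R) (b : \bar R) (x y : 'rV[R]_k),
  a0 <= a -> (a%:E < b)%E -> T x -> T y ->
  L2norm P (fun w => W (Ico a b) x w - v x w - W (Ico a b) y w + v y w)
  <= c0 * (\sum_(j < k) a `^ gamma j * `|x 0 j - y 0 j| + fine b^-1%E).

(** Since the sides of the rectangle have positive length, one of the two directions of
    the axis [j0] stays inside it. *)
Lemma Delta_axis_point (j0 : 'I_k) : exists2 u0 : R, 0 < u0 &
  forall u, 0 <= u -> u <= u0 -> exists2 x, T x & Delta x c = u.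
Proof.
have /andP[c1 c2] := Tc j0; have lh := lohi j0.
have [s [h0 [s1 h00 hs]]] : exists s h0 : R, [/\ `|s| = 1, 0 < h0 &
    forall h, 0 <= h -> h <= h0 -> lo 0 j0 <= c 0 j0 + s * h <= hi 0 j0].
  have [ch|ch] := ltP (c 0 j0) (hi 0 j0).
    exists 1, (hi 0 j0 - c 0 j0); split; rewrite ?normr1 ?subr_gt0 // => h h0 hh.
    by rewrite mul1r; apply/andP; split; lra.
  exists (-1), (c 0 j0 - lo 0 j0); split; rewrite ?normrN1 ?subr_gt0 //; first by lra.
  by move=> h h0 hh; rewrite mulN1r; apply/andP; split; lra.
exists (h0 `^ alpha gamma j0); first exact: powR_gt0.
move=> u u_ge0 uu0; pose h := u `^ (gamma j0 + 1).
have hu : h `^ alpha gamma j0 = u by exact: powR_alphaK.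
have hh0 : h <= h0.
  rewrite -(alphaK_powR gamma0 j0 (ltW h00)) ge0_ler_powR ?nnegrE ?powR_ge0 //.
  by rewrite addr_ge0 // ltW.
exists (\row_j (c 0 j + (if j == j0 then s * h else 0))).
  move=> j; rewrite mxE; case: eqP => [->|_]; last by rewrite addr0.
  by apply: hs => //; exact: powR_ge0.
rewrite /Defs.Delta (bigD1 j0) //= big1 => [|j jj0].
  by rewrite mxE eqxx addr0 addrAC subrr add0r normrM s1 mul1r ger0_norm ?powR_ge0.
rewrite mxE (negPf jj0) addr0 subrr normr0 powR0 //.
by rewrite gt_eqF // alpha_gt0.
Qed.

(** For [s = sqrt (2 ln n)] the exponent [((1 - t) * s + 1) ^+ 2 / 2] is at most
    [ln n + 1 / 2] once [t * ln n] dominates [s]. *)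
Lemma gaussian_lower_tail_ln (t : R) : 0 < t -> t <= 1 ->
  \forall n \near \oo, forall X : Omega -> R,
  measurable_fun setT X -> centered_gaussian P X -> 0 < L2norm P X ->
  ((normal_peak 1 * expR (- (1 / 2)) / n%:R)%:E <=
   P [set w | (L2norm P X * ((1 - t) * Num.sqrt (2 * ln n%:R)) < X w)%R])%E.
Proof.
move=> t0 t1; near=> n => X mX gX X0.
have n0 : (0 : R) < n%:R by rewrite ltr0n; near: n; exact: nbhs_infty_gt.
have Lt : 2 / t ^+ 2 <= ln n%:R by near: n; exact: ln_natr_pinfty.
have t2 : 0 < t ^+ 2 by rewrite exprn_gt0.
have L0 : 0 <= ln n%:R :> R by rewrite (le_trans _ Lt) // divr_ge0 // ltW.
set s := Num.sqrt (2 * ln n%:R).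
have s0 : 0 <= s := sqrtr_ge0 _.
have s2 : s ^+ 2 = 2 * ln n%:R by rewrite sqr_sqrtr // mulr_ge0.
have st : s <= t * ln n%:R.
  have -> : t * ln n%:R = Num.sqrt ((t * ln n%:R) ^+ 2).
    by rewrite sqrtr_sqr ger0_norm // mulr_ge0 // ltW.
  rewrite ler_wsqrtr // exprMn (expr2 (ln _)) mulrA ler_wpM2r //.
  by rewrite mulrC -ler_pdivrMr.
have t1' : 0 <= (1 - t) * s by rewrite mulr_ge0 // subr_ge0.
apply: le_trans (gaussian_lower_tail mX gX X0 t1').
rewrite lee_fin -mulrA ler_wpM2l ?normal_peak_ge0 //.
have -> : n%:R^-1 = expR (- ln n%:R) :> R by rewrite expRN lnK.
rewrite -expRD ler_expR -opprD lerN2.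
have -> : ((1 - t) * s + 1) ^+ 2 = (1 - t) ^+ 2 * s ^+ 2 + 2 * ((1 - t) * s) + 1 by ring.
rewrite s2; have h : (1 - t) * s <= t * ln n%:R.
  by rewrite (le_trans _ st) // ler_piMl // gerBl ltW.
have h2 : (1 - t) ^+ 2 * ln n%:R <= (1 - t) * ln n%:R.
  by rewrite ler_wpM2r // expr2 ler_piMl ?subr_ge0 // gerBl ltW.
by move: h2; rewrite mulrBl mul1r; lra.
Unshelve. all: by end_near. Qed.

Lemma independent_gaussians_large (Y : nat -> Omega -> R) (t : R) :
  (forall n, measurable_fun setT (Y n)) -> (forall n, centered_gaussian P (Y n)) ->
  (\forall n \near \oo, 0 < L2norm P (Y n)) ->
  (forall m n (a b : R), m != n ->
    P ([set w | a < Y m w] `&` [set w | b < Y n w]) =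
    (P [set w | a < Y m w]%R * P [set w | b < Y n w]%R)%E) ->
  0 < t -> t <= 1 ->
  {ae P, forall w, forall m : nat, exists2 n, (m <= n)%N &
    L2norm P (Y n) * ((1 - t) * Num.sqrt (2 * ln n%:R)) < Y n w}.
Proof.
move=> mY gY Y0 iY t0 t1.
have [N _ HN] := filterI Y0 (gaussian_lower_tail_ln t0 t1).
pose F n := [set w | L2norm P (Y n) * ((1 - t) * Num.sqrt (2 * ln n%:R)) < Y n w].
have mF n : measurable (F n).
  rewrite /F; move: (L2norm P (Y n) * _) => a.
  have -> : [set w | a < Y n w] = setT `&` Y n @^-1` `]a, +oo[%classic.
    by apply/seteqP; split => w; rewrite /= in_itv /= andbT // => -[].
  by apply: mY => //; exact: measurable_itv.
pose b : R := normal_peak 1 * expR (- (1 / 2)).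
have b0 : 0 < b by rewrite mulr_gt0 ?expR_gt0 // normal_peak_gt0.
have div : forall M : R, exists K, M <= \sum_(n < K) fine (P (F n)).
  apply: (@harmonic_minorant_diverges (fun n => fine (P (F n))) b N.+1 b0) => n; first exact: fine_ge0.
  move=> Nn; have [Yn /(_ _ (mY n) (gY n) Yn)] := HN n (ltnW Nn).
  rewrite -/b -/(F n) => h.
  have n0 : (0 < n)%N by exact: leq_ltn_trans Nn.
  apply: (@le_trans _ _ (b / n%:R)).
    by rewrite ler_wpM2l ?(ltW b0) // lef_pV2 ?posrE ?ltr0n // ler_nat.
  by rewrite -lee_fin fineK // fin_num_measure.
by apply: (borel_cantelli_second mF _ div) => m n mn; exact: iY.
Qed.

(** Twice [sqrt (ln n)] standard deviations leave the summable probabilities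
    [2 * n ^ (- 2)]. *)
Lemma gaussian_sequence_bound (Z : nat -> Omega -> R) (s : nat -> R) :
  (forall n, measurable_fun setT (Z n)) -> (forall n, centered_gaussian P (Z n)) ->
  (\forall n \near \oo, L2norm P (Z n) <= s n) ->
  {ae P, forall w, \forall n \near \oo, `|Z n w| <= s n * (2 * Num.sqrt (ln n%:R))}.
Proof.
move=> mZ gZ Zs.
have h : \forall n \near \oo,
    (P [set w | (s n * (2 * Num.sqrt (ln n%:R)) < `|Z n w|)%R] <=
     (2 * expR (- ((1 + 1) * ln n%:R)))%:E)%E.
  near=> n; have Zn : L2norm P (Z n) <= s n by near: n.
  have n0 : 0 <= ln n%:R :> R by near: n; exact: ln_natr_pinfty.
  have h : 0 <= 2 * Num.sqrt (ln n%:R) :> R by rewrite mulr_ge0 ?sqrtr_ge0.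
  apply: le_trans (gaussian_tail (mZ n) (gZ n) Zn h) _.
  by rewrite lee_fin exprMn sqr_sqrtr // ler_wpM2l // ler_expR; lra.
have := borel_cantelli_first _ _ (cvg_series_expR_ln ltr01 (ler0n R 2)) h.
move=> /(_ (fun n => measurable_norm_gt _ (mZ n)) (fun n => mulr_ge0 (ler0n R 2) (expR_ge0 _))).
apply: filterS => w; apply: filterS => n; rewrite /= => nE; rewrite leNgt; exact/negP.
Unshelve. all: by end_near. Qed.

(** The loss in [lil_lower]: the standard deviation of the band increment, its level and
    the iterated logarithm each cost a factor [1 - t], and the residual a summand [2 * t]. *)
(** The residual [Z n] outside the band is at most [t] times [d] in L2 norm, so the band
    increment [Y n] carries at least the fraction [1 - t] of [d]. *)
Lemma lil_lower_constant (t : R) : 0 <= t -> t <= 1 / 10 ->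
  0 <= (1 - t) ^+ 2 * Num.sqrt 2 - 2 * t /\
  Num.sqrt 2 - 8 * t <= (1 - t) * ((1 - t) ^+ 2 * Num.sqrt 2 - 2 * t).
Proof.
move=> t0 t1.
have s0 : 0 <= Num.sqrt 2 :> R := sqrtr_ge0 _.
have s2 : Num.sqrt 2 <= (3 / 2 : R).
  rewrite -(@ler_pXn2r _ 2) ?nnegrE ?sqrtr_ge0 ?divr_ge0 // sqr_sqrtr //.
  by rewrite expr2; lra.
have s1 : 1 <= Num.sqrt 2 :> R by rewrite -{1}sqrtr1 ler_wsqrtr // ler1n.
have h : (4 / 5) * Num.sqrt 2 <= (1 - t) ^+ 2 * Num.sqrt 2 by rewrite ler_wpM2r //; nra.
split; first by lra.
have h3 : (1 - 3 * t) * Num.sqrt 2 <= (1 - t) ^+ 3 * Num.sqrt 2.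
  rewrite ler_wpM2r //.
  have -> : (1 - t) ^+ 3 = 1 - 3 * t + t ^+ 2 * (3 - t) by ring.
  by rewrite lerDl mulr_ge0 ?sqr_ge0 //; lra.
have -> : (1 - t) * ((1 - t) ^+ 2 * Num.sqrt 2 - 2 * t) =
  (1 - t) ^+ 3 * Num.sqrt 2 - 2 * t + 2 * t ^+ 2 by ring.
have h4 : t * Num.sqrt 2 <= t * (3 / 2) by rewrite ler_wpM2l.
have h5 : 0 <= t ^+ 2 by exact: sqr_ge0.
by move: h3; rewrite mulrBl mul1r -mulrA; lra.
Qed.

Lemma lil_lower (j0 : 'I_k) (c1 c3 eps t : R) :
  gaussian_increments lo hi v ->
  0 < c1 -> 0 < eps -> (forall x y, T x -> T y -> Delta x y <= eps ->
    canonical_metric v x y <= c1 * Delta x y) ->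
  0 < c3 -> (forall x y, T x -> T y -> c3 * Delta x y <= canonical_metric v x y) ->
  0 < t -> t <= 1 / 10 ->
  {ae P, forall w, forall r : R, 0 < r -> exists2 x, T x &
    0 < canonical_metric v x c <= r /\
    (Num.sqrt 2 - 8 * t) * (canonical_metric v x c * Num.sqrt (lnln (canonical_metric v x c)))
      <= `|v x w - v c w|}.
Proof.
move=> gv c10 eps0 dc1 c30 dc3 t0 t1.
have [del [del0 del1 hdel]] : exists del : R, [/\ 0 < del, del < 1 &
    c0 * (powR_sum gamma del + del) <= t * c3].
  have tc : 0 < t * c3 / (2 * c0) by rewrite divr_gt0 ?mulr_gt0.
  have [u u0 hu] := powR_sum_small gamma0 tc.
  pose del := Num.min u (Num.min (1 / 2) (t * c3 / (2 * c0))).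
  have d0 : 0 < del by rewrite !lt_min u0 tc andbT /= divr_gt0.
  have [d1 d2 d3] : [/\ del <= u, del <= 1 / 2 & del <= t * c3 / (2 * c0)].
    by split; rewrite !ge_min lexx ?orbT.
  exists del; split => //; first by lra.
  have -> : t * c3 = c0 * (t * c3 / (2 * c0) + t * c3 / (2 * c0)).
    by field; rewrite gt_eqF.
  rewrite ler_wpM2l ?(ltW c0_gt0) // lerD // (le_trans _ hu) //.
  by apply: powR_sum_le => //; exact: ltW.
(* the bands [[a n, a n.+1)] with [a n = del / q ^+ n] are then adjacent, and
[(a n.+1)^-1 = del * q ^+ n] *)
pose q := del ^+ 2.
have q0 : 0 < q by rewrite exprn_gt0.
have q1 : q < 1 by rewrite expr_lt1 // ltW.
have qn0 n : 0 < q ^+ n by rewrite exprn_gt0.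
have cvgq : q ^+ n @[n --> \oo] --> (0 : R) by apply: cvg_expr; rewrite gtr0_norm.
have q_le (e : R) : 0 < e -> \forall n \near \oo, q ^+ n <= e.
  by move=> e0; have /cvgr_le/(_ _ e0) := cvgq.
pose a n := del / q ^+ n.
have a_ge0 n : 0 < a n by rewrite divr_gt0.
have aS n : (a n.+1)^-1 = del * q ^+ n.
  by rewrite /a exprS /q; field; rewrite !gt_eqF // exprn_gt0.
have a_lt n : a n < a n.+1.
  rewrite /a ltr_pM2l // ltf_pV2 ?posrE // exprS gtr_pMl //.
have a_le m n : (m <= n)%N -> a m <= a n.
  by move=> mn; apply: (@nondecreasing_seqP _ _ a).1 mn => // i; exact: ltW.
have a_big : \forall n \near \oo, a0 <= a n.
  have a1 : 0 < del / (a0 + 1) by rewrite divr_gt0 // ltr_wpDl.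
  apply: filterS (q_le _ a1) => n.
  rewrite ler_pdivlMr ?ltr_wpDl // => h.
  by rewrite /a ler_pdivlMr // (le_trans _ h) // mulrC ler_wpM2l ?(ltW (qn0 n)) ?lerDl.
have [u0 u00 hu] := Delta_axis_point j0.
have ex n : exists x, T x /\ (q ^+ n <= u0 -> Delta x c = q ^+ n).
  have [qu|qu] := leP (q ^+ n) u0; last by exists c.
  by have [x Tx Dx] := hu _ (ltW (qn0 n)) qu; exists x.
have [x hx] := choice ex.
have Tx n : T (x n) := (hx n).1.
have Dx : \forall n \near \oo, Delta (x n) c = q ^+ n.
  by apply: filterS (q_le _ u00) => n; exact: (hx n).2.
pose A n := Ico (a n) (a n.+1)%:E.
have bA n : borel_Rplus (A n) by apply: borel_Rplus_Ico; exact: ltW.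
pose Y n := fun w => W (A n) (x n) w - W (A n) c w.
pose Z n := fun w => W (A n) (x n) w - v (x n) w - W (A n) c w + v c w.
have gY n : centered_gaussian P (Y n) by apply: (noise_diff_gaussian hW).
have gZ n : centered_gaussian P (Z n) by apply: (noise_residual_gaussian hW).
have mY n : measurable_fun setT (Y n) by exact: measurable_funB.
have mZ n : measurable_fun setT (Z n).
  by apply: measurable_funD => //; do 2 apply: measurable_funB => //.
have Zs : \forall n \near \oo, L2norm P (Z n) <= t * c3 * q ^+ n.
  apply: filterS2 a_big Dx => n an Dn.
  have := band_approximation c0_gt0 a0_ge0 gamma0 hb an (a_lt n) (Tx n) Tc.
  move=> /le_trans; apply; rewrite Dn /a divfK ?gt_eqF // aS -mulrDl mulrA.
  by rewrite ler_wpM2r // ltW.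
pose dd n := canonical_metric v (x n) c.
have d_ge : \forall n \near \oo, c3 * q ^+ n <= dd n.
  by apply: filterS Dx => n <-; exact: dc3.
have Ys : \forall n \near \oo, (1 - t) * dd n <= L2norm P (Y n).
  apply: filterS2 Zs d_ge => n Zn dn.
  have : dd n <= L2norm P (Y n) + L2norm P (Z n).
    rewrite -(L2normN _ (Z n)).
    have -> : dd n = L2norm P (fun w => Y n w + - Z n w).
      by congr L2norm; apply/funext => w; rewrite /Y /Z; ring.
    apply: L2norm_triangle; first exact: gaussian_square_integrable.
    by apply: square_integrableN; exact: gaussian_square_integrable.
  have : t * c3 * q ^+ n <= t * dd n by rewrite -mulrA ler_wpM2l // ltW.
  lra.
have Y0 : \forall n \near \oo, 0 < L2norm P (Y n).
  apply: filterS2 Ys d_ge => n Yn dn; rewrite (lt_le_trans _ Yn) // mulr_gt0 //; first by lra.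
  by rewrite (lt_le_trans _ dn) // mulr_gt0.
have iY m n b b' : m != n -> P ([set w | b < Y m w] `&` [set w | b' < Y n w]) =
    (P [set w | (b < Y m w)%R] * P [set w | (b' < Y n w)%R])%E.
  move=> mn; apply: (noise_independent hW (bA m) (bA n)); last 2 first.
  - exact: sigma_generated_gt.
  - exact: sigma_generated_gt.
  move: mn; rewrite neq_ltn => /orP[mn|mn].
    by apply: Ico_disjoint; exact: a_le.
  by rewrite setIC; apply: Ico_disjoint; exact: a_le.
have t1' : t <= 1 by lra.
have Yio := independent_gaussians_large mY gY Y0 iY t0 t1'.
have Zb := gaussian_sequence_bound mZ gZ Zs.
apply: filterS2 Yio Zb => w Yw Zw r r0.
have d_le : \forall n \near \oo, dd n <= r.
  have e1 : 0 < Num.min eps (r / c1) by rewrite lt_min eps0 divr_gt0.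
  apply: filterS2 (q_le _ e1) Dx => n.
  rewrite le_min => /andP[h1 h2] Dn; rewrite /dd.
  apply: (le_trans (dc1 _ _ (Tx n) Tc _)); first by rewrite Dn.
  by rewrite Dn mulrC -ler_pdivlMr.
have [N _ HN] := filterI (filterI Zw d_le) (filterI (filterI Ys d_ge)
  (filterI (lnln_le_ln q0 q1 c30 t0) (@ln_natr_pinfty R 0))).
have [n Nn Yn] := Yw N.
have [[{}Zn dr] [[{}Ysn dn] [lnn ln0]]] := HN n Nn.
have dn0 : 0 < dd n by rewrite (lt_le_trans _ dn) // mulr_gt0.
exists (x n) => //; rewrite -/(dd n) dn0 dr; split => //.
set L := Num.sqrt (ln n%:R) in Zn.
have L0 : 0 <= L := sqrtr_ge0 _.
have tp : 0 <= t := ltW t0.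
have [k0 kt] := lil_lower_constant tp t1.
have lnL : (1 - t) * Num.sqrt (lnln (dd n)) <= L.
  have h : Num.sqrt (lnln (dd n)) <= (1 + t) * L by apply: sqrt_le_scale => //; exact: lnn.
  apply: (@le_trans _ _ ((1 - t) * ((1 + t) * L))); first by rewrite ler_wpM2l // subr_ge0.
  by rewrite mulrA ler_piMl // -subr_sqr expr1n gerBl sqr_ge0.
have hY : (1 - t) ^+ 2 * Num.sqrt 2 * (dd n * L) <= Y n w.
  apply: le_trans (ltW Yn); rewrite sqrtrM // -/L.
  have -> : (1 - t) ^+ 2 * Num.sqrt 2 * (dd n * L) = (1 - t) * dd n * ((1 - t) * (Num.sqrt 2 * L)).
    by ring.
  by rewrite ler_wpM2r // mulr_ge0 ?subr_ge0 // mulr_ge0 ?sqrtr_ge0.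
have hZ : `|Z n w| <= 2 * t * (dd n * L).
  apply: (le_trans Zn); have -> : 2 * t * (dd n * L) = t * dd n * (2 * L) by ring.
  by rewrite ler_wpM2r ?mulr_ge0 // -mulrA ler_wpM2l.
have hv : v (x n) w - v c w = Y n w - Z n w by rewrite /Y /Z; ring.
have h1 : ((1 - t) ^+ 2 * Num.sqrt 2 - 2 * t) * (dd n * L) <= `|v (x n) w - v c w|.
  rewrite hv mulrBl; have := ler_norm (Y n w - Z n w); have := ler_norm (Z n w); lra.
apply: le_trans h1.
apply: (@le_trans _ _ (((1 - t) * ((1 - t) ^+ 2 * Num.sqrt 2 - 2 * t)) *
    (dd n * Num.sqrt (lnln (dd n))))).
  by rewrite ler_wpM2r // mulr_ge0 ?sqrtr_ge0 // ltW.
have -> : (1 - t) * ((1 - t) ^+ 2 * Num.sqrt 2 - 2 * t) * (dd n * Num.sqrt (lnln (dd n))) =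
  ((1 - t) ^+ 2 * Num.sqrt 2 - 2 * t) * (dd n * ((1 - t) * Num.sqrt (lnln (dd n)))) by ring.
by rewrite ler_wpM2l // ler_wpM2l // ltW.
Qed.

End lower_bound.

(** * The two limits *)

Section limit_theorem.
Context {d : measure_display} {Omega : measurableType d} {R : realType}.
Variables (P : probability Omega R) (k : nat).

Lemma lil_sup_cvg (v : 'rV[R]_k -> {RV P >-> R}) (T : set 'rV[R]_k)
    (rho : 'rV[R]_k -> 'rV[R]_k -> R) (c : 'rV[R]_k) (w : Omega) (kappa : R) :
  (forall e, 0 < e -> exists2 r, 0 < r & forall x, T x -> 0 < rho x c -> rho x c <= r ->
     `|v x w - v c w| <= (kappa + e) * (rho x c * Num.sqrt (lnln (rho x c)))) ->
  (forall e r, 0 < e -> 0 < r -> exists2 x, T x & 0 < rho x c <= r /\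
     (kappa - e) * (rho x c * Num.sqrt (lnln (rho x c))) <= `|v x w - v c w|) ->
  lil_sup v T rho c w r @[r --> 0^'+] --> kappa%:E.
Proof.
move=> up low; have [r0 r00 hr0] := @lnln_gt0 R.
have pos x : 0 < rho x c -> rho x c <= r0 -> 0 < rho x c * Num.sqrt (lnln (rho x c)).
  by move=> x0 xr; rewrite mulr_gt0 // sqrtr_gt0 hr0.
have bnd e : 0 < e -> \forall r \near 0^'+,
    ((kappa - e)%:E <= lil_sup v T rho c w r)%E /\ (lil_sup v T rho c w r <= (kappa + e)%:E)%E.
  move=> e0; have [r1 r10 hr1] := up e e0; near=> r.
  have r_gt0 : 0 < r by near: r; exact: nbhs_right_gt.
  have rr0 : r <= r0 by near: r; exact: nbhs_right_le.
  have rr1 : r <= r1 by near: r; exact: nbhs_right_le.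
  split.
    have [x Tx [/andP[x0 xr] hx]] := low e r e0 r_gt0.
    apply: (@le_trans _ _ (`|v x w - v c w| / (rho x c * Num.sqrt (lnln (rho x c))))%:E).
      by rewrite lee_fin ler_pdivlMr // pos // (le_trans xr).
    by apply: ereal_sup_ubound; exists x => //; split => //; rewrite x0 xr.
  apply: ub_ereal_sup => _ [x [Tx /andP[x0 xr]] <-].
  by rewrite lee_fin ler_pdivrMr ?hr1 ?(le_trans xr) // pos // (le_trans xr).
apply/fine_cvgP; split.
  have := bnd 1 ltr01; apply: filterS => r [h1 h2].
  by rewrite fin_numE; apply/andP; split; apply/eqP => h; rewrite h in h1 h2.
apply/cvgrPdist_le => e e0; have := bnd e e0; apply: filterS => r /= [].
case: (lil_sup _ _ _ _ _ _) => [y| |] //=; rewrite !lee_fin => h1 h2.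
by rewrite ler_norml; lra.
Unshelve. all: by end_near. Qed.

Variables (v : 'rV[R]_k -> {RV P >-> R}) (gamma : 'I_k -> R) (lo hi c : 'rV[R]_k).
Hypotheses (hcont : continuous_field v) (hgauss : centered_gaussian_field setT v).
Hypotheses (gamma0 : forall j, 0 < gamma j) (Tc : rectangle lo hi c).
Hypothesis lohi : forall j, lo 0 j < hi 0 j.
Local Notation T := (rectangle lo hi).
Local Notation Delta := (Delta gamma).
Implicit Types x y : 'rV[R]_k.
Variable j0 : 'I_k.
Variable (W : set R -> 'rV[R]_k -> {RV P >-> R}).
Hypothesis hW : gaussian_noise_field v T W.
Variables c0 a0 : R.
Hypotheses (c0_gt0 : 0 < c0) (a0_ge0 : 0 <= a0).
Hypothesis hb : forall (a : R) (b : \bar R) (x y : 'rV[R]_k),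
  a0 <= a -> (a%:E < b)%E -> T x -> T y ->
  L2norm P (fun w => W (Ico a b) x w - v x w - W (Ico a b) y w + v y w)
  <= c0 * (\sum_(j < k) a `^ gamma j * `|x 0 j - y 0 j| + fine b^-1%E).
Variable c3 : R.
Hypotheses (c3_gt0 : 0 < c3) (hC : forall x y, T x -> T y ->
  c3 * Delta x y <= canonical_metric v x y).

Let gauss_v : gaussian_increments lo hi v.
Proof. by move=> x y _ _; exact: (gaussian_diff hgauss). Qed.

Lemma canonical_metric_lil :
  {ae P, forall w, lil_sup v T (canonical_metric v) c w r @[r --> 0^'+] --> (Num.sqrt 2)%:E}.
Proof.
have [c1 c10 [eps eps0 dc1]] :=
  canonical_metric_le_Delta hW c0_gt0 a0_ge0 gamma0 hb.
pose t p : R := p.+1%:R^-1 / 10.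
have p1 p : (p.+1%:R^-1 : R) <= 1 by rewrite invf_le1 ?ler1n.
have p0 p : (0 : R) < p.+1%:R^-1 by rewrite invr_gt0.
have t0 p : 0 < t p by rewrite divr_gt0.
have t1 p : t p <= 1 / 10 by rewrite ler_pM2r ?p1 // invr_gt0.
have t1' p : t p <= 1 by apply: le_trans (t1 p) _; rewrite ler_pdivrMr // mul1r ler1n.
have up : {ae P, forall w (p : nat), exists2 r : R, 0 < r & forall x, T x ->
    0 < canonical_metric v x c -> canonical_metric v x c <= r ->
    `|v x w - v c w| <= (Num.sqrt 2 + 60 * t p) *
      (canonical_metric v x c * Num.sqrt (lnln (canonical_metric v x c)))}.
  apply: ae_foralln => p.
  exact: (lil_upper gamma0 Tc gauss_v hcont c10 eps0 dc1 c3_gt0 hC (t0 p) (t1' p)).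
have low : {ae P, forall w (p : nat), forall r : R, 0 < r -> exists2 x, T x &
    0 < canonical_metric v x c <= r /\
    (Num.sqrt 2 - 8 * t p) * (canonical_metric v x c * Num.sqrt (lnln (canonical_metric v x c)))
      <= `|v x w - v c w|}.
  apply: ae_foralln => p.
  exact: (lil_lower gamma0 Tc lohi hW c0_gt0 a0_ge0 hb j0 gauss_v c10 eps0 dc1 c3_gt0 hC (t0 p) (t1 p)).
apply: filterS2 up low => w upw loww; apply: lil_sup_cvg.
  move=> e e0; have [p hp] := ex_invS_lt (divr_gt0 e0 (ltr0n R 6)).
  have [r r0 hr] := upw p; exists r => // x Tx x0 xr; apply: (le_trans (hr x Tx x0 xr)).
  rewrite ler_wpM2r ?mulr_ge0 ?sqrtr_ge0 ?(ltW x0) // lerD2l /t.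
  by move: hp; rewrite ltr_pdivlMr //; move: (_.+1%:R^-1) => u; lra.
move=> e r e0 r0; have [p hp] := ex_invS_lt e0.
have [x Tx [x0 hx]] := loww p r r0; exists x => //; split => //.
apply: le_trans hx; rewrite ler_wpM2r ?mulr_ge0 ?sqrtr_ge0 //.
by rewrite lerD2l lerN2 /t; move: hp (p0 p); move: (_.+1%:R^-1) => u; lra.
Qed.

Let rho : R := 1 / 2.
Let rho0 : 0 < rho. Proof. by rewrite divr_gt0. Qed.
Let rho1 : rho < 1. Proof. by rewrite ltr_pdivrMr // mul1r ltr1n. Qed.
Local Notation exceeds := (exceeds gamma lo hi c rho).
Local Notation modulus := (lil_modulus gamma c).

(** The noise below [a] is a negligible field, and at the countably many grid points [v]
    is almost surely the sum of the noise below and above [a]. *)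
Lemma exceeds_high_frequencies (a t : R) : a0 <= a ->
  {ae P, forall w, exceeds v t w <-> exceeds (W (Ico a +oo%E)) t w}.
Proof.
move=> a0a; have a_ge0 : 0 <= a := le_trans a0_ge0 a0a.
have gU : gaussian_increments lo hi (W (Ico 0 a%:E)).
  by move=> x y Tx Ty; apply: (noise_diff_gaussian hW) => //; exact: borel_Rplus_Ico.
have neg : {ae P, forall w (p : nat), exists2 r : R, 0 < r & forall x, T x ->
    grid_point gamma c rho x -> 0 < Delta x c -> Delta x c <= r ->
    `|W (Ico 0 a%:E) x w - W (Ico 0 a%:E) c w| <= p.+1%:R^-1 * modulus x}.
  apply: ae_foralln => p; apply: (lil_negligible gamma0 Tc rho0 rho1 gU); last first.
    by rewrite invr_gt0.
  by move=> e e0; exact: (low_frequency_negligible hW c0_gt0 a0_ge0 gamma0 hb a0a e0).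
have split_c := noise_split hW a_ge0 Tc.
have split_x : {ae P, forall w (i : nat), T (grid_enum gamma c rho i) ->
    v (grid_enum gamma c rho i) w =
    W (Ico 0 a%:E) (grid_enum gamma c rho i) w + W (Ico a +oo%E) (grid_enum gamma c rho i) w}.
  apply: ae_foralln => i; have [Ti|nTi] := pselect (T (grid_enum gamma c rho i)).
    by apply: filterS (noise_split hW a_ge0 Ti) => w h _.
  by apply: aeW => w.
apply: filterS3 neg split_c split_x => w negw cw xw.
have key e : 0 < e -> exists2 r, 0 < r & forall x, T x -> grid_point gamma c rho x ->
    0 < Delta x c -> Delta x c <= r ->
    `|(v x w - v c w) - (W (Ico a +oo%E) x w - W (Ico a +oo%E) c w)| <= e * modulus x.
  move=> e0; have [p hp] := ex_invS_lt e0; have [r r0 hr] := negw p.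
  exists r => // x Tx gx x0 xr; have [i Ei] := grid_enum_surj gx.
  rewrite cw -Ei xw ?Ei //.
  have -> : W (Ico 0 a%:E) x w + W (Ico a +oo%E) x w - (W (Ico 0 a%:E) c w + W (Ico a +oo%E) c w)
    - (W (Ico a +oo%E) x w - W (Ico a +oo%E) c w) = W (Ico 0 a%:E) x w - W (Ico 0 a%:E) c w by ring.
  apply: (le_trans (hr x Tx gx x0 xr)).
  by rewrite ler_wpM2r ?lil_modulus_ge0 // ltW.
split; apply: exceeds_perturbation_sub => // e e0; have [r r0 hr] := key e e0; exists r => //.
by move=> x Tx gx x0 xr; rewrite distrC; exact: hr.
Qed.

Lemma exceeds_zero_one (t : R) : P (exceeds v t) = 0%E \/ P (exceeds v t) = 1%E.
Proof.
(* [low_frequency_negligible] needs cut-off frequencies that are at least [a0] *)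
have [M aM] : exists M : nat, a0 <= M%:R.
  by exists (Num.bound a0); rewrite ltW // archi_boundP.
pose U (N : nat) := W (Ico 0 (N + M)%:R%:E).
pose V (N : nat) := W (Ico (N + M)%:R +oo%E).
have bU N : borel_Rplus (Ico 0 (N + M)%:R%:E : set R) by exact: borel_Rplus_Ico.
apply: (@zero_one_law _ _ _ P _ T v U V); first exact: sigma_generated_exceeds.
- move=> N; exists (exceeds (V N) t); first exact: sigma_generated_exceeds.
  by apply: exceeds_high_frequencies; rewrite (le_trans aM) // ler_nat leq_addl.
- move=> N; apply: (noise_independent hW) => //; first exact: borel_Rplus_Ico.
  exact: Ico_disjoint.
- move=> N x Tx; apply: square_integrableD.
    by apply: gaussian_square_integrable => //; exact: (gaussian_single hgauss).
  by apply: square_integrableN; exact: (noise_square_integrable hW).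
- move=> x Tx; have := cvg_noise_Ico0 hW Tx.
  by rewrite -(@cvg_shiftn M).
Qed.

(** If the limsup did not exceed [t], then near [c] the increments would be smaller than
    those that [lil_lower] provides, as [d >= c3 * Delta]. *)
Lemma exceeds_below (t : R) : t < Num.sqrt 2 * c3 -> {ae P, forall w, exceeds v t w}.
Proof.
move=> tc; pose g := Num.sqrt 2 * c3 - t.
have g0 : 0 < g by rewrite subr_gt0.
have [c1 c10 [eps eps0 dc1]] :=
  canonical_metric_le_Delta hW c0_gt0 a0_ge0 gamma0 hb.
(* a loss of at most [10 * s * c3 <= g / 4] leaves [lil_lower] above [t + g / 2] *)
pose s : R := Num.min (1 / 10) (g / (40 * c3)).
have s0 : 0 < s by rewrite lt_min !divr_gt0 // mulr_gt0.
have s1 : s <= 1 / 10 by rewrite ge_min lexx.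
have s2 : 10 * (s * c3) <= g / 4.
  have : s <= g / (40 * c3) by rewrite ge_min lexx orbT.
  by rewrite ler_pdivlMr ?mulr_gt0 //; lra.
have low := lil_lower gamma0 Tc lohi hW c0_gt0 a0_ge0 hb j0 gauss_v c10 eps0 dc1 c3_gt0 hC s0 s1.
have c1V : 0 < c1^-1 by rewrite invr_gt0.
have [r1 r10 hr1] := lnln_scale c1V s0.
have [r2 r20 hr2] := @lnln_gt0 R.
apply: filterS2 low hcont => w loww cw; apply: contrapT => nE.
have g2 : 0 < g / 2 by rewrite divr_gt0.
have [r r0 hr] := not_exceeds_bound gamma0 Tc rho0 rho1 cw nE g2.
pose r' := Num.min r1 (c3 * Num.min r (Num.min r2 eps)).
have r'0 : 0 < r' by rewrite lt_min r10 mulr_gt0 // !lt_min r0 r20.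
have [x Tx [/andP[x0 xr'] hx]] := loww r' r'0.
set dx := canonical_metric v x c in x0 xr' hx.
set D := Delta x c.
have cD : c3 * D <= dx by exact: hC.
have [dr1 [Dr [Dr2 De]]] : dx <= r1 /\ D <= r /\ D <= r2 /\ D <= eps.
  move: xr'; rewrite le_min => /andP[h1 h2].
  have : D <= Num.min r (Num.min r2 eps) by rewrite -(ler_pM2l c3_gt0) (le_trans cD).
  by rewrite !le_min => /and3P[].
have dD : dx <= c1 * D by exact: dc1.
have D0 : 0 < D by rewrite -(pmulr_rgt0 _ c10) (lt_le_trans x0).
have LD : 0 < lnln D by exact: hr2.
have Ld : lnln D <= (1 + s) * lnln dx by apply: hr1 => //; rewrite ler_pdivrMl.
have ldx : 0 <= lnln dx by rewrite -(pmulr_rge0 _ (addr_gt0 ltr01 s0)) (le_trans (ltW LD)).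
have sL : (1 - s) * Num.sqrt (lnln D) <= Num.sqrt (lnln dx).
  have h : Num.sqrt (lnln D) <= (1 + s) * Num.sqrt (lnln dx) by apply: sqrt_le_scale => //; exact: ltW.
  apply: (@le_trans _ _ ((1 - s) * ((1 + s) * Num.sqrt (lnln dx)))).
    by rewrite ler_wpM2l //; lra.
  by rewrite mulrA ler_piMl ?sqrtr_ge0 // -subr_sqr expr1n gerBl sqr_ge0.
have q1 : 1 <= Num.sqrt 2 :> R by rewrite -{1}sqrtr1 ler_wsqrtr // ler1n.
have q2 : Num.sqrt 2 <= (2 : R).
  rewrite -(@ler_pXn2r _ 2) ?nnegrE ?sqrtr_ge0 // sqr_sqrtr //.
  by rewrite expr2; lra.
have m0 : 0 < D * Num.sqrt (lnln D) by rewrite mulr_gt0 // sqrtr_gt0.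
have k0 : 0 <= Num.sqrt 2 - 8 * s by lra.
have low1 : (Num.sqrt 2 - 8 * s) * ((c3 * D) * ((1 - s) * Num.sqrt (lnln D))) <= `|v x w - v c w|.
  apply: le_trans hx; rewrite ler_wpM2l //.
  have s1' : 0 <= 1 - s by lra.
  by apply: ler_pM => //; [rewrite ltW // mulr_gt0|rewrite mulr_ge0 ?sqrtr_ge0].
have := le_trans low1 (hr x Tx D0 Dr); rewrite /lil_modulus -/D.
have -> : (Num.sqrt 2 - 8 * s) * ((c3 * D) * ((1 - s) * Num.sqrt (lnln D))) =
  ((Num.sqrt 2 - 8 * s) * (1 - s) * c3) * (D * Num.sqrt (lnln D)) by ring.
rewrite ler_pM2r // leNgt => /negP; apply.
have h1 : (Num.sqrt 2 - 10 * s) * c3 <= (Num.sqrt 2 - 8 * s) * (1 - s) * c3.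
  by rewrite ler_wpM2r ?(ltW c3_gt0) //; nra.
by rewrite (lt_le_trans _ h1) // mulrBl -mulrA -/g; rewrite /g in s2 g0 *; lra.
Qed.

Lemma locally_bounded_ge (c1 : R) : locally_bounded_by_Delta v T gamma c1 -> c3 <= c1.
Proof.
move=> [eps eps0 hc1]; have [u0 u00 hu] := Delta_axis_point gamma0 Tc lohi j0.
have m0 : 0 < Num.min u0 eps by rewrite lt_min u00.
have [x Tx Dx] := hu (Num.min u0 eps) (ltW m0) (ltac:(by rewrite ge_min lexx)).
have De : Delta x c <= eps by rewrite Dx ge_min lexx orbT.
rewrite -(ler_pM2r m0) -Dx; exact: le_trans (hC Tx Tc) (hc1 x c Tx Tc De).
Qed.

(** Near [c] the upper half of the law for [d <= c1 * Delta] bounds the increments by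
    almost [Num.sqrt 2 * c1] times the modulus. *)
Lemma exceeds_above (c1 t : R) : locally_bounded_by_Delta v T gamma c1 ->
  Num.sqrt 2 * c1 < t -> {ae P, forall w, ~ exceeds v t w}.
Proof.
move=> bc1 tc; have c10 : 0 < c1 := lt_le_trans c3_gt0 (locally_bounded_ge bc1).
have [eps eps0 dc1] := bc1; pose g := t - Num.sqrt 2 * c1.
have g0 : 0 < g by rewrite subr_gt0.
(* a loss of at most [122 * s * c1 < g] leaves [lil_upper] below [t] *)
pose s : R := Num.min 1 (g / (200 * c1)).
have c200 : 0 < 200 * c1 by apply: mulr_gt0; rewrite ?ltr0n.
have s0 : 0 < s by rewrite lt_min ltr01 divr_gt0.
have s1 : s <= 1 by rewrite ge_min lexx.
have s2 : 200 * (s * c1) <= g.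
  have : s <= g / (200 * c1) by rewrite ge_min lexx orbT.
  by rewrite ler_pdivlMr // mulrCA.
have up := lil_upper gamma0 Tc gauss_v hcont c10 eps0 dc1 c3_gt0 hC s0 s1.
have [r1 r10 hr1] := lnln_scale c3_gt0 s0.
have [r2 r20 hr2] := @lnln_gt0 R.
apply: filterS up => w [r r0 hr] /exceedsP.
pose r' := Num.min (Num.min r1 r2) (Num.min (r / c1) eps).
have r'0 : 0 < r' by rewrite !lt_min r10 r20 divr_gt0.
move=> /(_ r' r'0) [x [Tx /andP[D0]]]; rewrite /lil_modulus.
set D := Delta x c in D0 *; rewrite !le_min => /andP[/andP[Dr1 Dr2] /andP[Dr De]] hx.
set dx := canonical_metric v x c.
have cD : c3 * D <= dx by exact: hC.
have dD : dx <= c1 * D by exact: dc1.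
have dx0 : 0 < dx by rewrite (lt_le_trans _ cD) // mulr_gt0.
have dr : dx <= r by rewrite (le_trans dD) // mulrC -ler_pdivlMr.
have LD : 0 < lnln D by exact: hr2.
have sL : Num.sqrt (lnln dx) <= (1 + s) * Num.sqrt (lnln D).
  by apply: sqrt_le_scale; rewrite ?(ltW s0) ?(ltW LD) // hr1.
have m0 : 0 < D * Num.sqrt (lnln D) by rewrite mulr_gt0 // sqrtr_gt0.
have q0 : 0 <= Num.sqrt 2 :> R := sqrtr_ge0 _.
have q2 : Num.sqrt 2 <= (2 : R).
  rewrite -(@ler_pXn2r _ 2) ?nnegrE ?sqrtr_ge0 // sqr_sqrtr //.
  by rewrite expr2; lra.
have := le_trans hx (hr x Tx dx0 dr); rewrite -/dx.
have h : (Num.sqrt 2 + 60 * s) * (dx * Num.sqrt (lnln dx)) <=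
    (Num.sqrt 2 + 60 * s) * ((c1 * D) * ((1 + s) * Num.sqrt (lnln D))).
  by rewrite ler_wpM2l ?addr_ge0 ?mulr_ge0 ?(ltW s0) // ler_pM ?sqrtr_ge0 ?(ltW dx0).
move=> /le_trans/(_ h).
have -> : (Num.sqrt 2 + 60 * s) * ((c1 * D) * ((1 + s) * Num.sqrt (lnln D))) =
  ((Num.sqrt 2 + 60 * s) * (1 + s) * c1) * (D * Num.sqrt (lnln D)) by ring.
rewrite ler_pM2r // leNgt => /negP; apply.
have h1 : (Num.sqrt 2 + 60 * s) * (1 + s) * c1 <= (Num.sqrt 2 + 122 * s) * c1.
  by rewrite ler_wpM2r ?(ltW c10) //; nra.
have s3 : 0 < s * c1 by rewrite mulr_gt0.
by rewrite (le_lt_trans h1) // mulrDl -mulrA; rewrite /g in s2; lra.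
Qed.

(** [kappa] is the supremum of the levels that are almost surely exceeded; by the zero-one
    law the levels above it are almost surely not exceeded. *)
Lemma Delta_lil : exists kappa : R,
  [/\ 0 < kappa,
      {ae P, forall w, lil_sup v T Delta c w r @[r --> 0^'+] --> kappa%:E},
      Num.sqrt 2 * c3 <= kappa &
      forall c1, locally_bounded_by_Delta v T gamma c1 -> kappa <= Num.sqrt 2 * c1].
Proof.
have mE t : measurable (exceeds v t) by apply: sigma_generated_sub; exact: sigma_generated_exceeds.
pose S : set R := [set t | P (exceeds v t) = 1%E].
have belowS t : t < Num.sqrt 2 * c3 -> S t.
  by move=> /exceeds_below h; rewrite /S /=
    (probability_ae_eq (mE t) measurableT) ?probability_setT //; apply: filterS h.
have aboveS c1 t : locally_bounded_by_Delta v T gamma c1 -> S t -> t <= Num.sqrt 2 * c1.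
  move=> bc1 St; rewrite leNgt; apply/negP => tc.
  have h := exceeds_above bc1 tc.
  have P0 : P (exceeds v t) = 0%E.
    by rewrite -(measure0 P); apply: probability_ae_eq => //; apply: filterS h.
  by move: St; rewrite /S /= P0 => /eqP; rewrite eq_sym onee_eq0.
have [c1 c10 hc1] := canonical_metric_le_Delta hW c0_gt0 a0_ge0 gamma0 hb.
have S_sup : has_sup S.
  split; first by exists (Num.sqrt 2 * c3 - 1); apply: belowS; rewrite ltrBlDr ltrDl.
  by exists (Num.sqrt 2 * c1) => t; exact: aboveS.
pose kappa := sup S.
have kge : Num.sqrt 2 * c3 <= kappa.
  rewrite leNgt; apply/negP => h.
  have /belowS St : (kappa + Num.sqrt 2 * c3) / 2 < Num.sqrt 2 * c3 by lra.
  by have := ub_le_sup S_sup.2 St; rewrite -/kappa; lra.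
exists kappa; split => //.
- by rewrite (lt_le_trans _ kge) // mulr_gt0 // sqrtr_gt0.
- have low : {ae P, forall w (p : nat), exceeds v (kappa - p.+1%:R^-1) w}.
    apply: ae_foralln => p.
    have [t St tk] : exists2 t, S t & kappa - p.+1%:R^-1 < t.
      by apply: sup_adherent => //; rewrite invr_gt0.
    have : {ae P, forall w, exceeds v t w}.
      exists (~` exceeds v t); split => //; first exact: measurableC.
      by move: St; rewrite /S /= probability_setC // => ->; rewrite subee.
    by apply: filterS; apply: exceeds_nonincreasing; exact: ltW.
  have up : {ae P, forall w (p : nat), ~ exceeds v (kappa + p.+1%:R^-1) w}.
    apply: ae_foralln => p.
    have [h|h] := exceeds_zero_one (kappa + p.+1%:R^-1).
      by exists (exceeds v (kappa + p.+1%:R^-1)); split => // w; exact: contrapT.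
    by have := ub_le_sup S_sup.2 h; rewrite -/kappa gerDl invr_le0 lern0.
  apply: filterS3 low up hcont => w loww upw cw; apply: lil_sup_cvg.
    move=> e e0; have e2 : 0 < e / 2 by rewrite divr_gt0.
    have [p hp] := ex_invS_lt e2.
    have [r r0 hr] := not_exceeds_bound gamma0 Tc rho0 rho1 cw (upw p) e2.
    exists r => // x Tx x0 xr; apply: (le_trans (hr x Tx x0 xr)).
    by rewrite ler_wpM2r ?lil_modulus_ge0 //; move: hp; move: (_.+1%:R^-1) => u; lra.
  move=> e r e0 r0; have [p hp] := ex_invS_lt e0.
  have [x [Tx xr] hx] := exceedsP (loww p) r0; exists x => //; split => //.
  apply: le_trans hx; rewrite ler_wpM2r ?lil_modulus_ge0 //.
  by rewrite lerD2l lerN2 ltW.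
- move=> c1' bc1; apply: sup_le_ub S_sup.1 _ => t; exact: aboveS.
Qed.

End limit_theorem.

Theorem theorem5p2 (d : measure_display) (Omega : measurableType d)
    (R : realType) (P : probability Omega R) (k : nat) (hk : (1 <= k)%N)
    (v : 'rV[R]_k -> {RV P >-> R})
    (hgauss : centered_gaussian_field setT v)
    (hcont : continuous_field v)
    (lo hi : 'rV[R]_k) (hlohi : forall j, lo 0 j < hi 0 j)
    (gamma : 'I_k -> R) (c3 : R)
    (hA : assumption_A v (rectangle lo hi) gamma)
    (hC : assumption_C v (rectangle lo hi) gamma c3)
    (x0 : 'rV[R]_k) (hx0 : rectangle lo hi x0) :
  {ae P, forall w,
     lil_sup v (rectangle lo hi) (canonical_metric v) x0 w r
       @[r --> 0^'+] --> (Num.sqrt 2)%:E} /\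
  (exists c1 : R, locally_bounded_by_Delta v (rectangle lo hi) gamma c1) /\
  (exists kappa : R,
    [/\ 0 < kappa,
        {ae P, forall w,
           lil_sup v (rectangle lo hi) (Delta gamma) x0 w r
             @[r --> 0^'+] --> kappa%:E},
        Num.sqrt 2 * c3 <= kappa
      & forall c1 : R, locally_bounded_by_Delta v (rectangle lo hi) gamma c1 ->
          kappa <= Num.sqrt 2 * c1]).
Proof.
have [W [hW [c0 [a0 [c0_gt0 a0_ge0 gamma0 hb _]]]]] := hA.
have [c3_gt0 hC3] := hC.
pose j0 : 'I_k := Ordinal hk.
split.
  exact: (canonical_metric_lil hcont hgauss gamma0 hx0 hlohi j0 hW c0_gt0 a0_ge0 hb c3_gt0 hC3).
split; last first.
  exact: (Delta_lil hcont hgauss gamma0 hx0 hlohi j0 hW c0_gt0 a0_ge0 hb c3_gt0 hC3).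
have [c1 _ hc1] := canonical_metric_le_Delta hW c0_gt0 a0_ge0 gamma0 hb.
by exists c1.
Qed.
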